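(* Let $\Phi$ be an $\mathbb H^{n\times n}$-valued slice-hyperholomorphic rational function belonging to $\mathcal{GPE}(\mathbb H)$ (generalized positive even), slice hyperholomorphic at infinity with value $I_n$ there, i.e. $\lim_{p\to\infty}\Phi(p)=I_n$, and with minimal realization $$\Phi(p)=I_n+C\star(pI_N-A)^{-\star}\star B .$$ Then there exist $\mathbb H^{n\times n}$-valued slice-hyperholomorphic rational functions $L_+$ and $L_-$, respectively without poles and zeros in the open right half-space $\{\mathrm{Re}\,p>0\}$ and in the open left half-space $\{\mathrm{Re}\,p<0\}$, uniquely determined by the condition $L_\pm(\infty)=I_n$, and such that $$\Phi(p)=L_+^\sharp(p)\star L_+(p)=L_-^\sharp(p)\star L_-(p).$$
   Context: $\mathbb H$ denotes the quaternions, with units $i,j,k$; a quaternion is written $p=x+Iy$ with $x,y\in\mathbb R$ and $I$ in the sphere $\mathbb S$ of purely imaginary quaternions of norm $1$. The sphere of $p$ is $[p]=\{x+Jy: J\in\mathbb S\}$. $M^*$ is the conjugate transpose. Slice-hyperholomorphic rational functions: an $\mathbb H^{n\times m}$-valued slice-hyperholomorphic rational function is a function $\Phi(p)=Q(p)^{-1}\sum_{k} p^kP_k$ (finite sum), where $Q$ is a nonzero polynomial with real coefficients and $P_k\in\mathbb H^{n\times m}$. It is determined by its restriction to real $p=x$. Star product: $\big(Q_1(p)^{-1}\sum_k p^kF_k\big)\star\big(Q_2(p)^{-1}\sum_\ell p^\ell G_\ell\big)=(Q_1(p)Q_2(p))^{-1}\sum_{k,\ell}p^{k+\ell}F_kG_\ell$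 (so it is the slice-hyperholomorphic extension of the pointwise product on the real axis); $^{-\star}$ denotes the inverse for $\star$. Map $\chi$: writing a quaternionic matrix as $A=A_1+A_2j$ with $A_1,A_2$ complex (in the units $1,i$), $\chi(A)=\begin{pmatrix}A_1&A_2\\-\overline{A_2}&\overline{A_1}\end{pmatrix}$. To $\Phi$ is associated the complex rational matrix function $R_\Phi(z)=Q(z)^{-1}\sum_k z^k\chi(P_k)$. Poles and zeros: $\Phi$ has a pole at the sphere $[x+Iy]$ if $R_\Phi$ has a pole at $x+iy$; when $\Phi$ is square and $\star$-invertible, its zeros are the poles of $\Phi^{-\star}$. Sharp: for $\Phi(p)=\sum_k p^k\Phi_k$, $\Phi^\sharp(p)=\sum_k(-p)^k\Phi_k^*$; for a general rational $\Phi=Q(p)^{-1}\sum_k p^kP_k$ this means $\Phi^\sharp(p)=Q(-p)^{-1}\sum_k(-p)^kP_k^*$, i.e. the slice-hyperholomorphic rational function with $\Phi^\sharp(x)=\Phi(-x)^*$ for real $x$. $\Phi$ is called even if $\Phi^\sharp=\Phi$. Kernel: $K_\Phi(p,q)=(\Phi(p)+\Phi(q)^* )\star(p+\overline q)^{-\star}$ ($\star$-product in $p$), explicitly $K_\Phi(p,q)=(p^2+2\,\mathrm{Re}(q)\,p+|q|^2)^{-1}(pX+Xq)$ with $X=\Phi(p)+\Phi(q)^*$; equivalently $pK_\Phi(p,q)+K_\Phi(p,q)\overline q=\Phi(p)+\Phi(q)^*$. Negative squares: an $\mathbb H^{n\times n}$-valued kernel $K(p,q)$ on a set $\Omega$ has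 $\kappa$ negative squares if $K(p,q)=K(q,p)^*$ on $\Omega$ and, for every $M\in\mathbb N$, $p_1,\dots,p_M\in\Omega$, $c_1,\dots,c_M\in\mathbb H^n$, the quaternionic Hermitian matrix with $(s,t)$ entry $c_s^*K(p_s,p_t)c_t$ has at most $\kappa$ strictly negative eigenvalues, and exactly $\kappa$ for some choice. It has a finite number of negative squares if this holds for some finite $\kappa$. $\mathcal{GPE}(\mathbb H)$: $\Phi$ is generalized positive even if it is even and $K_\Phi$ has a finite number of negative squares in the open right half-space $\{\mathrm{Re}\,p>0\}$ from which the spheres of poles of $\Phi$ are removed. Realization: $D+C\star(pI_N-A)^{-\star}\star B$, with $A\in\mathbb H^{N\times N}$, $B\in\mathbb H^{N\times n}$, $C\in\mathbb H^{n\times N}$, $D\in\mathbb H^{n\times n}$, is the slice-hyperholomorphic rational function equal to $D+C(xI_N-A)^{-1}B$ for real $x$; the realization is minimal if $N$ is the smallest possible. *)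

(* Defs.v *)
From HB Require Import structures.
From mathcomp Require Import all_boot all_order all_algebra.
From mathcomp Require Import complex.
From mathcomp Require Import boolp classical_sets reals.
From mathcomp Require Import ring.

Set Implicit Arguments.
Unset Strict Implicit.
Unset Printing Implicit Defensive.

Import Order.TTheory GRing.Theory Num.Theory.
Local Open Scope ring_scope.

Record quat (R : Type) := Quat { qre : R; qpi : R; qpj : R; qpk : R }.

Section QuatChoice.
Variable R : choiceType.

Definition prod_of_quat (p : quat R) := (qre p, qpi p, qpj p, qpk p).
Definition quat_of_prod (t : R * R * R * R) :=
  Quat t.1.1.1 t.1.1.2 t.1.2 t.2.

Lemma prod_of_quatK : cancel prod_of_quat quat_of_prod.
Proof. by case. Qed.

HB.instance Definition _ := Choice.copy (quat R) (can_type prod_of_quatK).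
End QuatChoice.

Section QuatRing.
Variable R : rcfType.
Implicit Types p q r : quat R.

Definition qadd p q :=
  Quat (qre p + qre q) (qpi p + qpi q) (qpj p + qpj q) (qpk p + qpk q).
Definition qopp p := Quat (- qre p) (- qpi p) (- qpj p) (- qpk p).
Definition qmul p q :=
  let: Quat a b c d := p in
  let: Quat a' b' c' d' := q in
  Quat (a * a' - b * b' - c * c' - d * d')
       (a * b' + b * a' + c * d' - d * c')
       (a * c' - b * d' + c * a' + d * b')
       (a * d' + b * c' - c * b' + d * a').

Definition qreal (x : R) : quat R := Quat x 0 0 0.

Fact qaddA : associative qadd.
Proof. by move=> [????] [????] [????]; rewrite /qadd /= !addrA. Qed.
Fact qaddC : commutative qadd.
Proof.
by move=> [a b c d] [????]; rewrite /qadd /= (addrC a) (addrC b) (addrC c) (addrC d).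
Qed.
Fact qadd0 : left_id (qreal 0) qadd.
Proof. by move=> [????]; rewrite /qadd /= !add0r. Qed.
Fact qaddN : left_inverse (qreal 0) qopp qadd.
Proof. by move=> [????]; rewrite /qadd /= !addNr. Qed.

HB.instance Definition _ := GRing.isZmodule.Build (quat R) qaddA qaddC qadd0 qaddN.

Fact qmulA : associative qmul.
Proof. by move=> [????] [????] [????]; congr Quat; ring. Qed.
Fact qmul1l : left_id (qreal 1) qmul.
Proof. by move=> [????]; congr Quat; ring. Qed.
Fact qmul1r : right_id (qreal 1) qmul.
Proof. by move=> [????]; congr Quat; ring. Qed.
Fact qmulDl : left_distributive qmul qadd.
Proof. by move=> [????] [????] [????]; congr Quat => /=; ring. Qed.
Fact qmulDr : right_distributive qmul qadd.
Proof. by move=> [????] [????] [????]; congr Quat => /=; ring. Qed.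
Fact qone_neq0 : qreal 1 != qreal 0.
Proof. by apply/eqP => -[] /eqP; rewrite oner_eq0. Qed.

HB.instance Definition _ :=
  GRing.Zmodule_isNzRing.Build (quat R) qmulA qmul1l qmul1r qmulDl qmulDr qone_neq0.

Definition qconj p := Quat (qre p) (- qpi p) (- qpj p) (- qpk p).
Definition qnormsq p : R := qre p ^+ 2 + qpi p ^+ 2 + qpj p ^+ 2 + qpk p ^+ 2.
Definition qnorm p : R := Num.sqrt (qnormsq p).
Definition qimnorm p : R := Num.sqrt (qpi p ^+ 2 + qpj p ^+ 2 + qpk p ^+ 2).
Definition qinv p :=
  let s := (qnormsq p)^-1 in
  Quat (qre p * s) (- qpi p * s) (- qpj p * s) (- qpk p * s).

Fact qnormsq_eq0 p : (qnormsq p == 0) = (p == 0).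
Proof.
apply/idP/eqP => [|->]; last by rewrite /qnormsq /= expr0n /= !addr0.
case: p => a b c d; rewrite /qnormsq /=.
rewrite !paddr_eq0 ?addr_ge0 ?sqr_ge0 // !sqrf_eq0.
by move=> /andP[/andP[/andP[/eqP-> /eqP->] /eqP->] /eqP->].
Qed.

Fact qmulVq : {in [pred p | p != 0], left_inverse (1 : quat R) qinv *%R}.
Proof.
move=> p; rewrite inE -qnormsq_eq0; case: p => a b c d np.
have E : (qnormsq (Quat a b c d))^-1 * qnormsq (Quat a b c d) = 1 by rewrite mulVf.
rewrite /qinv; set s := _^-1 in E *; rewrite /qnormsq /= in E.
by clearbody s; congr Quat => /=; [rewrite -E; ring | ring..].
Qed.

Fact qmulqV : {in [pred p | p != 0], right_inverse (1 : quat R) qinv *%R}.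
Proof.
move=> p; rewrite inE -qnormsq_eq0; case: p => a b c d np.
have E : (qnormsq (Quat a b c d))^-1 * qnormsq (Quat a b c d) = 1 by rewrite mulVf.
rewrite /qinv; set s := _^-1 in E *; rewrite /qnormsq /= in E.
by clearbody s; congr Quat => /=; [rewrite -E; ring | ring..].
Qed.

Fact quat_unitP p q : q * p = 1 /\ p * q = 1 -> p != 0.
Proof.
move=> [qp _]; apply/eqP => p0; move/eqP: qp.
by rewrite p0 mulr0 eq_sym oner_eq0.
Qed.

Fact qinv_out : {in [predC [pred p | p != 0]], qinv =1 id}.
Proof.
move=> p; rewrite !inE negbK => /eqP ->.
by rewrite /qinv /= !(mul0r, oppr0).
Qed.

HB.instance Definition _ := GRing.NzRing_hasMulInverse.Build (quat R)
  qmulVq qmulqV quat_unitP qinv_out.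

End QuatRing.

Section QuatMatrices.
Variable R : rcfType.
Notation H := (quat R).

Definition ctrmx n m (A : 'M[H]_(n, m)) : 'M[H]_(m, n) := map_mx (@qconj R) A^T.

(* Writing a + bi + cj + dk = (a + bi) + (c + di)j, these are the two complex
   parts, so that A = A1 + A2 j with A1 := map_mx qchi1 A, A2 := map_mx qchi2 A. *)
Definition qchi1 (p : H) : R[i] := (qre p +i* qpi p)%C.
Definition qchi2 (p : H) : R[i] := (qpj p +i* qpk p)%C.

Definition chi n m (A : 'M[H]_(n, m)) : 'M[R[i]]_(n + n, m + m) :=
  block_mx (map_mx qchi1 A) (map_mx qchi2 A)
           (- map_mx (conjc \o qchi2) A) (map_mx (conjc \o qchi1) A).

(* At least k strictly negative eigenvalues, counted with multiplicity: the
   columns of V are k right-linearly independent eigenvectors,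
   A v_j = v_j d_j with d_j < 0. *)
Definition neg_eig_ge M (A : 'M[H]_M) (k : nat) : Prop :=
  exists (V : 'M[H]_(M, k)) (d : 'rV[R]_k),
    [/\ forall j, d 0 j < 0,
        A *m V = V *m diag_mx (map_mx (@qreal R) d)
      & forall c : 'cV[H]_k, V *m c = 0 -> c = 0].

Definition neg_eig_le M (A : 'M[H]_M) (kappa : nat) : Prop :=
  forall k, neg_eig_ge A k -> (k <= kappa)%N.

Definition gram n (K : H -> H -> 'M[H]_n) M
    (p : 'I_M -> H) (c : 'I_M -> 'cV[H]_n) : 'M[H]_M :=
  \matrix_(s, t) (ctrmx (c s) *m K (p s) (p t) *m c t) 0 0.

Definition has_negative_squares n (Omega : set H)
    (K : H -> H -> 'M[H]_n) (kappa : nat) : Prop :=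
  [/\ forall p q, Omega p -> Omega q -> K p q = ctrmx (K q p),
      forall M (p : 'I_M -> H) (c : 'I_M -> 'cV[H]_n),
        (forall s, Omega (p s)) -> neg_eig_le (gram K p c) kappa
    & exists M (p : 'I_M -> H) (c : 'I_M -> 'cV[H]_n),
        [/\ forall s, Omega (p s), neg_eig_ge (gram K p c) kappa
          & neg_eig_le (gram K p c) kappa]].

End QuatMatrices.

Section SliceRational.
Variable R : rcfType.
Notation H := (quat R).

(* The fraction Q(p)^-1 (sum_k p^k P_k).  The P_k are the coefficients of the
   matrix of polynomials [snum]; as 'X is central in {poly H}, the product of
   {poly H} is the star product of polynomials.  Two fractions can be equal as
   functions without being equal as records: see [sreq]. *)
Record srat (n m : nat) := SRat {
  sden : {poly R};
  sden_neq0 : sden != 0;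
  snum : 'M[{poly H}]_(n, m) }.

Definition polyH (Q : {poly R}) : {poly H} := map_poly (@qreal R) Q.

(* sum_k p^k f_k.  The powers are on the left, unlike in [horner]. *)
Definition leval (f : {poly H}) (p : H) : H := \sum_(k < size f) p ^+ k * f`_k.

Definition sden_at n m (F : srat n m) (p : H) : H := leval (polyH (sden F)) p.

Definition frac_at n m (F : srat n m) (p : H) : 'M[H]_(n, m) :=
  (sden_at F p)^-1 *: map_mx (leval^~ p) (snum F).

Definition sreq n m (F G : srat n m) : Prop :=
  forall p, sden_at F p != 0 -> sden_at G p != 0 -> frac_at F p = frac_at G p.

(* The value at p, computed on any fraction equal to F whose denominator does
   not vanish at p; so removable singularities are removed. *)
Definition sval_at n m (F : srat n m) (p : H) : 'M[H]_(n, m) :=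
  xget 0 [set v | exists G : srat n m,
                    [/\ sreq F G, sden_at G p != 0 & v = frac_at G p]].

Definition sconst n m (D : 'M[H]_(n, m)) : srat n m :=
  SRat (oner_neq0 _) (map_mx polyC D).

Definition sadd n m (F G : srat n m) : srat n m :=
  SRat (mulf_neq0 (sden_neq0 F) (sden_neq0 G))
       (polyH (sden G) *: snum F + polyH (sden F) *: snum G).

Definition smul n m l (F : srat n m) (G : srat m l) : srat n l :=
  SRat (mulf_neq0 (sden_neq0 F) (sden_neq0 G)) (snum F *m snum G).

Definition is_sinv n (F G : srat n n) : Prop :=
  sreq (smul F G) (sconst 1%:M) /\ sreq (smul G F) (sconst 1%:M).

Fact comp_polyNX_neq0 (Q : {poly R}) : Q != 0 -> Q \Po (- 'X) != 0.
Proof.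
move=> Q0; rewrite -size_poly_eq0 size_comp_poly2 ?size_poly_eq0 //.
by rewrite size_polyN size_polyX.
Qed.

Definition sharp_poly (f : {poly H}) : {poly H} :=
  \poly_(k < size f) ((-1) ^+ k * qconj f`_k).

Definition ssharp n m (F : srat n m) : srat m n :=
  SRat (comp_polyNX_neq0 (sden_neq0 F)) (map_mx sharp_poly (snum F)^T).

Definition seven n (F : srat n n) : Prop := sreq (ssharp F) F.

(* sum_k z^k chi(P_k), where P_k collects the coefficients of index k *)
Definition chi_poly n m (P : 'M[{poly H}]_(n, m)) :
    'M[{poly R[i]}]_(n + n, m + m) :=
  let N := (\max_i \max_j size (P i j))%N in
  \matrix_(a, b) \poly_(k < N) chi (map_mx (fun f : {poly H} => f`_k) P) a b.

Definition ratio_pole (f g : {poly R[i]}) (z : R[i]) : bool :=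
  (f != 0) && (mup z f < mup z g)%N.

(* R_F = Q^-1 (sum_k z^k chi(P_k)) has a pole at z *)
Definition Rpole n m (F : srat n m) (z : R[i]) : bool :=
  [exists a, exists b,
    ratio_pole (chi_poly (snum F) a b) (map_poly (real_complex R) (sden F)) z].

(* x + iy with p = x + Iy and y >= 0; [Rpole F] is invariant under conjugation. *)
Definition spole n m (F : srat n m) (p : H) : bool :=
  Rpole F (qre p +i* qimnorm p)%C.

Definition no_poles_in n m (Omega : set H) (F : srat n m) : Prop :=
  forall p, Omega p -> ~~ spole F p.

(* Zeros are only defined for star-invertible F, as the poles of the inverse. *)
Definition no_zeros_in n (Omega : set H) (F : srat n n) : Prop :=
  exists G : srat n n, is_sinv F G /\ no_poles_in Omega G.

Definition right_half : set H := [set p | 0 < qre p].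
Definition left_half : set H := [set p | qre p < 0].

Definition svalue_infty n m (F : srat n m) (D : 'M[H]_(n, m)) : Prop :=
  forall eps : R, 0 < eps -> exists r : R, forall p : H, r < qnorm p ->
    ~~ spole F p /\ forall i j, qnorm (sval_at F p i j - D i j) < eps.

(* X star (p + conj q)^(-star), written out: for 0 < Re p and 0 < Re q the
   denominator does not vanish. *)
Definition skernel n (F : srat n n) (p q : H) : 'M[H]_n :=
  let X := sval_at F p + ctrmx (sval_at F q) in
  (p ^+ 2 + qreal (2 * qre q) * p + qreal (qnormsq q))^-1 *:
    (p *: X + X *m q%:M).

Definition GPE n (F : srat n n) : Prop :=
  seven F /\
  exists kappa, has_negative_squares
    [set p | right_half p /\ ~~ spole F p] (skernel F) kappa.

Definition spencil N (A : 'M[H]_N) : srat N N :=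
  SRat (oner_neq0 _) ('X%:M - map_mx polyC A).

Definition realization n N (F : srat n n) (A : 'M[H]_N) (B : 'M[H]_(N, n))
    (C : 'M[H]_(n, N)) (D : 'M[H]_n) : Prop :=
  exists W : srat N N, is_sinv (spencil A) W /\
    sreq F (sadd (sconst D) (smul (smul (sconst C) W) (sconst B))).

Definition minimal_realization n N (F : srat n n) (A : 'M[H]_N)
    (B : 'M[H]_(N, n)) (C : 'M[H]_(n, N)) (D : 'M[H]_n) : Prop :=
  realization F A B C D /\
  forall N' (A' : 'M[H]_N') (B' : 'M[H]_(N', n)) (C' : 'M[H]_(n, N'))
      (D' : 'M[H]_n),
    realization F A' B' C' D' -> (N <= N')%N.

Definition normalized_factor n (Omega : set H) (F L : srat n n) : Prop :=
  [/\ no_poles_in Omega L, no_zeros_in Omega L, svalue_infty L 1%:M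
    & sreq F (smul (ssharp L) L)].

End SliceRational.

(* Main.v *)
(** The complex rational matrix function R_Phi attached to Phi by chi is an even
    matrix function.  Counting negative squares on points [e + i y_s], as [e] tends
    to 0, forces R_Phi to be nonnegative on the imaginary axis.  A Cholesky
    factorization over the polynomials, whose scalar pivots are factored root by
    root, then gives R_Phi = M^# M / (g^# g) with no control on the zeros of M and
    g; multiplying M on the left by Blaschke-Potapov factors reflects every zero in
    the wrong half-plane without changing M^# M.  Two normalized factors L, L'
    differ by U = L' L^-1 with U^# U = I, regular off the axis by the location of
    the poles and zeros, and on the axis because it is isometric there; so U is
    constant, and it is I at infinity.  This uniqueness also shows that the factor
    is invariant under the antilinear symmetry that characterizes the range of chi,
    hence is quaternionic. *)

Require Import Defs.
From HB Require Import structures.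
From mathcomp Require Import all_boot all_order all_algebra.
From mathcomp Require Import complex polyrcf.
From mathcomp Require Import boolp classical_sets reals.
From mathcomp Require Import ring lra zify.

Set Implicit Arguments.
Unset Strict Implicit.
Unset Printing Implicit Defensive.

Import Order.TTheory GRing.Theory Num.Theory.
Local Open Scope ring_scope.

(** * Scalar spectral factorization *)

(** Rational matrices are handled as a polynomial matrix over a scalar polynomial and identities are
    cleared of denominators: absence of a pole becomes [regular_at], and the value I at infinity
    becomes strict properness of F - I, a degree inequality. The kernel is tied to R_Phi by p K + K
    conj q = Phi(p) + conjugate transpose of Phi(q). At a single point z, tested on the two pieces
    of a complex vector u, it gives Re z times a compressed Gram entry as Re(u^* R(z) u). A negative
    value near the axis thus makes a diagonal entry blow up like 1 / Re z, while entries between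
    distinct spheres stay bounded. Negative squares are defined through eigenvectors over a skew
    field, so a negative definite compression does not suffice by itself. Eigenvectors are produced
    one at a time as real polynomials in the Gram matrix applied to a vector; this form preserves
    orthogonality to those already found. The denominator g of the complex factor M / g need not be
    real. The quaternionic factor is therefore read from (conj g M) / (g conj g), with conj acting
    on coefficients. *)

Section Sharp.
Variable C : numClosedFieldType.
Implicit Types (f g h a : {poly C}) (z t : C).

(** The map z |-> - conj z fixes exactly the imaginary axis, and there [csharp] is pointwise
    conjugation. The equation [z = - z^*] is how axis points are recognized throughout. *)
Definition csharp f : {poly C} := map_poly Num.conj f \Po (- 'X).

HB.instance Definition _ :=
  GRing.RMorphism.copy csharp (comp_poly (- 'X) \o map_poly Num.conj).

Lemma csharpE f z : (csharp f).[z] = (f.[- z^*])^*.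
Proof.
rewrite /csharp horner_comp hornerN hornerX -[- z]conjCK rmorphN /=.
by rewrite horner_map.
Qed.

Lemma csharpC z : csharp z%:P = (z^*)%:P.
Proof. by rewrite /csharp map_polyC /= comp_polyC. Qed.

Lemma csharpX : csharp 'X = - 'X.
Proof. by rewrite /csharp map_polyX comp_polyX. Qed.

Lemma coef_csharp f k : (csharp f)`_k = (-1) ^+ k * (f`_k)^*.
Proof.
have E i : csharp (f`_i *: 'X^i) = ((-1) ^+ i * (f`_i)^*) *: 'X^i.
  rewrite -mul_polyC rmorphM /= csharpC rmorphXn /= csharpX [(- 'X) ^+ i]exprNn.
  by rewrite mulrCA mulrA -mul_polyC rmorphM rmorphXn rmorphN rmorph1.
rewrite -{1}[f]coefK poly_def rmorph_sum /=.
under eq_bigr do rewrite E.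
rewrite -(poly_def _ (fun i => (-1) ^+ i * (f`_i)^*)) coef_poly.
by case: ltnP => // /(nth_default 0) ->; rewrite rmorph0 mulr0.
Qed.

Lemma csharpK : involutive csharp.
Proof.
move=> f; apply/polyP => k; rewrite !coef_csharp rmorphM /= conjCK.
by rewrite rmorphXn rmorphN rmorph1 /= mulrA -exprMn mulrNN mulr1 expr1n mul1r.
Qed.

Lemma csharp_eq0 f : (csharp f == 0) = (f == 0).
Proof. by rewrite -[in RHS](inj_eq (can_inj csharpK)) rmorph0. Qed.

Lemma csharpXsubC z : csharp ('X - z%:P) = - ('X + (z^*)%:P).
Proof. by rewrite rmorphB /= csharpC csharpX opprD. Qed.

Lemma size_csharp f : size (csharp f) = size f.
Proof.
by rewrite /csharp size_comp_poly2 ?size_polyN ?size_polyX// size_map_poly.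
Qed.

Lemma csharp_axis f z : z = - z^* -> (csharp f).[z] = (f.[z])^*.
Proof. by move=> {2}->; rewrite csharpE. Qed.

(** Continuity at 0 over an abstract closed field, as a Lipschitz bound on the unit disc obtained
    along the Horner scheme. *)
Lemma horner_near0 f : exists2 B, 0 < B &
  forall t, `|t| <= 1 -> `|f.[t] - f.[0]| <= `|t| * B.
Proof.
elim/poly_ind: f => [|f c [B B0 fB]].
  by exists 1 => // t _; rewrite !horner0 subrr normr0 mulr1.
exists (B + `|f.[0]|) => [|t t1]; first by rewrite ltr_pwDl.
rewrite !hornerMXaddC mulr0 add0r addrK normrM mulrC ler_wpM2l //.
rewrite -[f.[t]](subrK f.[0]) (le_trans (ler_normD _ _)) // lerD2r.
by rewrite (le_trans (fB t t1)) // ler_piMl // ltW.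
Qed.

(** For complex numbers [0 <= x] also asserts that x is real, so the claim amounts to f(0) =
    |f(0)|. *)
Lemma horner_lim_ge0 f : (forall t, 0 < t -> 0 <= f.[t]) -> 0 <= f.[0].
Proof.
move=> f0; have [B B0 fB] := horner_near0 f.
suff: f.[0] - `|f.[0]| == 0 by rewrite subr_eq0 => /eqP ->.
rewrite -normr_eq0; apply/negPn/negP => nz.
set e := `|_| in nz; have e0 : 0 < e by rewrite lt_def nz normr_ge0.
(* Here e = |f(0) - |f(0)||. Since f(t) equals its own norm, the triangle inequality gives e <= 2 t
   B, and this t makes 2 t B < e. *)
pose t := e / (e + (B + B)).
have D0 : 0 < e + (B + B) by rewrite !addr_gt0.
have t0 : 0 < t by rewrite divr_gt0.
have t1 : `|t| <= 1.
  by rewrite gtr0_norm // ler_pdivrMr // mul1r lerDl ltW // addr_gt0.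
have h1 := fB t t1.
have h2 : `| `|f.[0]| - f.[t]| <= `|t| * B.
  rewrite -[in X in _ - X](ger0_norm (f0 t t0)) (le_trans (ler_dist_dist _ _)) //.
  by rewrite distrC.
have: e <= `|t| * (B + B).
  rewrite mulrDr; apply: le_trans (lerD h1 h2).
  by rewrite [leRHS]addrC /e distrC ler_distD.
rewrite gtr0_norm // /t mulrAC ler_pdivlMr // mulrDr gerDr.
by rewrite lt_geF ?mulr_gt0.
Qed.

(** Put b(t) = i g(z + i t). For real t the hypothesis says t b(t) >= 0, so b is nonnegative to the
    right of 0 and nonpositive to the left; hence b(0) = 0. *)
Lemma root_axis_double g z : z = - z^* ->
  (forall x, x = - x^* -> 0 <= (('X - z%:P) * g).[x]) -> root g z.
Proof.
move=> zE pos; pose b := 'i *: (g \Po (z%:P + 'i *: 'X)).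
have bE t : b.[t] = 'i * g.[z + 'i * t].
  by rewrite /b hornerZ horner_comp hornerD hornerC hornerZ hornerX.
have key t : t \is Num.real -> 0 <= t * b.[t].
  move=> tr; have /= := pos (z + 'i * t).
  rewrite rmorphD rmorphM /= conjCi (CrealP tr) mulNr opprD opprK -zE => /(_ erefl).
  rewrite hornerM hornerXsubC [z + _ - z]addrC addKr bE [t * _]mulrA.
  by rewrite [t * _]mulrC.
have p1 : 0 <= b.[0].
  by apply: horner_lim_ge0 => t t0; rewrite -(pmulr_rge0 _ t0) key ?gtr0_real.
have p2 : 0 <= (- (b \Po (- 'X))).[0].
  apply: horner_lim_ge0 => t t0; rewrite -(pmulr_rge0 _ t0).
  rewrite !hornerE horner_comp hornerN hornerX mulrN -mulNr.
  by rewrite key // rpredN gtr0_real.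
move: p2; rewrite hornerN horner_comp hornerN hornerX oppr0 oppr_ge0 => p2.
have : b.[0] == 0 by rewrite eq_le p1 p2.
by rewrite bE mulr0 addr0 mulf_eq0 (negPf (neq0Ci _)).
Qed.

(** At an axis point other than z the removed factor is |x - z|^2 > 0. If z itself lies on the axis,
    its value is reached as a limit along the axis. *)
Lemma axis_ge0_cancel g z :
  (forall x, x = - x^* -> 0 <= (csharp ('X - z%:P) * ('X - z%:P) * g).[x]) ->
  forall x, x = - x^* -> 0 <= g.[x].
Proof.
move=> pos; have key x : x = - x^* -> x != z -> 0 <= g.[x].
  move=> xE xz; move: (pos x xE); rewrite !hornerM csharp_axis //.
  by rewrite [_^* * _]mulrC pmulr_rge0 // mul_conjC_gt0 hornerXsubC subr_eq0.
move=> x xE; have [zx|] := eqVneq x z; last exact: key.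
have := @horner_lim_ge0 (g \Po (x%:P + 'i *: 'X)).
rewrite horner_comp hornerD hornerC hornerZ hornerX mulr0 addr0; apply=> t t0.
rewrite horner_comp hornerD hornerC hornerZ hornerX key //.
  by rewrite rmorphD rmorphM /= conjCi (CrealP (gtr0_real t0)) mulNr opprD opprK -xE.
by rewrite -zx -subr_eq0 addrC addKr mulf_eq0 (negPf (neq0Ci _)) gt_eqF.
Qed.

(** Fejer-Riesz for the imaginary axis. Since a^# = a the roots are symmetric under z |-> - conj z,
    and a root on the axis is at least double; so p^# p with p = X - z splits off and the degree
    drops by two. *)
Lemma scalar_spectral_factor a : csharp a = a ->
  (forall x, x = - x^* -> 0 <= a.[x]) -> exists h, a = csharp h * h.
Proof.
have [n] := ubnP (size a); elim: n a => // n IHn a; rewrite ltnS => san aE pos.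
have [sa|sa] := leqP (size a) 1.
  have := pos 0; rewrite (size1_polyC sa) hornerC rmorph0 oppr0 => /(_ erefl) c0.
  exists (sqrtC a`_0)%:P; rewrite csharpC -polyCM; congr _%:P.
  by rewrite (CrealP (ger0_real _)) ?sqrtC_ge0 // -expr2 sqrtCK.
have [z /factor_theorem [b ab]] : exists z, root a z.
  by apply/closed_rootP; rewrite gtn_eqF.
have a0 : a != 0 by apply/eqP => a0; rewrite a0 size_poly0 in sa.
pose p : {poly C} := 'X - z%:P.
have p0 : p != 0 by rewrite polyXsubC_eq0.
have ps0 : csharp p != 0 by rewrite csharp_eq0.
have [c ac] : exists c : {poly C}, a = csharp p * p * c.
  have rb : root b (- z^*).
    have [zE|zE] := eqVneq z (- z^*).
      rewrite -zE; apply: (root_axis_double zE) => x xE.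
      by rewrite mulrC -ab pos.
    have : root a (- z^*).
      rewrite -aE /root csharpE rmorphN /= conjCK opprK ab hornerM hornerXsubC.
      by rewrite subrr mulr0 rmorph0.
    by rewrite ab rootM root_XsubC [_ == z]eq_sym (negPf zE) orbF.
  (* The sign comes from (X - z)^# = - (X + conj z). *)
  have /factor_theorem [c bc] := rb; exists (- c).
  by rewrite ab bc csharpXsubC polyCN opprK mulrN mulNr mulNr opprK /p; ring.
have cE : csharp c = c.
  apply: (mulfI (mulf_neq0 ps0 p0)); apply: (etrans _ ac).
  by rewrite -aE ac !rmorphM /= csharpK [p * _]mulrC.
have [||h ch] := IHn c _ cE; last by exists (h * p); rewrite ac ch rmorphM /=; ring.
  apply: leq_trans san; have [->|c0] := eqVneq c 0.
    by rewrite size_poly0 (leq_trans _ sa).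
  rewrite ac size_mul ?mulf_neq0 // size_mul // size_csharp size_XsubC /=.
  by rewrite leqnSn.
by apply: (@axis_ge0_cancel c z) => x xE; rewrite -/p -ac pos.
Qed.

End Sharp.

(** * Matrix polynomials nonnegative on the imaginary axis *)

Section SharpMatrix.
Variable C : numClosedFieldType.
Implicit Types (f g h a : {poly C}) (z t : C).

Definition csharpmx m n (A : 'M[{poly C}]_(m, n)) : 'M[{poly C}]_(n, m) :=
  map_mx (@csharp C) A^T.

Definition adjmx m n (A : 'M[C]_(m, n)) : 'M[C]_(n, m) := map_mx Num.conj A^T.

Lemma csharpmxM m n p (A : 'M[{poly C}]_(m, n)) (B : 'M[{poly C}]_(n, p)) :
  csharpmx (A *m B) = csharpmx B *m csharpmx A.
Proof. by rewrite /csharpmx trmx_mul map_mxM. Qed.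

Lemma csharpmxZ m n f (A : 'M[{poly C}]_(m, n)) :
  csharpmx (f *: A) = csharp f *: csharpmx A.
Proof. by rewrite /csharpmx linearZ map_mxZ. Qed.

Lemma csharpmxB m n (A B : 'M[{poly C}]_(m, n)) :
  csharpmx (A - B) = csharpmx A - csharpmx B.
Proof. by rewrite /csharpmx linearB map_mxB. Qed.

Lemma csharpmxD m n (A B : 'M[{poly C}]_(m, n)) :
  csharpmx (A + B) = csharpmx A + csharpmx B.
Proof. by rewrite /csharpmx linearD map_mxD. Qed.

Lemma csharpmx0 m n : csharpmx 0 = 0 :> 'M[{poly C}]_(m, n).
Proof. by rewrite /csharpmx trmx0 map_mx0. Qed.

Lemma csharpmx_scalar n f : csharpmx (f%:M : 'M_n) = (csharp f)%:M.
Proof. by rewrite /csharpmx tr_scalar_mx map_scalar_mx. Qed.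

Lemma csharpmxK m n (A : 'M[{poly C}]_(m, n)) : csharpmx (csharpmx A) = A.
Proof. by apply/matrixP => i j; rewrite !mxE csharpK. Qed.

Lemma csharpmx_block m1 m2 n1 n2 (A : 'M[{poly C}]_(m1, n1)) B D (E : 'M_(m2, n2)) :
  csharpmx (block_mx A B D E) =
  block_mx (csharpmx A) (csharpmx D) (csharpmx B) (csharpmx E).
Proof. by rewrite /csharpmx tr_block_mx map_block_mx. Qed.

Lemma det_csharpmx n (A : 'M[{poly C}]_n) : \det (csharpmx A) = csharp (\det A).
Proof. by rewrite /csharpmx det_map_mx det_tr. Qed.

Lemma csharpmx_axis m n (A : 'M[{poly C}]_(m, n)) z : z = - z^* ->
  map_mx (horner_eval z) (csharpmx A) = adjmx (map_mx (horner_eval z) A).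
Proof.
by move=> zE; apply/matrixP => i j; rewrite !mxE /horner_eval csharp_axis.
Qed.

Lemma adjmxM m n p (A : 'M[C]_(m, n)) (B : 'M[C]_(n, p)) :
  adjmx (A *m B) = adjmx B *m adjmx A.
Proof. by rewrite /adjmx trmx_mul map_mxM. Qed.

Lemma adjmxZ m n (x : C) (A : 'M[C]_(m, n)) : adjmx (x *: A) = x^* *: adjmx A.
Proof. by rewrite /adjmx linearZ map_mxZ. Qed.

Definition axis_psd n (N : 'M[{poly C}]_n) := forall z, z = - z^* ->
  forall u : 'cV[C]_n, 0 <= (adjmx u *m map_mx (horner_eval z) N *m u) 0 0.

Lemma poly_axis_eq0 f : (forall z, z = - z^* -> f.[z] = 0) -> f = 0.
Proof.
move=> f0; pose s := [seq 'i * k%:R : C | k <- iota 0 (size f)].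
apply: (@roots_geq_poly_eq0 _ _ s); last by rewrite size_map size_iota.
  apply/allP => _ /mapP[k _ ->]; apply/rootP/f0.
  by rewrite rmorphM /= conjCi conjC_nat mulNr opprK.
rewrite map_inj_uniq ?iota_uniq // => i j /(mulfI (neq0Ci _))/eqP.
by rewrite eqr_nat => /eqP.
Qed.

(* If [a = 0] the minors [- |b_j|^2] are nonnegative on the axis. *)
Lemma psd_zero_corner m (b : 'M[{poly C}]_(1, m)) (D : 'M[{poly C}]_m) :
  axis_psd (block_mx 0 b (csharpmx b) D : 'M_(1 + m)) -> b = 0.
Proof.
move=> pos; apply/rowP => j; rewrite mxE; apply: poly_axis_eq0 => z zE.
set w := (b 0 j).[z]; apply/eqP/negPn/negP => w0.
have ww0 : 0 < w * w^* by rewrite mul_conjC_gt0.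
pose d := (D j j).[z].
(* The test vector (t, e_j) isolates the principal 2 x 2 block with diagonal 0, d and corner w. *)
have key t : 0 <= t^* * w + w^* * t + d.
  have := pos z zE (col_mx t%:M (delta_mx j 0)).
  rewrite map_block_mx csharpmx_axis // map_mx0 /adjmx tr_col_mx map_row_mx.
  rewrite mul_row_block mul_row_col mulmx0 add0r mulmxDl.
  rewrite tr_scalar_mx map_scalar_mx trmx_delta map_delta_mx.
  rewrite mul_scalar_mx -scalemxAl -!colE -rowE !mul_mx_scalar !mxE.
  rewrite (bigD1 j) //= big1 => [|i /negPf ij]; last by rewrite mxE eqxx ij mul0r.
  by rewrite !mxE !eqxx mul1r addr0 [t * _]mulrC addrCA addrA [w^* * _]mulrC.
have d0 : 0 <= d by have := key 0; rewrite rmorph0 mul0r mulr0 !add0r.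
(* This choice of t turns the form into - (d + 2), which is negative because d >= 0. *)
have := key (- ((d + 1) / (w * w^*)) * w).
rewrite !rmorphM rmorphN /= rmorphM fmorphV rmorphM /= conjCK [w^* * w]mulrC.
rewrite rmorphD rmorph1 /= (CrealP (ger0_real d0)).
have -> : - ((d + 1) / (w * w^*)) * w^* * w + w^* * (- ((d + 1) / (w * w^*)) * w)
   = - ((d + 1) + (d + 1)) by field; rewrite w0 conjC_eq0 w0.
rewrite (_ : _ + d = - (d + 1 + 1)); last by ring.
by rewrite oppr_ge0 lt_geF // ltr_wpDl ?addr_ge0 ?ler01 ?ltr01.
Qed.

(* Schur complement, scaled by [a] so that no division occurs. *)
Lemma psd_schur m a (b : 'M[{poly C}]_(1, m)) (D : 'M[{poly C}]_m) :
  csharp a = a -> axis_psd (block_mx a%:M b (csharpmx b) D : 'M_(1 + m)) ->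
  axis_psd (a *: (a *: D - csharpmx b *m b)).
Proof.
move=> aE pos z zE v.
(* The test vector (- b v, a v) is annihilated by the first block row: a (- b v) + b (a v) = 0. *)
have := pos z zE (col_mx (- (map_mx (horner_eval z) b *m v)) (a.[z] *: v)).
have az : (a.[z])^* = a.[z] by rewrite -csharp_axis // aE.
rewrite map_block_mx csharpmx_axis // map_scalar_mx /=.
set be := map_mx _ b; set de := map_mx _ D.
rewrite -mulmxA mul_block_col /adjmx tr_col_mx map_row_mx mul_row_col.
rewrite mul_scalar_mx scalerN -!scalemxAr addNr mulmx0 add0r.
rewrite linearZ map_mxZ /= az -/(adjmx v) -!scalemxAl.
rewrite mulmxN !mulmxA !map_mxZ map_mxB map_mxZ map_mxM csharpmx_axis //.
rewrite -!scalemxAr -!scalemxAl.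
by rewrite mulmxBr mulmxBl -!scalemxAr -scalemxAl !mulmxA mulmxDr mulmxN -scalemxAr addrC
  !mulmxA.
Qed.

Lemma psd_corner m (A : 'M[{poly C}]_1) b d (D : 'M[{poly C}]_m) :
  axis_psd (block_mx A b d D : 'M_(1 + m)) -> axis_psd A.
Proof.
move=> pos z zE u; have := pos z zE (col_mx u 0).
rewrite map_block_mx /adjmx tr_col_mx map_row_mx mul_row_block mul_row_col.
by rewrite trmx0 map_mx0 !mulmx0 !mul0mx !addr0.
Qed.

Lemma psd_cocorner m (A : 'M[{poly C}]_1) b d (D : 'M[{poly C}]_m) :
  axis_psd (block_mx A b d D : 'M_(1 + m)) -> axis_psd D.
Proof.
move=> pos z zE u; have := pos z zE (col_mx 0 u).
rewrite map_block_mx /adjmx tr_col_mx map_row_mx mul_row_block mul_row_col.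
by rewrite trmx0 map_mx0 !mulmx0 !mul0mx !add0r.
Qed.

(** Induction with the scalar corner a as pivot. If a = 0 its row vanishes and the lower block is
    treated alone; otherwise a = h^# h and the induction applies to the scaled Schur complement. The
    multiplier g^# g absorbs the divisions by the pivots. *)
Lemma psd_cholesky m (N : 'M[{poly C}]_m) : csharpmx N = N -> axis_psd N ->
  exists g (M : 'M[{poly C}]_m), g != 0 /\ (csharp g * g) *: N = csharpmx M *m M.
Proof.
elim: m N => [|m IHm] N NE pos.
  by exists 1, 0; rewrite oner_neq0 [LHS]flatmx0 [RHS]flatmx0.
move: N NE pos; rewrite -[m.+1]/(1 + m)%N => N NE pos.
rewrite -(submxK N) in NE pos *.
set a := ulsubmx N 0 0; have aE : ulsubmx N = a%:M by rewrite [LHS]mx11_scalar.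
set b := ursubmx N in NE pos *; set D := drsubmx N in NE pos *.
move: NE; rewrite aE csharpmx_block => /eq_block_mx [E1 _ E3 DE].
have {E1} aS : csharp a = a by move/matrixP/(_ 0 0): E1; rewrite !mxE.
rewrite aE -{}E3 in pos *.
have [a0|a0] := eqVneq a 0.
  rewrite a0 raddf0 in pos *.
  have b0 : b = 0 by apply: psd_zero_corner pos.
  have [g [M [g0 gM]]] := IHm D DE (psd_cocorner pos).
  exists g, (block_mx 0 0 0 M); split=> //.
  rewrite b0 csharpmx_block !csharpmx0 mulmx_block scale_block_mx gM.
  by rewrite !mulmx0 !mul0mx !scaler0 !add0r.
have [h ah] : exists h, a = csharp h * h.
  apply: scalar_spectral_factor => // z zE.
  have := psd_corner pos zE 1%:M; rewrite /adjmx trmx1 map_mx1 mul1mx mulmx1.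
  by rewrite !mxE.
set S := a *: (a *: D - csharpmx b *m b).
have SE : csharpmx S = S.
  by rewrite /S !(csharpmxZ, csharpmxB, csharpmxM) csharpmxK aS DE.
have [g [M [g0 gM]]] := IHm S SE (psd_schur aS pos).
(* With S = a (a D - b^# b) and g^# g S = M^# M, the block rows (g h a, g h b) and (0, M) reproduce
   (g a)^# (g a) N: in the lower corner g^# g a b^# b cancels against the same term of S. *)
exists (g * a), (block_mx (g * h * a)%:M ((g * h) *: b) 0 M).
split; first by rewrite mulf_neq0.
rewrite csharpmx_block csharpmx0 mulmx_block !csharpmx_scalar csharpmxZ -gM.
rewrite !mul0mx !mulmx0 !addr0 scale_block_mx !mul_scalar_mx !mul_mx_scalar.
rewrite !scale_scalar_mx -!scalemxAr -!scalemxAl !scalerA ![csharp (_ * _)]rmorphM /= aS.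
congr block_mx.
- by congr _%:M; rewrite ah; ring.
- by congr (_ *: _); rewrite ah; ring.
- by congr (_ *: _); rewrite ah; ring.
rewrite scalerBr !scalerA addrC -addrA.
have -> : g * h * (csharp g * csharp h) = csharp g * g * a by rewrite ah; ring.
by rewrite addNr addr0; congr (_ *: _); ring.
Qed.

End SharpMatrix.

(** * Reflecting zeros, normalization and uniqueness *)

Lemma scalemxI (D : idomainType) m n (a : D) (A B : 'M[D]_(m, n)) :
  a != 0 -> a *: A = a *: B -> A = B.
Proof.
move=> a0 /matrixP AB; apply/matrixP => i j.
by have := AB i j; rewrite !mxE => /(mulfI a0).
Qed.

(** The matrix determinant lemma, multiplied by x because x need not be invertible. The bordered
    matrix E is made block triangular from the right in two ways, and the determinants are
    compared. *)
Lemma det_scalar_add_rank1 (T : comNzRingType) m (x : T) (u : 'cV[T]_m) (v : 'rV[T]_m) :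
  \det (u *m v + x%:M) * x = x ^+ m * (x + (v *m u) 0 0).
Proof.
pose E : 'M_(1 + m) := block_mx 1%:M (- v) u x%:M.
have E1 : E *m block_mx 1%:M v 0 1%:M = block_mx 1%:M 0 u (u *m v + x%:M).
  by rewrite mulmx_block !mulmx0 !mulmx1 !mul1mx !addr0 subrr.
have E2 : E *m block_mx x%:M 0 (- u) 1%:M =
    block_mx (x + (v *m u) 0 0)%:M (- v) 0 x%:M.
  rewrite mulmx_block !mulmx0 !mulmx1 !mul1mx mulmxN mulNmx opprK !add0r mulmxN.
  rewrite mul_scalar_mx mul_mx_scalar subrr raddfD /=; congr (block_mx (_ + _) _ _ _).
  exact: mx11_scalar.
have e1 := congr1 determinant E1; have e2 := congr1 determinant E2.
rewrite !det_mulmx !(det_ublock, det_lblock) !det_scalar !expr1n !expr1 in e1 e2.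
by move: e1 e2; rewrite !(mul1r, mulr1) => <- ->; rewrite mulrC.
Qed.

Lemma coefM_top (T : nzRingType) (f h : {poly T}) d e :
  (size f <= d.+1)%N -> (size h <= e.+1)%N -> (f * h)`_(d + e) = f`_d * h`_e.
Proof.
move=> sf sh; have dlt : (d < (d + e).+1)%N by rewrite ltnS leq_addr.
rewrite coefM (bigD1 (Ordinal dlt)) //= addKn big1 ?addr0 // => i.
rewrite -val_eqE /= neq_ltn => /orP[id|di].
  by rewrite [h`__]nth_default ?mulr0 // (leq_trans sh) // ltn_subRL ltn_add2r id.
by rewrite nth_default ?mul0r // (leq_trans sf).
Qed.

Section ZeroFlip.
Variable C : numClosedFieldType.
Implicit Types (f g h a : {poly C}) (z t : C).

Lemma adjmx_mul_eq0 m n (A : 'M[C]_(m, n)) :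
  (forall j, (adjmx A *m A) j j = 0) -> A = 0.
Proof.
move=> A0; apply/matrixP => i j; rewrite mxE; have := A0 j; rewrite !mxE => /eqP.
rewrite psumr_eq0 => [/allP/(_ i)|k _]; last by rewrite !mxE mulrC mul_conjC_ge0.
by rewrite mem_index_enum !mxE mulrC mul_conjC_eq0 => /(_ isT)/eqP.
Qed.

Lemma mulmx_factor m n (V : 'M[{poly C}]_(m, n)) z :
  map_mx (horner_eval z) V = 0 -> exists W, V = ('X - z%:P) *: W.
Proof.
move=> /matrixP V0; exists (map_mx (fun f => f %/ ('X - z%:P)) V).
apply/matrixP => i j; rewrite !mxE mulrC divpK // dvdp_XsubCl.
by apply/rootP; have := V0 i j; rewrite !mxE.
Qed.

(** Let P be the orthogonal projection onto the line of the adjoint of a left null vector v of M(z).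
    The Blaschke-Potapov factor I - P + (X + conj z) / (X - z) P is isometric on the axis, and P M
    is divisible by X - z, so the product with M is again polynomial. *)
Lemma flip_zero m (M : 'M[{poly C}]_m) z : root (\det M) z ->
  exists M' : 'M[{poly C}]_m, csharpmx M' *m M' = csharpmx M *m M /\
    \det M' * ('X - z%:P) = \det M * ('X + (z^*)%:P).
Proof.
move=> /rootP dz.
have /det0P [v v0 vM] : \det (map_mx (horner_eval z) M) == 0 by rewrite det_map_mx /=
  /horner_eval dz.
set r := (v *m adjmx v) 0 0; have rE : v *m adjmx v = r%:M by exact: mx11_scalar.
have adjK : adjmx (adjmx v) = v by apply/matrixP => i j; rewrite !mxE conjCK.
have r0 : r != 0.
  apply: contra v0 => /eqP r0; rewrite -adjK.
  have -> : adjmx v = 0; last by rewrite /adjmx trmx0 map_mx0.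
  by apply: adjmx_mul_eq0 => j; rewrite ord1 adjK.
have rr : r^* = r.
  have := congr1 (fun A : 'M[C]_1 => A 0 0) (adjmxM v (adjmx v)).
  by rewrite adjK [LHS]mxE [in LHS]mxE.
pose P := r^-1 *: (adjmx v *m v).
have PP : P *m P = P.
  rewrite /P -scalemxAl -scalemxAr mulmxA -[X in X *m v]mulmxA rE.
  by rewrite mul_mx_scalar -scalemxAl !scalerA -mulrA mulVf // mulr1.
have Padj : adjmx P = P by rewrite /P adjmxZ adjmxM adjK fmorphV /= rr.
pose Pp := map_mx polyC P.
have PpPp : Pp *m Pp = Pp by rewrite -map_mxM PP.
have Pps : csharpmx Pp = Pp.
  by rewrite /Pp -[in RHS]Padj; apply/matrixP => i j; rewrite !mxE csharpC.
have [T TE] : exists T, Pp *m M = ('X - z%:P) *: T.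
  apply: mulmx_factor; rewrite map_mxM.
  have -> : map_mx (horner_eval z) Pp = P.
    by apply/matrixP => i j; rewrite !mxE /horner_eval hornerC.
  by rewrite /P -scalemxAl -mulmxA vM mulmx0 scaler0.
(* Chosen so that p + s = X + conj z; then B = p (I - P) + (X + conj z) P is p times the
   Blaschke-Potapov factor. *)
pose s : {poly C} := (z + z^*)%:P.
pose p : {poly C} := 'X - z%:P.
have p0 : p != 0 by rewrite polyXsubC_eq0.
pose B := p%:M + s *: Pp.
exists (M + s *: T).
have BM : p *: (M + s *: T) = B *m M.
  by rewrite mulmxDl mul_scalar_mx -scalemxAl TE scalerDr !scalerA [s * _]mulrC.
have ss : csharp s = s by rewrite csharpC rmorphD /= conjCK addrC.
have ps : csharp p = - (p + s) by rewrite /p /s csharpXsubC polyCD; ring.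
have BB : csharpmx B *m B = (csharp p * p)%:M.
  rewrite csharpmxD csharpmx_scalar csharpmxZ Pps ss mulmxDl !mulmxDr.
  rewrite -!scalemxAl -!scalemxAr PpPp mul_scalar_mx !mul_mx_scalar.
  rewrite mul_scalar_mx !scale_scalar_mx !scalerA -addrA; apply/eqP.
  rewrite -subr_eq0 addrAC subrr add0r -!scalerDl ps.
  by rewrite (_ : _ + _ = 0) ?scale0r //; ring.
split.
  apply: (@scalemxI _ _ _ (csharp p * p)); first by rewrite mulf_neq0 ?csharp_eq0.
  transitivity (csharpmx (p *: (M + s *: T)) *m (p *: (M + s *: T))).
    by rewrite csharpmxZ -scalemxAl -scalemxAr scalerA.
  rewrite BM csharpmxM mulmxA -[_ *m B]mulmxA BB mul_mx_scalar.
  by rewrite -scalemxAl.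
have dB : \det B * p = p ^+ m * ('X + (z^*)%:P).
  have -> : B = map_mx polyC ((z + z^*) *: (r^-1 *: adjmx v)) *m map_mx polyC v + p%:M.
    by rewrite -map_mxM -!scalemxAl -/P map_mxZ addrC.
  rewrite det_scalar_add_rank1 -map_mxM -!scalemxAr rE !mxE eqxx mulr1n mulVf //.
  by rewrite /= mulr1 /p polyCD; congr (_ * _); ring.
apply: (@mulfI _ (p ^+ m)); first by rewrite expf_neq0.
rewrite mulrA -detZ BM det_mulmx -/p mulrAC dB.
by rewrite -!mulrA [_ * \det M]mulrC.
Qed.

(** Zeros are reflected one at a time; the hypothesis on [Om] guarantees that a reflected zero has
    left [Om], so no later step has to return to it. *)
Lemma flip_zeros m (Om : pred C) (M : 'M[{poly C}]_m) :
  (forall z, Om z -> ~~ Om (- z^*)) -> \det M != 0 ->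
  exists M' : 'M[{poly C}]_m, csharpmx M' *m M' = csharpmx M *m M /\
    forall z, Om z -> ~~ root (\det M') z.
Proof.
move=> Om1; have [s dM] := closed_field_poly_normal (\det M) => d0.
(* The leading coefficient is generalized to a polynomial q without roots in [Om], which collects
   the zeros already treated while the list s of the remaining ones shrinks. *)
have {d0} q0 z : Om z -> ~~ root (lead_coef (\det M))%:P z.
  by move=> _; rewrite rootC lead_coef_eq0.
rewrite -mul_polyC in dM; move: (lead_coef _)%:P dM q0 => q.
elim: s q M => [|r s IHs] q M dM q0.
  by exists M; rewrite dM big_nil mulr1.
rewrite big_cons in dM; have [Omr|Omr] := boolP (Om r); last first.
  apply: (IHs (q * ('X - r%:P))); first by rewrite dM mulrA.
  move=> z Omz; rewrite rootM negb_or q0 // root_XsubC.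
  by apply: contraNneq Omr => <-.
have [|M1 [M1M dM1]] := @flip_zero _ M r.
  by rewrite dM !rootM root_XsubC eqxx orbT.
have [||M2 [M2M rM2]] := IHs (q * ('X + (r^*)%:P)) M1.
- apply: (@mulIf _ ('X - r%:P)); first by rewrite polyXsubC_eq0.
  by rewrite dM1 dM; ring.
- move=> z Omz; rewrite rootM negb_or q0 // -[r^*]opprK polyCN root_XsubC.
  by apply: contraTneq Omz => ->; apply: Om1.
by exists M2; rewrite M2M M1M.
Qed.

Lemma flip_zeros_scalar (Om : pred C) g :
  (forall z, Om z -> ~~ Om (- z^*)) -> g != 0 ->
  exists2 h, csharp h * h = csharp g * g & forall z, Om z -> ~~ root h z.
Proof.
move=> Om1 g0; have [|M [ME rM]] := flip_zeros (M := g%:M : 'M_1) Om1.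
  by rewrite det_scalar1.
rewrite [M]mx11_scalar in ME rM; exists (M 0 0) => [|z /rM]; last first.
  by rewrite det_scalar1.
move/(congr1 (fun A : 'M_1 => A 0 0)): ME.
by rewrite !csharpmx_scalar -!scalar_mxM !mxE eqxx !mulr1n.
Qed.

Lemma coef_csharpmxM_top m n (M : 'M[{poly C}]_(m, n)) d j l :
  (forall i j, (size (M i j) <= d.+1)%N) ->
  ((csharpmx M *m M) j l)`_(d + d) =
    (-1) ^+ d * (adjmx (map_mx (coefp d) M) *m map_mx (coefp d) M) j l.
Proof.
move=> sM; rewrite !mxE coef_sum mulr_sumr; apply: eq_bigr => i _.
by rewrite !mxE coefM_top ?size_csharp // coef_csharp mulrA.
Qed.

(** Leading terms cannot cancel: the coefficient of degree 2d in a diagonal entry of M^# M is (-1)^d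
    times the sum of the squared moduli of the degree d coefficients of that column. A crude bound k
    + e is lowered one degree at a time. *)
Lemma size_isometric m n (M : 'M[{poly C}]_(m, n)) k :
  (forall j, (size ((csharpmx M *m M) j j) <= (k + k).+1)%N) ->
  forall i j, (size (M i j) <= k.+1)%N.
Proof.
move=> sS; have [e] : exists e, forall i j, (size (M i j) <= (k + e).+1)%N.
  exists (\max_i \max_j size (M i j)) => i j;
    rewrite leqW // (leq_trans _ (leq_addl _ _)) //.
  exact: leq_trans (leq_bigmax j) (leq_bigmax i).
elim: e => [|e IHe] sM; first by move=> i j; rewrite -[k]addn0.
apply: IHe => i j; suff E : map_mx (coefp (k + e.+1)) M = 0.
  apply/leq_sizeP => t; rewrite leq_eqVlt => /predU1P[<-|kt].
    by move/matrixP/(_ i j): E; rewrite !mxE addnS.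
  by rewrite nth_default // (leq_trans (sM _ _)) // addnS.
apply: adjmx_mul_eq0 => l; apply: (@mulfI _ ((-1) ^+ (k + e.+1))).
  by rewrite signr_eq0.
rewrite -coef_csharpmxM_top // mulr0 nth_default // (leq_trans (sS l)) //.
by rewrite addnS addSn !ltnS leq_add ?leq_addr // ltnW // ltnS leq_addr.
Qed.

(* [M / g] tends to an isometry at infinity; multiply it by the inverse. *)
Lemma normalize_infty m (q g : {poly C}) (A M : 'M[{poly C}]_m) :
  q != 0 -> g != 0 ->
  (forall i j, (size (A i j - q *+ (i == j))%R < size q)%N) ->
  q *: (csharpmx M *m M) = (csharp g * g) *: A ->
  exists U : 'M[C]_m, let M' := map_mx polyC U *m M in
   [/\ U \in unitmx, csharpmx M' *m M' = csharpmx M *m M &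
       forall i j, (size (M' i j - g *+ (i == j))%R < size g)%N].
Proof.
move=> q0 g0 sA MA; set k := (size g).-1; set c := lead_coef g.
have c0 : c != 0 by rewrite lead_coef_eq0.
have sg : size g = k.+1 by rewrite prednK // lt0n size_poly_eq0.
have sgg : size (csharp g * g) = (k + k).+1.
  by rewrite size_mul ?csharp_eq0 // size_csharp sg addnS.
set S := csharpmx M *m M in MA.
(* M^# M / (g^# g) equals A / q, so its difference from I is strictly proper too. *)
have sS i j : (size (S i j - (csharp g * g) *+ (i == j))%R <= k + k)%N.
  have [->|nz] := eqVneq (S i j - (csharp g * g) *+ (i == j)) 0;
    first by rewrite size_poly0.
  have E : q * (S i j - (csharp g * g) *+ (i == j)) =
      (csharp g * g) * (A i j - q *+ (i == j)).
    move/matrixP/(_ i j): MA; rewrite [LHS]mxE [RHS]mxE => MA.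
    by rewrite !mulrBr MA !mulrnAr [q * _]mulrC.
  have nz' : A i j - q *+ (i == j) != 0.
    by apply: contra_neq nz => z; move/eqP: E; rewrite z mulr0 mulf_eq0 (negPf q0) => /eqP.
  move/(congr1 (fun f : {poly C} => size f)): E.
  rewrite size_mul // size_mul ?mulf_neq0 ?csharp_eq0 // sgg.
  by move: (sA i j); set b := size _; set d := size (polyseq (S i j - _));
    move: (size q) b d => x b d; clear; lia.
have sM i j : (size (M i j) <= k.+1)%N.
  apply: size_isometric => l; rewrite -/S -[S l l](subrK (csharp g * g)).
  have := sS l l; rewrite eqxx mulr1n => sSl.
  by rewrite (leq_trans (size_polyD _ _)) // geq_max sgg leqnn andbT leqW.
pose K := map_mx (coefp k) M.
have KK : adjmx K *m K = (c^* * c)%:M.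
  apply/matrixP => i j; apply: (@mulfI _ ((-1) ^+ k)); first by rewrite signr_eq0.
  rewrite -coef_csharpmxM_top // -/S -[S i j](subrK ((csharp g * g) *+ (i == j))).
  rewrite coefD nth_default ?sS // add0r !mxE coefMn coefM_top ?size_csharp ?sg //.
  by rewrite coef_csharp mulrnAr mulrA.
(* As K^* K = |c|^2 I, this U is unitary and U K = c I: the coefficient matrix of degree k becomes
   that of g I. *)
pose U := (c^*)^-1 *: adjmx K.
have cc0 : c^* != 0 by rewrite conjC_eq0.
have UK : U *m K = c%:M.
  by rewrite /U -scalemxAl KK scale_scalar_mx mulrA mulVf // mul1r.
have UU : adjmx U *m U = 1%:M.
  apply: mulmx1C; rewrite /U adjmxZ fmorphV /= conjCK -scalemxAl -scalemxAr scalerA.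
  have -> : adjmx (adjmx K) = K by apply/matrixP => i j; rewrite !mxE conjCK.
  by rewrite KK scale_scalar_mx; congr _%:M; field; rewrite c0 cc0.
exists U => M'; split.
- by case/mulmx1_unit: UU.
- rewrite /M' csharpmxM mulmxA -[_ *m _ *m map_mx _ _]mulmxA.
  have -> : csharpmx (map_mx polyC U) = map_mx polyC (adjmx U).
    by apply/matrixP => i j; rewrite !mxE csharpC.
  by rewrite -map_mxM UU map_mx1 mulmx1.
move=> i j; rewrite sg ltnS; apply/leq_sizeP => t; rewrite leq_eqVlt => /predU1P[<-|kt].
  have := congr1 (fun A : 'M_m => A i j) UK; rewrite !mxE => UKij.
  rewrite coefB coefMn -/c -UKij coef_sum -sumrB big1 // => l _.
  by rewrite !mxE coefCM subrr.
rewrite coefB coefMn [g`_t]nth_default ?sg // mul0rn subr0 mxE coef_sum big1 // => l _.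
by rewrite mxE coefCM nth_default ?mulr0 // (leq_trans (sM _ _)).
Qed.

End ZeroFlip.

Section Uniqueness.
Variable C : numClosedFieldType.
Implicit Types (f g h a : {poly C}) (z t : C).

(* [V / k] has no pole at [z]. *)
Definition regular_at m (V : 'M[{poly C}]_m) k z :=
  exists (V' : 'M[{poly C}]_m) k', k'.[z] != 0 /\ k' *: V = k *: V'.

Lemma regular_at_nonroot m (V : 'M[{poly C}]_m) k z : ~~ root k z -> regular_at V k z.
Proof. by move=> kz; exists V, k. Qed.

Lemma regular_atM m (V W : 'M[{poly C}]_m) k l z :
  regular_at V k z -> regular_at W l z -> regular_at (V *m W) (k * l) z.
Proof.
move=> [V' [k' [k'z VE]]] [W' [l' [l'z WE]]]; exists (V' *m W'), (k' * l').
split; first by rewrite hornerM mulf_neq0.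
by rewrite -!scalerA [l' *: _]scalemxAr WE [k' *: _]scalemxAl VE -scalemxAl -scalemxAr.
Qed.

(** At a root z of k the numerator V vanishes: off the axis by regularity of V / k, on the axis
    because the squared column norms of V(z) equal |k(z)|^2 = 0. Cancelling X - z from V and k
    preserves the hypotheses and lowers the degree of k. *)
Lemma isometric_regular_dvd m (V : 'M[{poly C}]_m) k : k != 0 ->
  csharpmx V *m V = (csharp k * k)%:M ->
  (forall z, z != - z^* -> regular_at V k z) ->
  exists W : 'M[{poly C}]_m, V = k *: W.
Proof.
have [n] := ubnP (size k); elim: n V k => // n IHn V k; rewrite ltnS => sk k0 VV reg.
have [sa|sa] := leqP (size k) 1.
  exists ((k`_0)^-1%:P *: V); rewrite scalerA {1}(size1_polyC sa) -polyCM mulfV ?scale1r //.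
  by apply: contra k0 => /eqP c0; rewrite (size1_polyC sa) c0.
have [z kz] : exists z, root k z by apply/closed_rootP; rewrite gtn_eqF.
have [|V1 V1E] := @mulmx_factor _ _ _ V z.
  have [zE|zE] := eqVneq z (- z^*).
    apply: adjmx_mul_eq0 => j; rewrite -csharpmx_axis // -map_mxM VV !mxE eqxx mulr1n.
    by rewrite /= /horner_eval hornerM (rootP kz) mulr0.
  have [V' [k' [k'z /matrixP VE]]] := reg z zE.
  apply/matrixP => i j; rewrite !mxE /horner_eval; apply: (mulfI k'z).
  by have := congr1 (fun f : {poly C} => f.[z]) (VE i j);
    rewrite !mxE !hornerM (rootP kz) mul0r mulr0.
have /factor_theorem [k1 kE] := kz.
have p0 : 'X - z%:P != 0 :> {poly C} by rewrite polyXsubC_eq0.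
have k10 : k1 != 0 by apply: contra k0 => /eqP k10; rewrite kE k10 mul0r.
have [||x xE|W WE] := IHn V1 k1 _ k10.
- by apply: leq_trans sk; rewrite kE size_mul // size_XsubC addn2.
- apply: (@scalemxI _ _ _ (csharp ('X - z%:P) * ('X - z%:P))).
    by rewrite mulf_neq0 ?csharp_eq0.
  rewrite -scalerA scalemxAr scalemxAl -csharpmxZ -V1E VV kE scale_scalar_mx ![csharp (_
    * _)]rmorphM /=.
  by congr _%:M; ring.
- have [V' [k' [k'x VE]]] := reg x xE; exists V', k'; split=> //.
  apply: (scalemxI p0); move: VE; rewrite V1E kE !scalerA => VE.
  by rewrite [_ * k1]mulrC -VE mulrC.
by exists W; rewrite V1E WE scalerA kE mulrC.
Qed.

(** A right inverse up to a scalar is also a left one. The adjugate of W replaces the passage to the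
    fraction field. *)
Lemma mulmx_scalarC m (M W : 'M[{poly C}]_m) d : d != 0 ->
  M *m W = d%:M -> W *m M = d%:M.
Proof.
move=> d0 MW; have dW : \det W != 0.
  have := congr1 determinant MW; rewrite det_mulmx det_scalar => /eqP.
  by apply: contraTneq => ->; rewrite mulr0 eq_sym expf_neq0.
apply: (scalemxI dW); rewrite -[LHS]mul_mx_scalar -[RHS]mul_mx_scalar.
rewrite -mul_mx_adj !mulmxA -[W *m M *m W]mulmxA MW.
by rewrite mul_mx_scalar mul_scalar_mx.
Qed.

Lemma coef_near_scalar m (M : 'M[{poly C}]_m) g i j :
  (size (M i j - g *+ (i == j))%R < size g)%N ->
  (M i j)`_(size g).-1 = lead_coef g *+ (i == j) /\ (size (M i j) <= size g)%N.
Proof.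
move=> sM; rewrite -[M i j](subrK (g *+ (i == j))); split.
  rewrite coefD nth_default ?add0r ?coefMn //.
  by rewrite -ltnS prednK // (leq_trans _ sM).
rewrite (leq_trans (size_polyD _ _)) // geq_max ltnW //=.
by case: eqP; rewrite ?size_poly0.
Qed.

(** A / q is the factored function, M / g and M' / g' are the two factors, W / h and W' / h' their
    inverses. In the proof V / k is the quotient U of the factors and V2 / k2 its inverse. [Om]
    supplies regularity at only one of z and - conj z; the other is gained from U = (U^-1)^#. *)
Lemma spectral_factor_unique m (Om : pred C) (q g h g' h' : {poly C})
    (A M W M' W' : 'M[{poly C}]_m) :
  (forall z, z != - z^* -> Om z \/ Om (- z^*)) ->
  q != 0 -> g != 0 -> h != 0 -> g' != 0 -> h' != 0 ->
  q *: (csharpmx M *m M) = (csharp g * g) *: A ->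
  q *: (csharpmx M' *m M') = (csharp g' * g') *: A ->
  M *m W = (g * h)%:M -> M' *m W' = (g' * h')%:M ->
  (forall z, Om z -> regular_at M g z /\ regular_at W h z) ->
  (forall z, Om z -> regular_at M' g' z /\ regular_at W' h' z) ->
  (forall i j, (size (M i j - g *+ (i == j))%R < size g)%N) ->
  (forall i j, (size (M' i j - g' *+ (i == j))%R < size g')%N) ->
  g *: M' = g' *: M.
Proof.
move=> Om2 q0 g0 h0 g'0 h'0 MA MA' MW MW' reg reg' sM sM'.
pose V := M' *m W; pose k := g' * h; pose V2 := M *m W'; pose k2 := g * h'.
have k0 : k != 0 by rewrite mulf_neq0.
have k20 : k2 != 0 by rewrite mulf_neq0.
have gg0 : csharp g * g != 0 by rewrite mulf_neq0 ?csharp_eq0.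
have VV : csharpmx V *m V = (csharp k * k)%:M.
  apply: (@scalemxI _ _ _ (csharp g * g * q)); first by rewrite mulf_neq0.
  transitivity ((csharp g * g) *: (csharpmx W *m (q *: (csharpmx M' *m M')) *m W)).
    rewrite -[LHS]scalerA; congr (_ *: _).
    by rewrite /V csharpmxM -scalemxAr -scalemxAl !mulmxA.
  rewrite MA'; transitivity ((csharp g' * g') *: (csharpmx W *m ((csharp g * g) *: A) *m
    W)).
    by rewrite -!scalemxAr -!scalemxAl !scalerA mulrC.
  rewrite -MA; transitivity ((csharp g' * g' * q) *: (csharpmx (M *m W) *m (M *m W))).
    by rewrite -[RHS]scalerA csharpmxM -scalemxAr -scalemxAl !mulmxA.
  rewrite MW /k csharpmx_scalar -scalar_mxM !scale_scalar_mx ![csharp (_ * _)]rmorphM /=.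
  by congr _%:M; ring.
have VV2 : V *m V2 = (k * k2)%:M.
  have WM : W *m M = (g * h)%:M by apply: mulmx_scalarC MW; rewrite mulf_neq0.
  rewrite /V /V2 mulmxA -[M' *m W *m M]mulmxA WM mul_mx_scalar -scalemxAl MW'.
  by rewrite scale_scalar_mx; congr _%:M; rewrite /k /k2; ring.
(* U = (U^-1)^# cleared of denominators: it transports regularity of V2 / k2 at - conj z to
   regularity of V / k at z. *)
have V2s : csharp k2 *: V = k *: csharpmx V2.
  rewrite -[k]csharpK -[V]csharpmxK -!csharpmxZ; congr csharpmx.
  apply: (scalemxI k0); rewrite !scalerA -[LHS]mul_mx_scalar -VV2 mulmxA VV.
  by rewrite mul_scalar_mx mulrC.
have [|W0 W0E] := isometric_regular_dvd k0 VV.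
  move=> z /Om2[Omz|Omz].
    by apply: regular_atM; [case: (reg' z Omz)|case: (reg z Omz)].
  have [V' [k' [k'z VE]]] : regular_at V2 k2 (- z^*).
    by apply: regular_atM; [case: (reg _ Omz)|case: (reg' _ Omz)].
  exists (csharpmx V'), (csharp k'); split; first by rewrite csharpE conjC_eq0.
  apply: (@scalemxI _ _ _ (csharp k2)); first by rewrite csharp_eq0.
  rewrite !scalerA [csharp k2 * csharp k']mulrC -[LHS]scalerA V2s.
  by rewrite scalerA [_ * k]mulrC -[LHS]scalerA -csharpmxZ VE csharpmxZ scalerA mulrC.
have W0W0 : csharpmx W0 *m W0 = 1%:M.
  apply: (@scalemxI _ _ _ (csharp k * k)); first by rewrite mulf_neq0 ?csharp_eq0.
  by rewrite -scalerA scalemxAr -W0E scalemxAl -csharpmxZ -W0E VV scale_scalar_mx mulr1.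
(* Degree bound 0 in [size_isometric]: a polynomial matrix with W0^# W0 = I is constant. *)
have sW0 i j : (size (W0 i j) <= 1)%N.
  by apply: size_isometric => l; rewrite W0W0 mxE eqxx size_poly1.
have gM : g *: M' = g' *: (W0 *m M).
  apply: (scalemxI h0); rewrite !scalerA [h * g']mulrC [h * g]mulrC -/k.
  rewrite -[LHS]mul_mx_scalar -(mulmx_scalarC _ MW) ?mulf_neq0 // mulmxA -/V W0E.
  by rewrite -scalemxAl.
suff W01 : W0 = 1%:M by rewrite gM W01 mul1mx.
apply/matrixP => i j; rewrite (size1_polyC (sW0 i j)) [RHS]mxE -(rmorphMn polyC).
congr _%:P; pose a := (size g).-1; pose b := (size g').-1.
have sg f : f != 0 -> (size f <= (size f).-1.+1)%N by rewrite leqSpred.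
have c0 : lead_coef g * lead_coef g' != 0 by rewrite mulf_neq0 ?lead_coef_eq0.
(* The constant W0 is read off the coefficient of degree a + b in g M' = g' W0 M, after
   multiplication by the two leading coefficients. *)
apply: (mulfI c0).
have [M'b sM'b] := coef_near_scalar (sM' i j).
have W0M : ((W0 *m M) i j)`_a = lead_coef g * (W0 i j)`_0 /\
    (size ((W0 *m M) i j) <= a.+1)%N.
  rewrite !mxE coef_sum; split.
    rewrite (bigD1 j) //= big1 => [|l /negPf lj]; rewrite (size1_polyC (sW0 _ _)) coefCM.
      have [-> _] := coef_near_scalar (sM j j).
      by rewrite eqxx mulr1n addr0 coefC /= mulrC.
    by have [-> _] := coef_near_scalar (sM l j); rewrite lj mulr0n mulr0.
  rewrite (leq_trans (size_sum _ _ _)) //; apply/bigmax_leqP => l _.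
  rewrite (size1_polyC (sW0 i l)) mul_polyC (leq_trans (size_scale_leq _ _)) //.
  by have [_ /leq_trans->] := coef_near_scalar (sM l j); rewrite // sg.
have [W0a sW0a] := W0M.
have := congr1 (fun X : 'M[{poly C}]_m => (X i j : {poly C})`_(a + b)) gM.
rewrite [in X in X -> _]mxE [in X in _ = X -> _]mxE.
rewrite coefM_top ?sg // ?(leq_trans sM'b) ?sg // M'b addnC coefM_top ?sg // W0a.
rewrite -!/(lead_coef _) => E.
rewrite [_ * lead_coef g']mulrC -mulrA -E.
by rewrite [LHS]mulrnAr [RHS]mulrnAr mulr1 [_ * lead_coef g]mulrC.
Qed.
End Uniqueness.

(** * Existence of a complex spectral factor *)

Section Existence.
Variable C : numClosedFieldType.
Implicit Types (f g h a : {poly C}) (z t : C).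

(* The reversed entries [X^k A_ij(1/X)] form a matrix of nonzero determinant at 0. *)
Lemma det_near_scalar_neq0 m (A : 'M[{poly C}]_m) (q : {poly C}) : q != 0 ->
  (forall i j, (size (A i j - q *+ (i == j))%R < size q)%N) -> \det A != 0.
Proof.
move=> q0 sA; apply/eqP => dA; pose k := (size q).-1.
pose rv f : {poly C} := \poly_(i < k.+1) f`_(k - i).
have rvE f t : (size f <= k.+1)%N -> t != 0 -> (rv f).[t] = t ^+ k * f.[t^-1].
  move=> sf t0; rewrite horner_poly (horner_coef_wide _ sf) mulr_sumr.
  rewrite (reindex_inj rev_ord_inj) /=; apply: eq_bigr => i _.
  have ik : (i <= k)%N by rewrite -ltnS.
  rewrite subSS subKn // mulrCA; congr (_ * _).
  by rewrite exprVn -expfB_cond // (negPf t0).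
pose Ar : 'M[{poly C}]_m := map_mx rv A.
have sA' i j := (coef_near_scalar (sA i j)).2.
have sq : size q = k.+1 by rewrite prednK // lt0n size_poly_eq0.
(* Ar(t) = t^k A(1/t) is singular at every positive integer t, which forces det Ar = 0, whereas
   Ar(0) is the leading coefficient of q times the identity. *)
have dr : \det Ar = 0.
  apply: (@roots_geq_poly_eq0 _ _ [seq i.+1%:R | i <- iota 0 (size (\det Ar))]).
  - apply/allP => _ /mapP[i _ ->]; set t := _%:R.
    have t0 : t != 0 by rewrite pnatr_eq0.
    rewrite /root -[_.[t]]/(horner_eval t _) -det_map_mx.
    have -> : map_mx (horner_eval t) Ar = t ^+ k *: map_mx (horner_eval t^-1) A.
      by apply/matrixP => a b; rewrite !mxE /= /horner_eval rvE // -sq.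
    by rewrite detZ det_map_mx dA /= /horner_eval horner0 mulr0.
  - by rewrite map_inj_uniq ?iota_uniq // => i j /eqP; rewrite eqr_nat => /eqP[].
  by rewrite size_map size_iota.
have := congr1 (horner_eval 0) dr; rewrite -det_map_mx.
have -> : map_mx (horner_eval 0) Ar = (lead_coef q)%:M.
  apply/matrixP => i j; rewrite !mxE /horner_eval horner_coef0 coef_poly subn0.
  by case: (coef_near_scalar (sA i j)).
by rewrite det_scalar /= /horner_eval horner0 => /eqP;
  rewrite expf_eq0 lead_coef_eq0 (negPf q0) andbF.
Qed.

(** With R = A / q, the polynomial matrix q^# A equals |q|^2 R on the axis, so it has the sign of R
    there. Its Cholesky factorization gives R = M0^# M0 / ((g0 q)^# (g0 q)); this is why the roots
    of g0 q, not of g0 alone, are reflected out of [Om] along with those of det M0. *)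
Lemma spectral_factor_exists m (Om : pred C) (q : {poly C}) (A : 'M[{poly C}]_m) :
  (forall z, Om z -> ~~ Om (- z^* )) -> q != 0 ->
  q *: csharpmx A = csharp q *: A -> axis_psd (csharp q *: A) ->
  (forall i j, (size (A i j - q *+ (i == j))%R < size q)%N) ->
  exists g (M : 'M[{poly C}]_m),
    [/\ g != 0, \det M != 0, forall z, Om z -> ~~ root g z /\ ~~ root (\det M) z,
        q *: (csharpmx M *m M) = (csharp g * g) *: A &
        forall i j, (size (M i j - g *+ (i == j))%R < size g)%N].
Proof.
move=> Om1 q0 AS pos sA.
have [g0 [M0 [g00 gM0]]] : exists g0 (M0 : 'M[{poly C}]_m), g0 != 0 /\
    (csharp g0 * g0) *: (csharp q *: A) = csharpmx M0 *m M0.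
  by apply: psd_cholesky => //; rewrite csharpmxZ csharpK.
have gq0 : g0 * q != 0 by rewrite mulf_neq0.
have [g gE rg] := flip_zeros_scalar Om1 gq0.
have gN0 : g != 0.
  apply: contraNneq gq0 => g0'; move/eqP: gE; rewrite g0' mulr0 eq_sym mulf_eq0.
  by rewrite csharp_eq0 orbb.
have dM0 : \det M0 != 0.
  have := congr1 determinant gM0; rewrite scalerA detZ det_mulmx => /eqP.
  apply: contraTneq => ->; rewrite mulr0 mulf_neq0 ?(det_near_scalar_neq0 q0 sA) //.
  by rewrite expf_neq0 // !mulf_neq0 // csharp_eq0.
have [M1 [M1E rM1]] := flip_zeros Om1 dM0.
have dM1 : \det M1 != 0.
  have := congr1 determinant M1E; rewrite !det_mulmx !det_csharpmx => /eqP.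
  apply: contraTneq => ->; rewrite rmorph0 mulr0 eq_sym mulf_neq0 //.
  by rewrite csharp_eq0.
have ME : q *: (csharpmx M1 *m M1) = (csharp g * g) *: A.
  rewrite gE M1E -gM0 !scalerA; congr (_ *: _).
  by rewrite [csharp (_ * _)]rmorphM /=; ring.
have [U [Uu UE sU]] := normalize_infty q0 gN0 sA ME.
have dU : \det (map_mx polyC U *m M1) = (\det U)%:P * \det M1.
  by rewrite det_mulmx det_map_mx.
have dU0 : \det U != 0 by move: Uu; rewrite unitmxE unitfE.
exists g, (map_mx polyC U *m M1); split=> //; last by rewrite UE.
  by rewrite dU mulf_neq0 ?polyC_eq0.
by move=> z Omz; rewrite rg // dU rootM negb_or rootC dU0 rM1.
Qed.

End Existence.

(** * The map chi *)

Section ChiRing.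
Variables (S : nzRingType) (T : comNzRingType) (e1 e2 : {additive S -> T}).
Variable cj : {rmorphism T -> T}.
Hypothesis e1M : forall p q, e1 (p * q) = e1 p * e1 q - e2 p * cj (e2 q).
Hypothesis e2M : forall p q, e2 (p * q) = e1 p * e2 q + e2 p * cj (e1 q).
Hypothesis cjK : involutive cj.

(** The rings and the two components are abstract because the same algebra serves twice: for
    quaternions over the complex numbers, and for {poly H} over complex polynomials with
    coefficientwise conjugation. *)
Definition chi_mx n m (A : 'M[S]_(n, m)) : 'M[T]_(n + n, m + m) :=
  block_mx (map_mx e1 A) (map_mx e2 A)
           (- map_mx (cj \o e2) A) (map_mx (cj \o e1) A).

Lemma chi_mxM n m l (A : 'M[S]_(n, m)) (B : 'M[S]_(m, l)) :
  chi_mx (A *m B) = chi_mx A *m chi_mx B.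
Proof.
rewrite /chi_mx mulmx_block.
have H1 : map_mx e1 (A *m B) =
    map_mx e1 A *m map_mx e1 B - map_mx e2 A *m map_mx (cj \o e2) B.
  apply/matrixP => i j; rewrite !mxE raddf_sum -sumrB.
  by apply: eq_bigr => k _; rewrite !mxE e1M.
have H2 : map_mx e2 (A *m B) =
    map_mx e1 A *m map_mx e2 B + map_mx e2 A *m map_mx (cj \o e1) B.
  apply/matrixP => i j; rewrite !mxE raddf_sum -big_split.
  by apply: eq_bigr => k _; rewrite !mxE e2M.
have cjc n' m' (e : S -> T) (M : 'M[S]_(n', m')) :
    map_mx (cj \o e) M = map_mx cj (map_mx e M).
  by apply/matrixP => i j; rewrite !mxE.
have cjcK n' m' (M : 'M[T]_(n', m')) : map_mx cj (map_mx cj M) = M.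
  by apply/matrixP => i j; rewrite !mxE cjK.
congr block_mx.
- by rewrite H1 mulmxN.
- by rewrite H2.
- rewrite cjc H2 map_mxD !map_mxM !cjc cjcK mulmxN mulNmx opprD addrC.
  by rewrite addrC -mulNmx.
by rewrite cjc H1 map_mxB !map_mxM !cjc cjcK mulNmx addrC.
Qed.

Lemma chi_mxD n m (A B : 'M[S]_(n, m)) : chi_mx (A + B) = chi_mx A + chi_mx B.
Proof.
rewrite /chi_mx add_block_mx -opprD; congr (block_mx _ _ (- _) _);
  by apply/matrixP => i j; rewrite !mxE /= !raddfD.
Qed.

Lemma chi_mxN n m (A : 'M[S]_(n, m)) : chi_mx (- A) = - chi_mx A.
Proof.
rewrite /chi_mx opp_block_mx; congr (block_mx _ _ (- _) _);
  by apply/matrixP => i j; rewrite !mxE /= !raddfN.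
Qed.

Lemma chi_mxZ n m (x : S) (A : 'M[S]_(n, m)) :
  e2 x = 0 -> cj (e1 x) = e1 x -> chi_mx (x *: A) = e1 x *: chi_mx A.
Proof.
move=> x2 x1; rewrite /chi_mx scale_block_mx scalerN; congr (block_mx _ _ (- _) _);
  apply/matrixP => i j; rewrite !mxE /= ?e1M ?e2M x2 mul0r ?subr0 ?addr0 //.
  by rewrite rmorphM x1.
by rewrite rmorphM x1.
Qed.

Lemma chi_mx_scalar n (x : S) :
  e2 x = 0 -> cj (e1 x) = e1 x -> chi_mx (x%:M : 'M_n) = (e1 x)%:M.
Proof.
move=> x2 x1; rewrite [RHS]scalar_mx_block /chi_mx.
congr block_mx; apply/matrixP => i j; rewrite !mxE /= ?raddfMn ?x2 ?x1 //= ?mul0rn //.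
- by rewrite rmorph0 oppr0 mul0rn.
by rewrite x1.
Qed.

Lemma chi_mx_inj n m (A B : 'M[S]_(n, m)) :
  (forall x, e1 x = 0 -> e2 x = 0 -> x = 0) -> chi_mx A = chi_mx B -> A = B.
Proof.
move=> e0 /eq_block_mx[/matrixP E1 /matrixP E2 _ _]; apply/matrixP => i j.
apply/eqP; rewrite -subr_eq0; apply/eqP/e0; rewrite raddfB.
  by have := E1 i j; rewrite !mxE => ->; rewrite subrr.
by have := E2 i j; rewrite !mxE => ->; rewrite subrr.
Qed.

Definition symplectic n : 'M[T]_(n + n) := block_mx 0 1%:M (- 1%:M) 0.

(* The range of chi: the matrices commuting with the antilinear map [v |-> J conj v]. *)
Lemma chi_mx_symplectic n (A : 'M[S]_n) :
  symplectic n *m map_mx cj (chi_mx A) = chi_mx A *m symplectic n.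
Proof.
have cjc (e : S -> T) : map_mx cj (map_mx (cj \o e) A) = map_mx e A.
  by apply/matrixP => i j; rewrite !mxE /= cjK.
have cjc' (e : S -> T) : map_mx cj (map_mx e A) = map_mx (cj \o e) A.
  by apply/matrixP => i j; rewrite !mxE.
rewrite /chi_mx /symplectic map_block_mx map_mxN !cjc !cjc' !mulmx_block.
by rewrite !(mul0mx, mulmx0, mul1mx, mulmx1, mulNmx, mulmxN, add0r, addr0, opprK).
Qed.

(** Commutation with J determines the lower blocks of B from the upper ones, so the upper blocks
    alone rebuild the preimage through [mk]. *)
Lemma chi_mxP n (B : 'M[T]_(n + n)) (mk : T -> T -> S) :
  (forall x y, e1 (mk x y) = x) -> (forall x y, e2 (mk x y) = y) ->
  symplectic n *m map_mx cj B = B *m symplectic n -> exists A, B = chi_mx A.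
Proof.
move=> mk1 mk2; rewrite -(submxK B) /symplectic map_block_mx !mulmx_block.
rewrite !(mul0mx, mulmx0, mul1mx, mulmx1, mulNmx, mulmxN, add0r, addr0).
case/eq_block_mx => _ _ /oppr_inj E3 E4.
exists (\matrix_(i, j) mk (ulsubmx B i j) (ursubmx B i j)).
rewrite /chi_mx -E3 -E4; move: (ulsubmx B) (ursubmx B) => X Y.
by congr (block_mx _ _ (- _) _); apply/matrixP => i j; rewrite !mxE /= ?mk1 ?mk2.
Qed.

End ChiRing.

Section QuatComplex.
Variable R : rcfType.
Notation H := (quat R).
Notation C := R[i].
Implicit Types (p q : H) (z : C) (f g : {poly H}).

Fact qchi1_is_additive : additive (@qchi1 R). Proof. by []. Qed.
Fact qchi2_is_additive : additive (@qchi2 R). Proof. by []. Qed.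
HB.instance Definition _ := GRing.isAdditive.Build H C (@qchi1 R) qchi1_is_additive.
HB.instance Definition _ := GRing.isAdditive.Build H C (@qchi2 R) qchi2_is_additive.

Lemma qchi1M p q : qchi1 (p * q) = qchi1 p * qchi1 q - qchi2 p * (qchi2 q)^*.
Proof.
case: p q => [a b c d] [a' b' c' d']; rewrite -[_^*]/(conjc _).
by congr Complex; rewrite /=; ring.
Qed.

Lemma qchi2M p q : qchi2 (p * q) = qchi1 p * qchi2 q + qchi2 p * (qchi1 q)^*.
Proof.
case: p q => [a b c d] [a' b' c' d']; rewrite -[_^*]/(conjc _).
by congr Complex; rewrite /=; ring.
Qed.

Definition qmk (x y : C) : H := Quat (complex.Re x) (complex.Im x) (complex.Re y)
  (complex.Im y).

Lemma qchi1_mk x y : qchi1 (qmk x y) = x. Proof. by case: x. Qed.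
Lemma qchi2_mk x y : qchi2 (qmk x y) = y. Proof. by case: y. Qed.
Lemma qmkK p : qmk (qchi1 p) (qchi2 p) = p. Proof. by case: p. Qed.

Lemma quat_eqP p q : qchi1 p = qchi1 q -> qchi2 p = qchi2 q -> p = q.
Proof. by move=> E1 E2; rewrite -(qmkK p) E1 E2 qmkK. Qed.

Lemma qconjM p q : qconj (p * q) = qconj q * qconj p.
Proof. by case: p q => [????] [????]; congr Quat => /=; ring. Qed.

Lemma qchi1_conj p : qchi1 (qconj p) = (qchi1 p)^*. Proof. by case: p. Qed.
Lemma qchi2_conj p : qchi2 (qconj p) = - qchi2 p. Proof. by case: p. Qed.

Lemma chi_chi_mx n m (A : 'M[H]_(n, m)) : chi A = chi_mx (@qchi1 R) (@qchi2 R) Num.conj A.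
Proof. by []. Qed.

Lemma chiM n m l (A : 'M[H]_(n, m)) (B : 'M[H]_(m, l)) : chi (A *m B) = chi A *m chi B.
Proof. exact: (chi_mxM qchi1M qchi2M (@conjCK _)). Qed.

Lemma chi_ctrmx n m (A : 'M[H]_(n, m)) : chi (ctrmx A) = adjmx (chi A).
Proof.
rewrite /chi /adjmx tr_block_mx map_block_mx.
congr block_mx; apply/matrixP => i j; rewrite !mxE ?qchi1_conj ?qchi2_conj //=.
- by case: (A j i) => a b c d; rewrite -[_^*]/(conjc _); congr Complex => /=;
  rewrite ?opprK.
by case: (A j i) => a b c d; rewrite -[_^*]/(conjc _); congr Complex => /=; rewrite ?opprK.
Qed.

Lemma ctrmxM n m l (A : 'M[H]_(n, m)) (B : 'M[H]_(m, l)) :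
  ctrmx (A *m B) = ctrmx B *m ctrmx A.
Proof.
apply/matrixP => i j; rewrite !mxE (big_morph (@qconj R) (id1 := 0) (op1 := +%R)) //.
- by apply: eq_bigr => k _; rewrite !mxE qconjM.
- by move=> [a b c d] [a' b' c' d']; congr Quat => /=; rewrite opprD.
by congr Quat; rewrite oppr0.
Qed.

Lemma ctrmxK n m (A : 'M[H]_(n, m)) : ctrmx (ctrmx A) = A.
Proof.
apply/matrixP => i j; rewrite !mxE; case: (A i j) => a b c d.
by congr Quat => /=; rewrite opprK.
Qed.

Definition cpart1 f : {poly C} := map_poly (@qchi1 R) f.
Definition cpart2 f : {poly C} := map_poly (@qchi2 R) f.
Definition cconj : {poly C} -> {poly C} := map_poly Num.conj.
HB.instance Definition _ := GRing.RMorphism.copy cconj (map_poly Num.conj).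

Lemma coef_cpart1 f k : (cpart1 f)`_k = qchi1 f`_k.
Proof. exact: coef_map. Qed.
Lemma coef_cpart2 f k : (cpart2 f)`_k = qchi2 f`_k.
Proof. exact: coef_map. Qed.
Lemma coef_cconj (f : {poly C}) k : (cconj f)`_k = (f`_k)^*.
Proof. exact: coef_map. Qed.

Fact cpart1_is_additive : additive cpart1.
Proof. by move=> f g; apply/polyP => k; rewrite !(coef_cpart1, coefB) raddfB. Qed.
Fact cpart2_is_additive : additive cpart2.
Proof. by move=> f g; apply/polyP => k; rewrite !(coef_cpart2, coefB) raddfB. Qed.
HB.instance Definition _ := GRing.isAdditive.Build {poly H} {poly C} cpart1
  cpart1_is_additive.
HB.instance Definition _ := GRing.isAdditive.Build {poly H} {poly C} cpart2
  cpart2_is_additive.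

Lemma cpart1M f g : cpart1 (f * g) = cpart1 f * cpart1 g - cpart2 f * cconj (cpart2 g).
Proof.
apply/polyP => k; rewrite coefB !coefM coef_cpart1 coefM raddf_sum -sumrB.
apply: eq_bigr => i _.
by rewrite /= qchi1M !coef_cpart1 coef_cconj !coef_cpart2.
Qed.

Lemma cpart2M f g : cpart2 (f * g) = cpart1 f * cpart2 g + cpart2 f * cconj (cpart1 g).
Proof.
apply/polyP => k; rewrite coefD !coefM coef_cpart2 coefM raddf_sum -big_split.
apply: eq_bigr => i _.
by rewrite /= qchi2M !coef_cpart1 coef_cconj !coef_cpart2 coef_cpart1.
Qed.

Lemma cconjK : involutive cconj.
Proof. by move=> f; apply/polyP => k; rewrite !coef_cconj conjCK. Qed.

Definition cmk (f g : {poly C}) : {poly H} :=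
  \poly_(k < maxn (size f) (size g)) qmk f`_k g`_k.

Lemma coef_cmk (f g : {poly C}) k : (cmk f g)`_k = qmk f`_k g`_k.
Proof.
rewrite coef_poly; case: ltnP => //; rewrite geq_max => /andP[sf sg].
by rewrite !nth_default.
Qed.

Lemma cpart1_mk (f g : {poly C}) : cpart1 (cmk f g) = f.
Proof. by apply/polyP => k; rewrite coef_cpart1 coef_cmk qchi1_mk. Qed.
Lemma cpart2_mk (f g : {poly C}) : cpart2 (cmk f g) = g.
Proof. by apply/polyP => k; rewrite coef_cpart2 coef_cmk qchi2_mk. Qed.

Lemma cpart_eq0 f : cpart1 f = 0 -> cpart2 f = 0 -> f = 0.
Proof.
move=> /polyP f1 /polyP f2; apply/polyP => k; apply: quat_eqP.
  by rewrite -coef_cpart1 f1 !coef0.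
by rewrite -coef_cpart2 f2 !coef0.
Qed.

Definition chip n m (P : 'M[{poly H}]_(n, m)) := chi_mx cpart1 cpart2 cconj P.

Lemma chipM n m l (A : 'M[{poly H}]_(n, m)) (B : 'M[{poly H}]_(m, l)) :
  chip (A *m B) = chip A *m chip B.
Proof. exact: (chi_mxM cpart1M cpart2M cconjK). Qed.

Lemma chip_inj n m : injective (@chip n m).
Proof. by move=> A B; apply: chi_mx_inj; exact: cpart_eq0. Qed.

Lemma chipP n (B : 'M[{poly C}]_(n + n)) :
  symplectic _ n *m map_mx cconj B = B *m symplectic _ n -> exists A, B = chip A.
Proof. exact: (chi_mxP cpart1_mk cpart2_mk). Qed.

Lemma chip_symplectic n (A : 'M[{poly H}]_n) :
  symplectic _ n *m map_mx cconj (chip A) = chip A *m symplectic _ n.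
Proof. exact: (chi_mx_symplectic _ _ cconjK). Qed.

Definition cpoly (Q : {poly R}) : {poly C} := map_poly (real_complex R) Q.

Lemma cpart1_polyH Q : cpart1 (polyH Q) = cpoly Q.
Proof. by apply/polyP => k; rewrite coef_cpart1 !coef_map_id0 ?coef_map. Qed.

Lemma cpart2_polyH Q : cpart2 (polyH Q) = 0.
Proof. by apply/polyP => k; rewrite coef_cpart2 !coef_map_id0 ?coef0. Qed.

Lemma cconj_cpoly Q : cconj (cpoly Q) = cpoly Q.
Proof.
by apply/polyP => k; rewrite coef_cconj coef_map; apply: conjc_real.
Qed.

Lemma chipZ n m Q (P : 'M[{poly H}]_(n, m)) : chip (polyH Q *: P) = cpoly Q *: chip P.
Proof.
rewrite -cpart1_polyH; apply: (chi_mxZ cpart1M cpart2M); first exact: cpart2_polyH.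
by rewrite /= cpart1_polyH cconj_cpoly.
Qed.

Lemma chip_scalar n Q : chip ((polyH Q)%:M : 'M_n) = (cpoly Q)%:M.
Proof.
rewrite -cpart1_polyH; apply: chi_mx_scalar; first exact: cpart2_polyH.
by rewrite /= cpart1_polyH cconj_cpoly.
Qed.

Lemma coef_sharp_poly f k : (sharp_poly f)`_k = (-1) ^+ k * qconj f`_k.
Proof.
rewrite coef_poly; case: ltnP => // /(nth_default 0) ->.
by rewrite (_ : qconj 0 = 0) ?mulr0 //; congr Quat; rewrite oppr0.
Qed.

(** Coefficient by coefficient both sides are (-1)^k times an adjoint, and chi turns the
    quaternionic adjoint into the complex one; the real sign passes through both components. *)
Lemma chip_sharp n m (P : 'M[{poly H}]_(n, m)) :
  chip (map_mx (@sharp_poly R) P^T) = csharpmx (chip P).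
Proof.
have sgn1 k p : qchi1 ((-1) ^+ k * p) = (-1) ^+ k * qchi1 p.
  by rewrite -signr_odd -[in RHS]signr_odd; case: (odd k);
    rewrite ?expr0 ?expr1 ?mul1r ?mulN1r ?raddfN.
have sgn2 k p : qchi2 ((-1) ^+ k * p) = (-1) ^+ k * qchi2 p.
  by rewrite -signr_odd -[in RHS]signr_odd; case: (odd k);
    rewrite ?expr0 ?expr1 ?mul1r ?mulN1r ?raddfN.
rewrite /chip /chi_mx csharpmx_block; congr block_mx; apply/matrixP => i j;
  rewrite !mxE /=; apply/polyP => k;
  rewrite ?coefN !(coef_csharp, coef_cpart1, coef_cpart2, coef_cconj, coefN)
    coef_sharp_poly.
- by rewrite sgn1 qchi1_conj.
- by rewrite sgn2 qchi2_conj rmorphN /= conjCK.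
- by rewrite sgn2 qchi2_conj rmorphM rmorphXn rmorphN rmorph1 /= rmorphN /= mulrN opprK.
by rewrite sgn1 qchi1_conj rmorphM rmorphXn rmorphN rmorph1 /=.
Qed.

End QuatComplex.

(** * Slice functions and their complex counterparts *)

Section QuatNorm.
Variable R : rcfType.
Notation H := (quat R).
Notation C := R[i].
Implicit Types (p q : H) (z : C) (f g : {poly H}).

Lemma qnormsq_ge0 p : 0 <= qnormsq p.
Proof. by rewrite /qnormsq !addr_ge0 ?sqr_ge0. Qed.

Lemma qnormsqM p q : qnormsq (p * q) = qnormsq p * qnormsq q.
Proof. by case: p q => [????] [????]; rewrite /qnormsq /=; ring. Qed.

Lemma qnorm_ge0 p : 0 <= qnorm p. Proof. exact: sqrtr_ge0. Qed.

Lemma qnormM p q : qnorm (p * q) = qnorm p * qnorm q.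
Proof. by rewrite /qnorm qnormsqM sqrtrM ?qnormsq_ge0. Qed.

Lemma sqr_qnorm p : qnorm p ^+ 2 = qnormsq p.
Proof. by rewrite sqr_sqrtr ?qnormsq_ge0. Qed.

Lemma qnorm_eq0 p : (qnorm p == 0) = (p == 0).
Proof. by rewrite -sqrf_eq0 sqr_qnorm qnormsq_eq0. Qed.

Lemma qnorm0 : qnorm (0 : H) = 0. Proof. by apply/eqP; rewrite qnorm_eq0. Qed.

Lemma qnorm_gt0 p : (0 < qnorm p) = (p != 0).
Proof. by rewrite lt_def qnorm_eq0 qnorm_ge0 andbT. Qed.

Lemma qnorm_real (x : R) : qnorm (qreal x) = `|x|.
Proof. by rewrite /qnorm /qnormsq /= expr0n /= !addr0 sqrtr_sqr. Qed.

Lemma qnorm1 : qnorm (1 : H) = 1. Proof. by rewrite [LHS]qnorm_real normr1. Qed.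

Lemma qnormN p : qnorm (- p) = qnorm p.
Proof. by rewrite /qnorm /qnormsq /= !sqrrN. Qed.

Lemma qnormV p : p != 0 -> qnorm p^-1 = (qnorm p)^-1.
Proof.
move=> p0; have np : qnorm p != 0 by rewrite qnorm_eq0.
by apply: (mulIf np); rewrite mulVf // -qnormM mulVr ?qnorm1.
Qed.

Lemma qnorm_conj p : qnorm (qconj p) = qnorm p.
Proof. by rewrite /qnorm /qnormsq /= !sqrrN. Qed.

Lemma qre_le_qnorm p : `|qre p| <= qnorm p.
Proof.
rewrite -sqrtr_sqr ler_wsqrtr // /qnormsq -!addrA lerDl.
by rewrite !addr_ge0 ?sqr_ge0.
Qed.

Lemma ler_qnormD p q : qnorm (p + q) <= qnorm p + qnorm q.
Proof.
rewrite -(@ler_pXn2r _ 2) ?nnegrE ?addr_ge0 ?qnorm_ge0 //.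
rewrite sqrrD !sqr_qnorm.
have -> : qnormsq (p + q) = qnormsq p + qre (p * qconj q) *+ 2 + qnormsq q.
  by case: p q => [????] [????]; rewrite /qnormsq /=; ring.
rewrite lerD2r lerD2l lerMn2r /= -(qnorm_conj q) -qnormM.
exact: le_trans (ler_norm _) (qre_le_qnorm _).
Qed.

Lemma ler_qnorm_sum (I : Type) (r : seq I) (P : pred I) (F : I -> H) :
  qnorm (\sum_(i <- r | P i) F i) <= \sum_(i <- r | P i) qnorm (F i).
Proof.
elim/big_rec2: _ => [|i y x _ xy]; first by rewrite qnorm0.
by rewrite (le_trans (ler_qnormD _ _)) // lerD2l.
Qed.

Lemma qrealC (c : R) p : qreal c * p = p * qreal c.
Proof. by case: p => [????]; congr Quat => /=; ring. Qed.

Lemma leval_wide f N p : (size f <= N)%N -> leval f p = \sum_(k < N) p ^+ k * f`_k.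
Proof.
move=> sf; rewrite /leval (big_ord_widen N (fun k => p ^+ k * f`_k)) // big_mkcond /=.
by apply: eq_bigr => k _; case: ltnP => // /(nth_default 0) ->; rewrite mulr0.
Qed.

Fact leval_is_additive p : additive (fun f => leval f p).
Proof.
move=> f g /=; rewrite !(@leval_wide _ (maxn (size f) (size g))) ?leq_maxl ?leq_maxr //.
  by rewrite -sumrB; apply: eq_bigr => k _; rewrite coefB mulrBr.
by rewrite (leq_trans (size_polyD _ _)) // size_polyN.
Qed.

Lemma levalB f g p : leval (f - g) p = leval f p - leval g p.
Proof. exact: leval_is_additive. Qed.

Lemma leval0 p : leval 0 p = 0.
Proof. by rewrite -(subrr 0) levalB subrr. Qed.

Lemma levalD f g p : leval (f + g) p = leval f p + leval g p.
Proof. by apply/eqP; rewrite -subr_eq -levalB addrK. Qed.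

Lemma levalMX f p : leval (f * 'X) p = p * leval f p.
Proof.
rewrite (@leval_wide (f * 'X) (size f).+1); last first.
  by rewrite (leq_trans (size_polyMleq _ _)) // size_polyX addn2.
rewrite big_ord_recl coefMX eqxx mulr0 add0r /leval mulr_sumr.
by apply: eq_bigr => k _; rewrite coefMX /= exprS mulrA.
Qed.

Lemma leval_realM (c : R) f p : leval ((qreal c)%:P * f) p = qreal c * leval f p.
Proof.
rewrite (@leval_wide _ (size f)).
  rewrite /leval mulr_sumr; apply: eq_bigr => k _.
  by rewrite coefCM !mulrA qrealC.
by apply/leq_sizeP => j sj; rewrite coefCM nth_default ?mulr0.
Qed.

Fact qreal_is_additive : additive (@qreal R).
Proof. by move=> x y; congr Quat; rewrite subr0. Qed.
Fact qreal_is_multiplicative : multiplicative (@qreal R).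
Proof. by split=> // x y; congr Quat => /=; rewrite !(mulr0, mul0r, subr0, addr0). Qed.
HB.instance Definition _ := GRing.isAdditive.Build R H (@qreal R) qreal_is_additive.
HB.instance Definition _ := GRing.isMultiplicative.Build R H (@qreal R)
  qreal_is_multiplicative.

(** Evaluation with powers on the left is not multiplicative in general; it is when the left factor
    has real coefficients, since these commute with p. *)
Lemma leval_polyHM (Q : {poly R}) f p :
  leval (polyH Q * f) p = leval (polyH Q) p * leval f p.
Proof.
elim/poly_ind: Q f => [|Q c IHQ] f; first by rewrite /polyH map_poly0 mul0r leval0 mul0r.
have E : polyH (Q * 'X + c%:P) = polyH Q * 'X + (qreal c)%:P.
  by rewrite /polyH rmorphD rmorphM /= map_polyX map_polyC.
have lc : leval (qreal c)%:P p = qreal c.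
  by rewrite -[_%:P]mulr1 leval_realM /leval size_poly1 big_ord1 expr0 mul1r coef1 mulr1.
rewrite E mulrDl -mulrA -commr_polyX mulrA !levalD leval_realM lc !levalMX.
by rewrite IHQ mulrDl mulrA.
Qed.

Definition qz z : H := qmk z 0.

Lemma qzM z w : qz (z * w) = qz z * qz w.
Proof. by case: z w => [??] [??]; congr Quat => /=; ring. Qed.

Lemma qzX z k : qz (z ^+ k) = qz z ^+ k.
Proof. by elim: k => [//|k IHk]; rewrite !exprS qzM IHk. Qed.

Lemma qz_mul z (x y : C) : qz z * qmk x y = qmk (z * x) (z * y).
Proof. by case: z x y => [??] [??] [??]; congr Quat => /=; ring. Qed.

(** Left multiplication by a complex number acts separately on the two parts of f1 + f2 j. On the
    slice through i a slice function is therefore a pair of ordinary complex functions. *)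
Lemma leval_qz f z : leval f (qz z) = qmk (cpart1 f).[z] (cpart2 f).[z].
Proof.
have s1 : (size (cpart1 f) <= size f)%N by exact: size_poly.
have s2 : (size (cpart2 f) <= size f)%N by exact: size_poly.
apply: quat_eqP; rewrite ?qchi1_mk ?qchi2_mk /leval raddf_sum ?(horner_coef_wide _ s1)
  ?(horner_coef_wide _ s2); apply: eq_bigr => k _ /=.
  by rewrite -qzX -[f`_k]qmkK qz_mul qchi1_mk coef_cpart1 mulrC.
by rewrite -qzX -[f`_k]qmkK qz_mul qchi2_mk coef_cpart2 mulrC.
Qed.

End QuatNorm.

Section SliceFunctions.
Variable R : rcfType.
Notation H := (quat R).
Notation C := R[i].
Implicit Types (p q : H) (z : C) (f g : {poly H}).

Definition qden n m (F : srat R n m) : {poly C} := cpoly (sden F).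
Definition qnum n m (F : srat R n m) : 'M[{poly C}]_(n + n, m + m) := chip (snum F).

Lemma qden_neq0 n m (F : srat R n m) : qden F != 0.
Proof. by rewrite map_poly_eq0 sden_neq0. Qed.

Lemma sden_at_qz n m (F : srat R n m) z : sden_at F (qz z) = qz (qden F).[z].
Proof. by rewrite /sden_at leval_qz cpart1_polyH cpart2_polyH horner0. Qed.

Lemma qz_eq0 z : (qz z == 0) = (z == 0).
Proof.
apply/eqP/eqP => [[x0 y0]|->] //.
by case: z x0 y0 => x y /= -> ->.
Qed.

Lemma frac_at_qz n m (F : srat R n m) z i j : (qden F).[z] != 0 ->
  frac_at F (qz z) i j = qmk ((cpart1 (snum F i j)).[z] / (qden F).[z])
                             ((cpart2 (snum F i j)).[z] / (qden F).[z]).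
Proof.
move=> Qz; rewrite /frac_at !mxE leval_qz sden_at_qz.
have q0 : qz (qden F).[z] != 0 by rewrite qz_eq0.
apply: (mulrI (x := qz (qden F).[z])); first exact: q0.
by rewrite mulVKr // qz_mul ![_.[z] * (_ / _)]mulrC !mulfVK.
Qed.

(** Points of the slice through i already suffice to obtain the polynomial identity, because
    infinitely many of them avoid the poles. Conversely the identity pulls back to {poly H} by
    injectivity of [chip] and can be evaluated at any quaternion. *)
Lemma sreqP n m (F G : srat R n m) :
  sreq F G <-> qden G *: qnum F = qden F *: qnum G.
Proof.
split=> [FG|E]; last first.
  have {}E : polyH (sden G) *: snum F = polyH (sden F) *: snum G.
    by apply: chip_inj; rewrite !chipZ.
  move=> p Fp Gp; apply/matrixP => i j; rewrite /frac_at !mxE.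
  have := congr1 (fun A : 'M[{poly H}]_(n, m) => leval (A i j) p) E.
  rewrite !mxE !leval_polyHM -/(sden_at F p) -/(sden_at G p) => {}E.
  have comm : sden_at F p * sden_at G p = sden_at G p * sden_at F p.
    by rewrite -!leval_polyHM /polyH -!rmorphM mulrC.
  apply: (mulrI (x := sden_at G p)); first exact: Gp.
  apply: (mulrI (x := sden_at F p)); first exact: Fp.
  rewrite mulrA comm -mulrA mulVKr // E.
  by rewrite mulVKr.
rewrite -!chipZ; congr chip; apply/matrixP => i j; rewrite !mxE.
have QQ : qden F * qden G != 0 by rewrite mulf_neq0 ?qden_neq0.
(* Multiplied by the two denominators, h vanishes at every point. *)
have key (h : {poly C}) :
    (forall z, (qden F * qden G).[z] != 0 -> h.[z] = 0) -> h = 0.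
  move=> h0; apply: (mulfI QQ); rewrite mulr0; apply: poly_axis_eq0 => z _.
  rewrite hornerM; have [->|/h0 ->] := eqVneq (qden F * qden G).[z] 0.
    by rewrite mul0r.
  by rewrite mulr0.
apply/eqP; rewrite -subr_eq0; apply/eqP/cpart_eq0; apply: key => z;
  rewrite hornerM mulf_eq0 negb_or => /andP[Fz Gz];
  have := FG (qz z); rewrite !sden_at_qz !qz_eq0 => /(_ Fz Gz)/matrixP/(_ i j);
  rewrite !frac_at_qz // => E; rewrite raddfB /= ?cpart1M ?cpart2M;
  rewrite !cpart1_polyH !cpart2_polyH !mul0r ?subr0 ?addr0 -!/(qden _) hornerD hornerN
    !hornerM.
  move/(congr1 (@qchi1 R)): E; rewrite !qchi1_mk => /eqP.
  by rewrite eqr_div // => /eqP E; rewrite mulrC E mulrC subrr.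
move/(congr1 (@qchi2 R)): E; rewrite !qchi2_mk => /eqP.
by rewrite eqr_div // => /eqP E; rewrite mulrC E mulrC subrr.
Qed.

Lemma qden_ssharp n m (F : srat R n m) : qden (ssharp F) = csharp (qden F).
Proof.
rewrite /qden /cpoly /csharp /= map_comp_poly rmorphN /= map_polyX; congr (_ \Po _).
by rewrite -[RHS]/(cconj (cpoly _)) cconj_cpoly.
Qed.

Lemma qnum_ssharp n m (F : srat R n m) : qnum (ssharp F) = csharpmx (qnum F).
Proof. exact: chip_sharp. Qed.

Lemma qden_smul n m l (F : srat R n m) (G : srat R m l) : qden (smul F G) = qden F * qden G.
Proof. exact: rmorphM. Qed.

Lemma qnum_smul n m l (F : srat R n m) (G : srat R m l) : qnum (smul F G) = qnum F *m
  qnum G.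
Proof. exact: chipM. Qed.

Lemma qden_sconst n m (D : 'M[H]_(n, m)) : qden (sconst D) = 1.
Proof. exact: rmorph1. Qed.

Lemma qnum_sconst1 n : qnum (sconst (1%:M : 'M[H]_n)) = 1%:M.
Proof.
have -> : (1%:M : 'M[{poly C}]_(n + n)) = (cpoly 1)%:M.
  by rewrite [cpoly 1]rmorph1.
rewrite -chip_scalar; congr chip; rewrite /= map_scalar_mx; congr _%:M.
by rewrite [polyH 1]rmorph1.
Qed.

Lemma coef_chip n m (P : 'M[{poly H}]_(n, m)) k :
  map_mx (coefp k) (chip P) = chi (map_mx (fun f : {poly H} => f`_k) P).
Proof.
rewrite /chip /chi_mx map_block_mx /chi.
by congr block_mx; apply/matrixP => i j;
  rewrite !mxE /= ?coefN ?coef_cconj ?coef_cpart1 ?coef_cpart2.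
Qed.

Lemma chi0 n m : chi (0 : 'M[H]_(n, m)) = 0.
Proof.
apply/eqP; rewrite -(inj_eq (addrI (chi (0 : 'M[H]_(n, m))))) addr0.
by rewrite !chi_chi_mx -chi_mxD addr0.
Qed.

Lemma chi_poly_chip n m (P : 'M[{poly H}]_(n, m)) : chi_poly P = chip P.
Proof.
apply/matrixP => a b; rewrite mxE; apply/polyP => k; rewrite coef_poly.
have /matrixP/(_ a b) := coef_chip P k; rewrite [LHS]mxE /= => ->.
case: ltnP => // kP; have -> : map_mx (fun f : {poly H} => f`_k) P = 0.
  apply/matrixP => i j; rewrite !mxE nth_default // (leq_trans _ kP) //.
  exact: leq_trans (leq_bigmax j) (leq_bigmax i).
by rewrite chi0 mxE.
Qed.

Lemma nonroot_not_Rpole n m (F : srat R n m) z : ~~ root (qden F) z -> ~~ Rpole F z.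
Proof.
move=> Fz; apply/existsP => -[a /existsP[b /andP[_]]].
by rewrite -/(cpoly _) -/(qden F) (mupNroot Fz).
Qed.

(** The full power of X - z in the denominator divides every entry of the numerator; cancelling it
    leaves a denominator that does not vanish at z. *)
Lemma not_Rpole_regular n (F : srat R n n) z :
  ~~ Rpole F z -> regular_at (qnum F) (qden F) z.
Proof.
move=> nR; set k := qden F; have k0 : k != 0 by exact: qden_neq0.
pose e := mup z k; pose p : {poly C} := ('X - z%:P) ^+ e.
have p0 : p != 0 by rewrite expf_neq0 // polyXsubC_eq0.
have dk : p %| k by rewrite /p -mup_geq.
have dA a b : p %| qnum F a b.
  have [->|A0] := eqVneq (qnum F a b) 0; first by rewrite dvdp0.
  rewrite /p -mup_geq // leqNgt; apply: contra nR => h.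
  apply/existsP; exists a; apply/existsP; exists b.
  by rewrite /ratio_pole chi_poly_chip -/(qnum F) A0.
exists (map_mx (fun f : {poly C} => f %/ p) (qnum F)), (k %/ p); split.
  rewrite -[_ == 0]/(root _ z) -dvdp_XsubCl; apply/negP => dz.
  have : ('X - z%:P) ^+ e.+1 %| k by rewrite exprS -[k](divpK dk) dvdp_mul2r.
  by rewrite -mup_geq // ltnn.
apply/matrixP => a b; rewrite [LHS]mxE [RHS]mxE [in RHS]mxE -[in LHS](divpK (dA a b))
  -[in RHS](divpK dk).
by ring.
Qed.

Lemma symplecticK n : symplectic {poly C} n *m symplectic {poly C} n = - 1%:M.
Proof.
rewrite /symplectic mulmx_block !(mul0mx, mulmx0, mul1mx, mulmx1, add0r, addr0).
by rewrite [1%:M in RHS]scalar_mx_block opp_block_mx !oppr0.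
Qed.

(** The antilinear symmetry of the range of chi carries a pole-free representation at z to one at
    conj z. It compensates for [spole] testing only the points x + i y with y >= 0. *)
Lemma regular_at_conj n (P : 'M[{poly H}]_n) (Q : {poly R}) z :
  regular_at (chip P) (cpoly Q) z -> regular_at (chip P) (cpoly Q) (z^*).
Proof.
move=> [V [k [kz VE]]]; pose J := symplectic {poly C} n.
have JJ : J *m J = - 1%:M := symplecticK n.
exists (- (J *m map_mx (@cconj R) V *m J)), (cconj k); split.
  by rewrite horner_map conjC_eq0.
have := congr1 (fun A => - (J *m map_mx (@cconj R) A *m J)) VE.
rewrite !map_mxZ /= cconj_cpoly -!scalemxAr -!scalemxAl chip_symplectic -/J.
by rewrite -[chip P *m J *m J]mulmxA JJ mulmxN mulmx1 scalerN opprK scalerN.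
Qed.

End SliceFunctions.

(** * The value at infinity as a degree condition *)

Section ValueAtInfinity.
Variable R : rcfType.
Notation H := (quat R).
Notation C := R[i].
Implicit Types (p q : H) (z : C) (f g : {poly H}).

(** F itself belongs to the set searched by [xget], so the default 0 does not occur, and [sreq]
    makes the value independent of the chosen fraction. *)
Lemma sval_atE n m (F : srat R n m) p : sden_at F p != 0 -> sval_at F p = frac_at F p.
Proof.
move=> Fp; rewrite /sval_at; set P := [set v | _]%classic.
have [G [FG Gp ->]] : P (xget 0 P) by apply: xgetPex; exists (frac_at F p), F; split.
by rewrite FG.
Qed.

Lemma qnormX p k : qnorm (p ^+ k) = qnorm p ^+ k.
Proof. by elim: k => [|k IHk]; rewrite ?qnorm1 // !exprS qnormM IHk. Qed.

(** The factor |p| on the left encodes growth of order at most |p|^(k - 1) without subtracting in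
    the exponent. *)
Lemma qnorm_leval_le f : exists2 B, 0 <= B & forall p k, 1 <= qnorm p ->
  (size f <= k)%N -> qnorm p * qnorm (leval f p) <= qnorm p ^+ k * B.
Proof.
exists (\sum_(i < size f) qnorm f`_i) => [|p k p1 fk].
  by apply: sumr_ge0 => i _; exact: qnorm_ge0.
rewrite -qnormM mulr_sumr (le_trans (ler_qnorm_sum _ _ _)) // mulr_sumr.
apply: ler_sum => i _; rewrite mulrA -exprS qnormM qnormX ler_wpM2r ?qnorm_ge0 //.
by rewrite ler_weXn2l // (leq_trans (ltn_ord i)).
Qed.

Lemma qnorm_leval_ge (Q : {poly R}) : Q != 0 -> exists c r : R,
  [/\ 0 < c, 1 <= r & forall p, r < qnorm p ->
      c * qnorm p ^+ (size Q).-1 <= qnorm (leval (polyH Q) p)].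
Proof.
move=> Q0; set k := (size Q).-1; set l := lead_coef Q.
pose S := polyH (Q - l *: 'X^k); have [B B0 SB] := qnorm_leval_le S.
have l0 : 0 < `|l| by rewrite normr_gt0 lead_coef_eq0.
(* Beyond radius 2 B / |l| the lower order terms are at most half of the leading one; the summand 1
   keeps |p| > 1. *)
exists (`|l| / 2), (1 + 2 * B / `|l|); split=> [||p rp]; first by rewrite divr_gt0.
  by rewrite lerDl divr_ge0 ?mulr_ge0.
have p1 : 1 < qnorm p by apply: le_lt_trans rp; rewrite lerDl divr_ge0 ?mulr_ge0.
have p0 : 0 < qnorm p by apply: lt_trans p1.
have QE : polyH Q = polyH (l *: 'X^k) + S.
  by rewrite /S /polyH -rmorphD addrC subrK.
have sS : (size S <= k)%N.
  apply/leq_sizeP => j; rewrite coef_map /= coefB coefZ coefXn leq_eqVlt.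
  case/predU1P => [<-|kj]; first by rewrite eqxx mulr1 subrr raddf0.
  rewrite gtn_eqF // mulr0 subr0 nth_default ?raddf0 //.
  by rewrite -[size Q]prednK ?lt0n ?size_poly_eq0.
have levX j : leval 'X^j p = p ^+ j.
  elim: j => [|j IHj]; last by rewrite exprSr levalMX IHj exprS.
  by rewrite !expr0 /leval size_poly1 big_ord1 expr0 mul1r coef1.
have top : qnorm (leval (polyH (l *: 'X^k)) p) = `|l| * qnorm p ^+ k.
  have -> : polyH (l *: 'X^k) = (qreal l)%:P * 'X^k.
    by rewrite /polyH -mul_polyC rmorphM /= map_polyC map_polyXn.
  by rewrite leval_realM levX qnormM qnorm_real qnormX.
have low : `|l| * qnorm p ^+ k <= qnorm (leval (polyH Q) p) + qnorm (leval S p).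
  by rewrite -top -(qnormN (leval S p)) -[polyH (_ *: _)](addrK S) -QE levalB ler_qnormD.
have := SB p k (ltW p1) sS; set s := qnorm (leval S p) in low *.
set X := qnorm p ^+ k in low * => sB.
have X0 : 0 < X by rewrite exprn_gt0.
have sX : s <= X * (`|l| / 2).
  rewrite -(ler_pM2l p0) (le_trans sB) // mulrCA ler_pM2l //.
  rewrite mulrA ler_pdivlMr // mulrC -ler_pdivrMr //.
  by rewrite (le_trans _ (ltW rp)) // lerDr.
by move: low sX; rewrite -lerBlDr => low sX; apply: le_trans low; lra.
Qed.

(** If deg f >= deg Q, then for a small eps the polynomial f^2 - eps^2 Q^2 has a positive leading
    coefficient; being eventually positive, it contradicts |f| < eps |Q|. *)
Lemma poly_growth (f Q : {poly R}) : Q != 0 ->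
  (forall eps, 0 < eps -> exists r, forall x, r < x -> `|f.[x]| < eps * `|Q.[x]|) ->
  (size f < size Q)%N.
Proof.
move=> Q0 fQ; rewrite ltnNge; apply/negP => sQf.
have f0 : f != 0 by apply: contraTneq sQf => ->; rewrite size_poly0 leqn0 size_poly_eq0.
pose d := (size f).-1; pose c := Q`_d; pose l := lead_coef f.
have sf : size f = d.+1 by rewrite prednK // lt0n size_poly_eq0.
have l0 : 0 < `|l| by rewrite normr_gt0 lead_coef_eq0.
have fd : f`_d = l by rewrite /l lead_coefE.
(* [c] is the coefficient of Q in degree deg f, possibly 0; this eps ensures eps |c| < |l|. *)
pose eps := `|l| / (`|c| + 1).
have c1 : 0 < `|c| + 1 by rewrite ltr_wpDl.
have e0 : 0 < eps by rewrite divr_gt0.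
pose h := f * f - (eps ^+ 2) *: (Q * Q).
have hd : 0 < h`_(d + d).
  rewrite coefB coefZ !coefM_top ?sf -?sf // fd -!expr2 -exprMn subr_gt0.
  rewrite -[ltLHS]real_normK ?num_real // -[ltRHS]real_normK ?num_real //.
  rewrite ltr_pXn2r ?nnegrE // normrM (gtr0_norm e0) /eps mulrAC ltr_pdivrMr //.
  by rewrite ltr_pM2l // ltrDl.
have sh : (size h <= (d + d).+1)%N.
  rewrite (leq_trans (size_polyD _ _)) // size_polyN geq_max; apply/andP; split.
    by rewrite (leq_trans (size_polyMleq _ _)) // sf addnS.
  rewrite (leq_trans (size_scale_leq _ _)) // (leq_trans (size_polyMleq _ _)) //.
  by rewrite -subn1 leq_subLR add1n -addnS -addSn leq_add // -sf.
have lh : lead_coef h = h`_(d + d).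
  rewrite lead_coefE; suff -> : size h = (d + d).+1 by [].
  apply/eqP; rewrite eqn_leq sh ltnNge; apply: contraTN hd => /(nth_default 0) ->.
  by rewrite ltxx.
have [r fr] := fQ eps e0.
have [y yh] := poly_pinfty_gt_lc (eq_ind_r (fun x => 0 < x) hd lh).
pose x := Num.max r y + 1.
have xr : r < x by rewrite ltr_pwDr // le_max lexx.
have /yh : y <= x by rewrite (@le_trans _ _ (Num.max r y)) ?le_max ?lexx ?orbT ?lerDl.
rewrite lh => hx; have := lt_le_trans hd hx.
rewrite hornerD hornerN hornerZ !hornerM -!expr2 -exprMn subr_gt0.
rewrite -[ltLHS]real_normK ?num_real // -[ltRHS]real_normK ?num_real //.
rewrite ltr_pXn2r ?nnegrE // normrM (gtr0_norm e0) => /(lt_trans (fr x xr)).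
by rewrite ltxx.
Qed.

Lemma chi_eq0 n m (A : 'M[H]_(n, m)) : chi A = 0 -> A = 0.
Proof.
rewrite -[X in _ = X](chi0 R n m) !chi_chi_mx; apply: chi_mx_inj => p p1 p2.
by apply: quat_eqP; rewrite ?p1 ?p2 raddf0.
Qed.

Lemma chip_size_leP n m (E : 'M[{poly H}]_(n, m)) k :
  (forall a b, (size (chip E a b) <= k)%N) <-> (forall i j, (size (E i j) <= k)%N).
Proof.
split=> sE.
  suff key l : (k <= l)%N -> map_mx (fun f : {poly H} => f`_l) E = 0.
    move=> i j; apply/leq_sizeP => l kl.
    by have /matrixP/(_ i j) := key l kl; rewrite !mxE.
  move=> kl; apply: chi_eq0; rewrite -coef_chip; apply/matrixP => a b.
  by rewrite [LHS]mxE [RHS]mxE /= nth_default // (leq_trans (sE a b)).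
suff key l : (k <= l)%N -> map_mx (coefp l) (chip E) = 0.
  move=> a b; apply/leq_sizeP => l kl.
  by have /matrixP/(_ a b) := key l kl; rewrite [LHS]mxE [RHS]mxE.
move=> kl; rewrite coef_chip -[RHS](chi0 R); congr chi; apply/matrixP => i j.
by rewrite !mxE nth_default // (leq_trans (sE i j)).
Qed.

(** Both conditions say that F - I is strictly proper, once on the complex side and once over {poly
    H}; [chip] is injective on coefficients, so degree bounds transfer both ways. *)
Lemma qnum_near_scalarP n (F : srat R n n) :
  (forall a b, (size (qnum F a b - qden F *+ (a == b))%R < size (qden F))%N) <->
  (forall i j, (size (snum F i j - polyH (sden F) *+ (i == j))%R < size (sden F))%N).
Proof.
have sQ : size (qden F) = size (sden F) by rewrite size_map_poly.
have sQk : size (sden F) = (size (sden F)).-1.+1.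
  by rewrite prednK // lt0n size_poly_eq0 sden_neq0.
pose E := snum F - (polyH (sden F))%:M.
have chE : chip E = qnum F - (qden F)%:M.
  by rewrite /E /chip chi_mxD chi_mxN -!/(chip _) chip_scalar.
have EE i j : E i j = snum F i j - polyH (sden F) *+ (i == j) by rewrite !mxE.
have cE a b : chip E a b = qnum F a b - qden F *+ (a == b).
  by rewrite chE [LHS]mxE [in X in _ + X]mxE [in X in _ + X]mxE.
rewrite sQ sQk.
split=> h.
  suff h' : forall i j, (size (E i j) <= (size (sden F)).-1)%N.
    by move=> i j; rewrite -EE ltnS h'.
  by apply/chip_size_leP => a b; rewrite cE -ltnS h.
suff h' : forall a b, (size (chip E a b) <= (size (sden F)).-1)%N.
  by move=> i j; rewrite -cE ltnS h'.
by apply/chip_size_leP => a b; rewrite EE -ltnS h.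
Qed.

Lemma frac_at_sub1 n (F : srat R n n) p i j : sden_at F p != 0 ->
  frac_at F p i j - (1%:M : 'M[H]_n) i j =
  (sden_at F p)^-1 * leval (snum F i j - polyH (sden F) *+ (i == j)) p.
Proof.
move=> Fp; rewrite /frac_at !mxE levalB mulrBr; congr (_ - _).
case: eqP => _; last by rewrite !mulr0n leval0 mulr0.
by rewrite !mulr1n -/(sden_at F p) mulVr.
Qed.

(** The limit is exploited at real points only, where each of the four coordinates of a numerator
    entry of F - I is a real polynomial of smaller growth than the denominator. *)
Lemma svalue_infty_near_scalar n (F : srat R n n) : svalue_infty F 1%:M ->
  forall a b, (size (qnum F a b - qden F *+ (a == b))%R < size (qden F))%N.
Proof.
move=> F1; apply/qnum_near_scalarP => i j; set e := _ - _.
have [c [r0 [c0 r01 Qlow]]] := qnorm_leval_ge (sden_neq0 F).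
have small eps : 0 < eps -> exists r, forall x : R, r < x ->
    qnorm (leval e (qreal x)) < eps * `|(sden F).[x]|.
  move=> e0; have [r Fr] := F1 eps e0; exists (Num.max r r0) => x.
  rewrite gt_max => /andP[rx r0x].
  have x0 : 0 < x by apply: lt_trans r0x; apply: lt_le_trans r01.
  have nx : qnorm (qreal x) = x by rewrite qnorm_real gtr0_norm.
  have Fx : sden_at F (qreal x) != 0.
    rewrite -qnorm_gt0; apply: lt_le_trans (Qlow _ _); rewrite nx //.
    by rewrite mulr_gt0 ?exprn_gt0.
  have /Fr[_ /(_ i j)] : r < qnorm (qreal x) by rewrite nx.
  rewrite sval_atE // frac_at_sub1 // -/e qnormM qnormV //.
  rewrite mulrC ltr_pdivrMr ?qnorm_gt0 // /sden_at.
  rewrite (_ : leval (polyH _) _ = qreal (sden F).[x]) ?qnorm_real //.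
  have -> : qreal x = qz x%:C%C by [].
  rewrite leval_qz cpart1_polyH cpart2_polyH horner0 /cpoly horner_map.
  by [].
(* A real-linear coordinate dominated by the norm reduces the estimate to real polynomials. *)
have comp (c' : {additive H -> R}) : (forall x q, c' (qreal x * q) = x * c' q) ->
    (forall q, `|c' q| <= qnorm q) -> (size (map_poly c' e) < size (sden F))%N.
  move=> cM cle; apply: poly_growth (sden_neq0 F) _ => eps e0.
  have [r Fr] := small eps e0; exists r => x /Fr; apply: le_lt_trans.
  rewrite (_ : _.[x] = c' (leval e (qreal x))) ?cle //.
  rewrite (horner_coef_wide _ (size_poly _ _)) /leval raddf_sum.
  by apply: eq_bigr => k _; rewrite coef_map /= -rmorphXn cM mulrC.
have sQk : size (sden F) = (size (sden F)).-1.+1.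
  by rewrite prednK // lt0n size_poly_eq0 sden_neq0.
have le2 (x y : R) (q : H) : x ^+ 2 + y = qnormsq q -> 0 <= y -> `|x| <= qnorm q.
  by move=> xy y0; rewrite -sqrtr_sqr ler_wsqrtr // -xy lerDl.
pose re : {additive H -> R} := HB.pack (@qre R) (GRing.isAdditive.Build H R (@qre R) (fun
  _ _ => erefl)).
pose im : {additive H -> R} := HB.pack (@qpi R) (GRing.isAdditive.Build H R (@qpi R) (fun
  _ _ => erefl)).
pose jm : {additive H -> R} := HB.pack (@qpj R) (GRing.isAdditive.Build H R (@qpj R) (fun
  _ _ => erefl)).
pose km : {additive H -> R} := HB.pack (@qpk R) (GRing.isAdditive.Build H R (@qpk R) (fun
  _ _ => erefl)).
have s1 : (size (map_poly re e) < size (sden F))%N.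
  apply: comp => [x [a b c' d]|q]; first by rewrite /=; ring.
  by apply: (le2 _ (qpi q ^+ 2 + qpj q ^+ 2 + qpk q ^+ 2));
    rewrite ?addr_ge0 ?sqr_ge0 // /qnormsq /re /=; ring.
have s2 : (size (map_poly im e) < size (sden F))%N.
  apply: comp => [x [a b c' d]|q]; first by rewrite /=; ring.
  by apply: (le2 _ (qre q ^+ 2 + qpj q ^+ 2 + qpk q ^+ 2));
    rewrite ?addr_ge0 ?sqr_ge0 // /qnormsq /im /=; ring.
have s3 : (size (map_poly jm e) < size (sden F))%N.
  apply: comp => [x [a b c' d]|q]; first by rewrite /=; ring.
  by apply: (le2 _ (qre q ^+ 2 + qpi q ^+ 2 + qpk q ^+ 2));
    rewrite ?addr_ge0 ?sqr_ge0 // /qnormsq /jm /=; ring.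
have s4 : (size (map_poly km e) < size (sden F))%N.
  apply: comp => [x [a b c' d]|q]; first by rewrite /=; ring.
  by apply: (le2 _ (qre q ^+ 2 + qpi q ^+ 2 + qpj q ^+ 2));
    rewrite ?addr_ge0 ?sqr_ge0 // /qnormsq /km /=; ring.
rewrite sQk !ltnS in s1 s2 s3 s4 *; apply/leq_sizeP => l kl.
have z0 (c' : {additive H -> R}) : (size (map_poly c' e) <= (size (sden F)).-1)%N ->
    c' e`_l = 0.
  by move=> sc; rewrite -coef_map nth_default // (leq_trans sc).
have := (z0 _ s1, z0 _ s2, z0 _ s3, z0 _ s4).
by case: e`_l => a b c' d /= [[[-> ->] ->] ->].
Qed.

Lemma near_scalar_svalue_infty n (F : srat R n n) :
  (forall a b, (size (qnum F a b - qden F *+ (a == b))%R < size (qden F))%N) ->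
  svalue_infty F 1%:M.
Proof.
move=> /qnum_near_scalarP sF eps e0.
have [c [r0 [c0 r01 Qlow]]] := qnorm_leval_ge (sden_neq0 F).
pose e i j := snum F i j - polyH (sden F) *+ (i == j).
have sQk : size (sden F) = (size (sden F)).-1.+1.
  by rewrite prednK // lt0n size_poly_eq0 sden_neq0.
have /all_sig2[B B0 eB] (ij : 'I_n * 'I_n) := cid2 (qnorm_leval_le (e ij.1 ij.2)).
pose BB := \sum_ij B ij; have BB0 : 0 <= BB by apply: sumr_ge0.
(* Past the first radius |Q(p)| >= c X; past the second each numerator is at most X BB / |p| < eps c
   X. The sum BB serves all entries at once. *)
exists (Num.max r0 (BB / (c * eps))) => p; rewrite gt_max => /andP[r0p rp].
have p1 : 1 < qnorm p by apply: le_lt_trans r0p.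
have p0 : 0 < qnorm p by apply: lt_trans p1.
have nz q : qnorm q = qnorm p -> sden_at F q != 0.
  move=> qp; rewrite -qnorm_gt0; apply: lt_le_trans (Qlow _ _); rewrite qp //.
  by rewrite mulr_gt0 ?exprn_gt0.
split.
  (* The point tested by [spole] is the representative of the sphere of p in the slice through i; it
     has the same norm as p. *)
  apply: nonroot_not_Rpole; rewrite /root -qz_eq0 -sden_at_qz; apply: nz.
  rewrite /qnorm /qnormsq /= expr0n /= !addr0 sqr_sqrtr ?addr_ge0 ?sqr_ge0 //.
  by rewrite !addrA.
move=> i j; have Fp := nz p erefl; rewrite sval_atE // frac_at_sub1 //.
rewrite qnormM qnormV // mulrC ltr_pdivrMr ?qnorm_gt0 //.
have := Qlow p r0p; set X := qnorm p ^+ _ => QX.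
have X0 : 0 < X by rewrite exprn_gt0.
have := eB (i, j) p (size (sden F)).-1 (ltW p1) _; rewrite -ltnS -sQk sF => /(_ isT).
rewrite -/X -/(e i j) => eX.
rewrite -(ltr_pM2l p0) (le_lt_trans eX) //.
have BBij : B (i, j) <= BB.
  by rewrite /BB (bigD1 (i, j)) //= lerDl sumr_ge0.
apply: (@lt_le_trans _ _ (qnorm p * (eps * (c * X)))).
  apply: (@le_lt_trans _ _ (X * BB)); first by rewrite ler_pM2l.
  rewrite [ltRHS](_ : _ = X * (qnorm p * (c * eps))); last by ring.
  by rewrite ltr_pM2l // -ltr_pdivrMr ?mulr_gt0.
by rewrite ler_pM2l // ler_pM2l.
Qed.

End ValueAtInfinity.

(** * Negative squares *)

(* Killing all spectral components of [u] but one, by a product of shifts. *)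
Lemma hermitian_neg_component (C : numClosedFieldType) m (A : 'M[C]_m) (u : 'cV[C]_m) :
  adjmx A = A -> (adjmx u *m A *m u) 0 0 < 0 ->
  exists (s : seq C) (l : C), [/\ l < 0, all (mem Num.real) s &
    let x := foldr (fun r x => A *m x - r *: x) u s in A *m x = l *: x /\ x != 0].
Proof.
move=> Ah neg; have Aher : A \is hermsymmx.
  by apply/is_hermitianmxP; rewrite expr0 scale1r -[LHS]Ah.
have /orthomx_spectralP := hermitian_normalmx Aher.
have Dr := hermitian_spectral_diag_real Aher.
have Pu := spectral_unitarymx A.
set P := spectralmx A in Pu *; set D := spectral_diag A in Dr * => AE.
have Pun : P \in unitmx by apply: spectral_unit.
have PA (x : 'cV[C]_m) i : (P *m (A *m x)) i 0 = D 0 i * (P *m x) i 0.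
  by rewrite AE !mulmxA mulmxV // mul1mx -mulmxA mul_diag_mx mxE.
pose eta := P *m u.
(* In the orthonormal eigenbasis the form is the sum of D_i |eta_i|^2, so a negative value needs a
   negative D_j with eta_j nonzero. *)
have [j Dj ej] : exists2 j, D 0 j < 0 & eta j 0 != 0.
  have E : (adjmx u *m A *m u) 0 0 = \sum_i D 0 i * (eta i 0 * (eta i 0)^*).
    have Pi : invmx P = adjmx P by rewrite invmx_unitary.
    rewrite AE Pi !mulmxA -adjmxM -/eta -[_ *m P *m u]mulmxA -/eta.
    rewrite -mulmxA mul_diag_mx mxE; apply: eq_bigr => i _; rewrite !mxE.
    by rewrite mulrCA [_^* * _]mulrC.
  have Dre i : D 0 i \is Num.real by apply: (mxOverP Dr).
  case: (pselect (exists2 j, D 0 j < 0 & eta j 0 != 0)) => // no.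
  suff /le_gtF : 0 <= (adjmx u *m A *m u) 0 0 by rewrite neg.
  rewrite E sumr_ge0 // => i _.
  have [->|e0] := eqVneq (eta i 0) 0; first by rewrite mul0r mulr0.
  rewrite mulr_ge0 ?mul_conjC_ge0 // real_leNgt ?real0 //.
  by apply/negP => Di; apply: no; exists i.
pose s := [seq D 0 i | i <- enum 'I_m & D 0 i != D 0 j].
exists s, (D 0 j); split=> //.
  by apply/allP => _ /mapP[i _ ->]; apply: (mxOverP Dr).
set x := foldr _ _ _.
have xE i : (P *m x) i 0 = \prod_(r <- s) (D 0 i - r) * eta i 0.
  rewrite /x; elim: (s) => [|r t IHs]; first by rewrite big_nil mul1r.
  rewrite big_cons /= mulmxBr -scalemxAr [LHS]mxE PA [X in _ + X]mxE [X in _ - X]mxE.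
  by rewrite IHs; ring.
split; last first.
  apply/eqP => x0; have := xE j; rewrite x0 mulmx0 mxE => /esym/eqP.
  rewrite mulf_eq0 (negPf ej) orbF prodf_seq_eq0 => /hasP[r]; rewrite /s.
  case/mapP => i; rewrite mem_filter => /andP[ij _] -> /=; rewrite subr_eq0 eq_sym.
  by rewrite (negPf ij).
suff E : P *m (A *m x) = P *m (D 0 j *: x) by rewrite -(mulKmx Pun (A *m x)) E mulKmx.
apply/colP => i; rewrite PA -scalemxAr [RHS]mxE xE.
have [->//|Dij] := eqVneq (D 0 i) (D 0 j).
have Ds : D 0 i \in s by rewrite /s map_f // mem_filter Dij mem_enum.
by rewrite (big_rem _ Ds) /= subrr !(mul0r, mulr0).
Qed.

Section NegativeEigenvectors.
Variable R : rcfType.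
Notation H := (quat R).
Notation C := R[i].

(* The identification of H^m with C^(2m) under which A acts as chi A. *)
Definition vcol m (y : 'cV[H]_m) : 'cV[C]_(m + m) :=
  col_mx (map_mx (@qchi1 R) y) (- map_mx (conjc \o @qchi2 R) y).

Definition unvcol m (u : 'cV[C]_(m + m)) : 'cV[H]_m :=
  \col_i qmk (u (lshift m i) 0) (- (u (rshift m i) 0)^*).

Lemma unvcolK m (u : 'cV[C]_(m + m)) : vcol (unvcol u) = u.
Proof.
rewrite -[RHS]vsubmxK /vcol; congr col_mx; apply/colP => i; rewrite !mxE.
  by rewrite qchi1_mk.
by rewrite -[(_ \o _) _]/(Num.conj (qchi2 _)) qchi2_mk rmorphN /= conjCK opprK.
Qed.

(** [vcol y] is the first column of [chi y], so this is one column of [chiM]. *)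
Lemma vcolM m n (A : 'M[H]_(m, n)) (y : 'cV[H]_n) : vcol (A *m y) = chi A *m vcol y.
Proof.
have chE l (x : 'cV[H]_l) :
    chi x = row_mx (vcol x) (col_mx (map_mx (@qchi2 R) x) (map_mx (conjc \o @qchi1 R) x)).
  by rewrite /chi block_mxEh.
by have := chiM A y; rewrite (chE _ y) mul_mx_row chE => /eq_row_mx[].
Qed.

Fact vcol_is_additive m : additive (@vcol m).
Proof.
move=> x y; rewrite /vcol opp_col_mx add_col_mx -opprD; congr col_mx.
  by apply/colP => i; rewrite !mxE raddfB.
by congr (- _); apply/colP => i; rewrite !mxE /= !raddfB.
Qed.
HB.instance Definition _ m :=
  GRing.isAdditive.Build 'cV[H]_m 'cV[C]_(m + m) (@vcol m) (@vcol_is_additive m).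

Lemma vcol_eq0 m (y : 'cV[H]_m) : (vcol y == 0) = (y == 0).
Proof.
apply/eqP/eqP => [|->]; last exact: raddf0.
rewrite -(@col_mx0 _ m m) => /eq_col_mx[/colP E1 /colP E2]; apply/colP => i.
have := (E1 i, E2 i); rewrite !mxE -[(_ \o _) _]/(Num.conj (qchi2 _)) => -[e1 /eqP].
rewrite oppr_eq0 conjC_eq0 => /eqP e2.
by apply: quat_eqP; rewrite ?e1 ?e2 raddf0.
Qed.

Lemma qchi_real (x : R) (q : H) : qchi1 (qreal x * q) = x%:C%C * qchi1 q /\
  qchi2 (qreal x * q) = x%:C%C * qchi2 q.
Proof. by case: q => a b c d; split; congr Complex => /=; ring. Qed.

Lemma vcolZ m (x : R) (y : 'cV[H]_m) : vcol (qreal x *: y) = x%:C%C *: vcol y.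
Proof.
rewrite /vcol scale_col_mx scalerN; congr (col_mx _ (- _)); apply/colP => i.
  by rewrite !mxE; case: (qchi_real x (y i 0)).
rewrite !mxE -![(_ \o _) _]/(Num.conj (qchi2 _)); case: (qchi_real x (y i 0)) => _ ->.
by rewrite rmorphM /=; congr (_ * _); exact: conjc_real.
Qed.

(** Only one complex part of the quaternionic form survives; a Hermitian form is real-valued, so its
    sign is still visible. *)
Lemma vcol_form m (w : 'cV[H]_m) (b : 'cV[H]_m) :
  (adjmx (vcol w) *m vcol b) 0 0 = qchi1 ((ctrmx w *m b) 0 0).
Proof.
have := congr1 (fun x : 'cV[C]_(1 + 1) => usubmx x 0 0) (vcolM (ctrmx w) b).
rewrite {1}/vcol col_mxKu [LHS]mxE => ->.
rewrite -mul_usub_mx; congr ((_ *m _) 0 0).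
by rewrite chi_ctrmx /adjmx tr_block_mx map_block_mx block_mxEv col_mxKu tr_col_mx
  map_row_mx.
Qed.

(** The eigenvector is exhibited as a product of real shifts of G applied to w: in this form it
    inherits from w the orthogonality to given eigenvectors. Realness of the shifts is what lets the
    construction descend from [chi G] to G. *)
Lemma quat_neg_eigenvector m (G : 'M[H]_m) (w : 'cV[H]_m) :
  ctrmx G = G -> qre ((ctrmx w *m G *m w) 0 0) < 0 ->
  exists (s : seq R) (l : R), l < 0 /\
    let x := foldr (fun r x => G *m x - qreal r *: x) w s in
    G *m x = qreal l *: x /\ x != 0.
Proof.
move=> Gh neg; have Ch : adjmx (chi G) = chi G by rewrite -chi_ctrmx Gh.
have [] := hermitian_neg_component (u := vcol w) Ch.
  rewrite -mulmxA -vcolM vcol_form mulmxA.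
  set h := (_ *m _) 0 0 in neg *.
  have hc : qconj h = h.
    have : ctrmx (ctrmx w *m G *m w) = ctrmx w *m G *m w.
      by rewrite !ctrmxM ctrmxK Gh mulmxA.
    by move/matrixP/(_ 0 0); rewrite /h [LHS]mxE [in LHS]mxE.
  have h0 : qpi h = 0.
    have /(congr1 (@qpi R)) /= := hc; case: h {neg hc} => a b c d /= /eqP.
    by rewrite eq_sym -addr_eq0 -mulr2n mulrn_eq0 /= => /eqP.
  by rewrite ltcE /= h0 eqxx.
move=> s [l [l0 sr [E x0]]].
have [rs rsE] : exists rs : seq R, s = [seq x%:C%C | x <- rs].
  elim: s sr {E x0} => [|z s IHs] /=; first by exists [::].
  by case/andP => /complex_realP[x ->] /IHs[rs ->]; exists (x :: rs).
have [x lE] : exists x, l = x%:C%C by apply/complex_realP; rewrite ler0_real ?ltW.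
exists rs, x; split; first by move: l0; rewrite lE ltcE => /andP[].
set y := foldr _ _ _ => /=.
have yE : vcol y = foldr (fun r x => chi G *m x - r *: x) (vcol w) s.
  rewrite /y rsE; elim: (rs) => [//|r t IHt] /=.
  by rewrite raddfB /= vcolM vcolZ IHt.
rewrite -yE in E x0; split; last by rewrite -vcol_eq0.
by apply/eqP; rewrite -subr_eq0 -vcol_eq0 raddfB /= vcolM vcolZ E lE subrr.
Qed.

(** Linear algebra over the skew field through chi: 2k complex equations in 2r unknowns have a
    nonzero solution, which [unvcol] reads back as a quaternionic vector. *)
Lemma quat_underdetermined k r (B : 'M[H]_(k, r)) : (k < r)%N ->
  exists2 xi : 'cV[H]_r, xi != 0 & B *m xi = 0.
Proof.
move=> kr; have : kermx (chi B)^T != 0.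
  rewrite -mxrank_eq0 mxrank_ker subn_eq0 -ltnNge.
  by rewrite (leq_ltn_trans (rank_leq_col _)) // !addnn ltn_double.
case/rowV0Pn => v /sub_kermxP vB v0; exists (unvcol v^T).
  by rewrite -vcol_eq0 unvcolK -trmx0 (inj_eq (@trmx_inj _ _ _)).
by apply/eqP; rewrite -vcol_eq0 vcolM unvcolK -[chi B]trmxK -trmx_mul vB trmx0.
Qed.

Lemma ctrmx_mul_eq0 m (x : 'cV[H]_m) : (ctrmx x *m x) 0 0 = 0 -> x = 0.
Proof.
move=> x0; apply/eqP; rewrite -vcol_eq0; apply/eqP/adjmx_mul_eq0 => j.
by rewrite ord1 vcol_form x0 raddf0.
Qed.

(** While k < r, some nonzero xi makes W xi orthogonal to the k eigenvectors already found, and the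
    form is negative at W xi; this yields one more negative eigenvector orthogonal to them. *)
Lemma neg_eig_step m (G : 'M[H]_m) k r (W : 'M[H]_(m, r)) : ctrmx G = G ->
  (forall xi : 'cV[H]_r, xi != 0 ->
    qre ((ctrmx xi *m (ctrmx W *m G *m W) *m xi) 0 0) < 0) ->
  (k < r)%N -> neg_eig_ge G k -> neg_eig_ge G k.+1.
Proof.
move=> Gh neg kr [V [d [dn GV Vi]]].
have [xi xi0 Vxi] := quat_underdetermined (ctrmx V *m W) kr.
have [|s [l [l0 [Gx x0]]]] := @quat_neg_eigenvector m G (W *m xi) Gh.
  by rewrite ctrmxM !mulmxA; have := neg _ xi0; rewrite !mulmxA.
set x := foldr _ _ _ in Gx x0.
(* G is Hermitian and G V = V diag(d), so G and all its real shifts preserve the orthogonal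
   complement of the columns of V. *)
have Vx : ctrmx V *m x = 0.
  rewrite /x; elim: (s) => [|a t IHt] /=; first by rewrite mulmxA.
  have ZE n' (c : R) (y : 'cV[H]_n') : qreal c *: y = y *m (qreal c)%:M.
    by apply/matrixP => i j; rewrite [j]ord1 !mxE big_ord1 !mxE mulr1n qrealC.
  rewrite mulmxBr mulmxA ZE [ctrmx V *m (_ *m _)]mulmxA IHt mul0mx subr0.
  by rewrite -{1}Gh -ctrmxM GV ctrmxM -mulmxA IHt mulmx0.
rewrite -[k.+1]/(1 + k)%N; exists (row_mx x V), (row_mx l%:M d); split.
- move=> j; rewrite mxE; case: splitP => i _; last exact: dn.
  by rewrite ord1 mxE eqxx.
- rewrite mul_mx_row GV map_row_mx diag_mx_row mul_row_block !mulmx0 addr0 add0r Gx.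
  congr row_mx; apply/matrixP => i j.
  by rewrite [j]ord1 !mxE big_ord1 !mxE !mulr1n qrealC.
move=> c; rewrite -[c]vsubmxK mul_row_col => E.
have xV : ctrmx x *m V = 0 by rewrite -[V]ctrmxK -ctrmxM Vx; apply/matrixP => i j;
  rewrite !mxE; congr Quat; rewrite oppr0.
have c1 : usubmx c = 0.
  have := congr1 (mulmx (ctrmx x)) E; rewrite mulmxDr !mulmxA xV mul0mx addr0 mulmx0.
  move/matrixP/(_ 0 0); rewrite !mxE big_ord1 => E0.
  apply/matrixP => i j; rewrite !ord1 [RHS]mxE; apply/eqP/negPn/negP => nz.
  case/negP: x0; apply/eqP/ctrmx_mul_eq0.
  by move/(congr1 (fun h => h / usubmx c 0 0)): E0; rewrite mulrK // mul0r.
by move: E; rewrite c1 mulmx0 add0r => /Vi ->; rewrite col_mx0.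
Qed.

End NegativeEigenvectors.

(** * One-sided limits at 0 of quaternion-valued functions *)

Section NearZero.
Variable R : rcfType.
Notation H := (quat R).
Notation C := R[i].
Implicit Types (P : R -> Prop) (f g : R -> H) (p q : H).

(** Only t > 0 is constrained: t is either the distance to the axis from the right half-plane or a
    displacement along the axis. *)
Definition near0 P := exists2 d, 0 < d & forall t, 0 < t -> t < d -> P t.

Lemma near0_and P P' : near0 P -> near0 P' -> near0 (fun t => P t /\ P' t).
Proof.
move=> [d d0 Pd] [d' d'0 Pd']; exists (Num.min d d'); first by rewrite lt_min d0.
by move=> t t0; rewrite lt_min => /andP[td td']; split; [exact: Pd|exact: Pd'].
Qed.

Lemma near0_imp P P' : (forall t, 0 < t -> P t -> P' t) -> near0 P -> near0 P'.
Proof. by move=> PP' [d d0 Pd]; exists d => // t t0 td; apply/PP'/Pd. Qed.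

Lemma near0_all (I : finType) (P : I -> R -> Prop) :
  (forall i, near0 (P i)) -> near0 (fun t => forall i, P i t).
Proof.
move=> nP; have /all_sig2[d d0 Pd] i := cid2 (nP i).
suff [e e0 ed] : exists2 e, 0 < e & forall i, i \in enum I -> e <= d i.
  by exists e => // t t0 te i; apply: Pd => //; rewrite (lt_le_trans te) // ed ?mem_enum.
elim: (enum I) => [|i s [e e0 es]]; first by exists 1.
exists (Num.min (d i) e); first by rewrite lt_min d0.
by move=> j; rewrite inE => /predU1P[->|/es js]; rewrite ge_min ?lexx // js orbT.
Qed.

Lemma near0_ex P : near0 P -> exists2 t, 0 < t & P t.
Proof. by case=> d d0 Pd; exists (d / 2); [|apply: Pd]; lra. Qed.

Definition cont0 f := forall e, 0 < e -> near0 (fun t => qnorm (f t - f 0) < e).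

Lemma cont0_bounded f : cont0 f -> near0 (fun t => qnorm (f t) <= qnorm (f 0) + 1).
Proof.
move=> cf; apply: near0_imp (cf 1 ltr01) => t _ h.
by rewrite -[f t](subrK (f 0)) addrC (le_trans (ler_qnormD _ _)) // lerD2l ltW.
Qed.

Lemma cont0_neq0 f : cont0 f -> f 0 != 0 ->
  near0 (fun t => qnorm (f 0) / 2 <= qnorm (f t)).
Proof.
move=> cf f0; have h0 : 0 < qnorm (f 0) / 2 by rewrite divr_gt0 ?qnorm_gt0.
apply: near0_imp (cf _ h0) => t _ h.
have := ler_qnormD (f t) (f 0 - f t); rewrite addrC subrK -opprB qnormN.
by move: h; lra.
Qed.

Lemma cont0_cst p : cont0 (fun=> p).
Proof. by move=> e e0; exists 1 => // t _ _; rewrite subrr qnorm0. Qed.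

Lemma cont0_id : cont0 (@qreal R).
Proof.
move=> e e0; exists e => // t t0 te.
by rewrite -raddfB subr0 qnorm_real gtr0_norm.
Qed.

Lemma cont0D f g : cont0 f -> cont0 g -> cont0 (fun t => f t + g t).
Proof.
move=> cf cg e e0; have e20 : 0 < e / 2 by rewrite divr_gt0.
apply: near0_imp (near0_and (cf _ e20) (cg _ e20)) => t _ [hf hg].
rewrite opprD addrACA (le_lt_trans (ler_qnormD _ _)) //.
by move: hf hg; lra.
Qed.

Lemma cont0_conj f : cont0 f -> cont0 (fun t => qconj (f t)).
Proof.
move=> cf e e0; apply: near0_imp (cf e e0) => t _.
by rewrite -qnorm_conj; congr (qnorm _ < _); case: (f t) (f 0) => [????] [????];
  congr Quat => /=; ring.
Qed.

Lemma cont0M f g : cont0 f -> cont0 g -> cont0 (fun t => f t * g t).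
Proof.
move=> cf cg e e0; pose B := qnorm (f 0) + qnorm (g 0) + 1.
have B0 : 0 < B by rewrite ltr_pwDr ?addr_ge0 ?qnorm_ge0.
have e20 : 0 < e / (2 * B) by rewrite divr_gt0 ?mulr_gt0.
apply: near0_imp (near0_and (cont0_bounded cf) (near0_and (cf _ e20) (cg _ e20))) => t _.
case=> fB [hf hg].
have -> : f t * g t - f 0 * g 0 = f t * (g t - g 0) + (f t - f 0) * g 0.
  by rewrite mulrBr mulrBl addrA subrK.
rewrite (le_lt_trans (ler_qnormD _ _)) // !qnormM.
have fB' : qnorm (f t) <= B by rewrite (le_trans fB) // /B; have := qnorm_ge0 (g 0); lra.
have gB' : qnorm (g 0) <= B by rewrite /B; have := qnorm_ge0 (f 0); lra.
have h1 : qnorm (f t) * qnorm (g t - g 0) <= B * qnorm (g t - g 0).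
  by rewrite ler_wpM2r ?qnorm_ge0.
have h2 : qnorm (f t - f 0) * qnorm (g 0) <= B * qnorm (f t - f 0).
  by rewrite mulrC ler_wpM2r ?qnorm_ge0.
have h3 : B * (e / (2 * B)) = e / 2 by field; rewrite gt_eqF.
have h4 : B * qnorm (g t - g 0) < e / 2 by rewrite -h3 ltr_pM2l.
have h5 : B * qnorm (f t - f 0) < e / 2 by rewrite -h3 ltr_pM2l.
by lra.
Qed.

Lemma cont0V f : cont0 f -> f 0 != 0 -> cont0 (fun t => (f t)^-1).
Proof.
move=> cf f0 e e0; set b := qnorm (f 0); have b0 : 0 < b by rewrite qnorm_gt0.
have e20 : 0 < e * b ^+ 2 / 2 by rewrite divr_gt0 ?mulr_gt0 ?exprn_gt0.
apply: near0_imp (near0_and (cont0_neq0 cf f0) (cf _ e20)) => t _ [hb ht].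
rewrite -/b in hb; have bt : 0 < qnorm (f t) by move: hb; lra.
have ft : f t != 0 by rewrite -qnorm_gt0.
have -> : (f t)^-1 - (f 0)^-1 = (f t)^-1 * (f 0 - f t) * (f 0)^-1.
  by rewrite mulrBr mulrBl mulrK // mulVr // mul1r.
rewrite !qnormM !qnormV // -opprB qnormN -/b ltr_pdivrMr //.
rewrite mulrC ltr_pdivrMr //; apply: (lt_le_trans ht).
by rewrite (_ : e * b ^+ 2 / 2 = e * b * (b / 2)) ?ler_pM2l ?mulr_gt0 //; field.
Qed.

Lemma cont0_sum (I : Type) (r : seq I) (F : I -> R -> H) :
  (forall i, cont0 (F i)) -> cont0 (fun t => \sum_(i <- r) F i t).
Proof.
move=> cF; elim: r => [|i r IHr].
  by under eq_fun do rewrite big_nil; exact: cont0_cst.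
by under eq_fun do rewrite big_cons; exact: cont0D.
Qed.

Lemma cont0X f k : cont0 f -> cont0 (fun t => f t ^+ k).
Proof.
move=> cf; elim: k => [|k IHk].
  by under eq_fun do rewrite expr0; exact: cont0_cst.
by under eq_fun do rewrite exprS; exact: cont0M.
Qed.

Lemma cont0_leval (h : {poly H}) f : cont0 f -> cont0 (fun t => leval h (f t)).
Proof. by move=> cf; apply: cont0_sum => i; apply: cont0M (cont0_cst _); exact: cont0X. Qed.

Lemma cont0_neg f : cont0 f -> qre (f 0) < 0 -> near0 (fun t => qre (f t) <= qre (f 0) / 2).
Proof.
move=> cf f0; have e0 : 0 < - qre (f 0) / 2 by lra.
apply: near0_imp (cf _ e0) => t _ h; have := le_lt_trans (qre_le_qnorm _) h.
by rewrite /= ltr_norml => /andP[_]; lra.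
Qed.

End NearZero.

(** * Diagonal dominance and the Lyapunov identity of the kernel *)

Section Kernel.
Variable R : rcfType.
Notation H := (quat R).
Notation C := R[i].
Implicit Types (p q h : H) (z w : C).

Lemma qre_sum (I : Type) (r : seq I) (F : I -> H) :
  qre (\sum_(i <- r) F i) = \sum_(i <- r) qre (F i).
Proof. exact: (big_morph (@qre R)). Qed.

(** Each off-diagonal term is at most B (|xi_s|^2 + |xi_t|^2) / 2, so in the sum |xi_s|^2 carries
    the factor (r - 1) B + Re A_ss, which is negative. *)
Lemma diag_dominant_neg r (A : 'M[H]_r) (B : R) : 0 <= B ->
  (forall s t, s != t -> qnorm (A s t) <= B) ->
  (forall s, qre (A s s) < - (r%:R * B)) ->
  forall xi : 'cV[H]_r, xi != 0 -> qre ((ctrmx xi *m A *m xi) 0 0) < 0.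
Proof.
move=> B0 off diag xi xi0; pose n s := qnormsq (xi s 0).
have n0 s : 0 <= n s by exact: qnormsq_ge0.
have term s t : qre (qconj (xi s 0) * A s t * xi t 0) <=
    B * (n s + n t) / 2 + (qre (A s s) - B) * n s *+ (s == t).
  have [<-|st] := eqVneq s t.
    rewrite (_ : qre _ = qre (A s s) * n s); last first.
      by rewrite /n; case: (xi s 0) (A s s) => [????] [????]; rewrite /qnormsq /=; ring.
    by rewrite mulr1n [leRHS](_ : _ = qre (A s s) * n s) //; field.
  rewrite mulr0n addr0 (le_trans (ler_norm _)) // (le_trans (qre_le_qnorm _)) //.
  rewrite !qnormM qnorm_conj /n -!sqr_qnorm.
  set a := qnorm (xi s 0); set b := qnorm (xi t 0).
  have ab : 0 <= a * b by rewrite mulr_ge0 ?qnorm_ge0.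
  apply: (@le_trans _ _ (B * (a * b))).
    by rewrite mulrAC [a * b * _]mulrC ler_wpM2r // off.
  rewrite -mulrA ler_wpM2l //; have := sqr_ge0 (a - b); rewrite sqrrB; lra.
have total : qre ((ctrmx xi *m A *m xi) 0 0) <= \sum_s (r%:R * B - B + qre (A s s)) * n s.
  have -> : \sum_s (r%:R * B - B + qre (A s s)) * n s =
      \sum_t \sum_s (B * (n s + n t) / 2 + (qre (A s s) - B) * n s *+ (s == t)).
    pose N := \sum_s n s.
    have E1 t : \sum_s (B * (n s + n t) / 2 + (qre (A s s) - B) * n s *+ (s == t)) =
        B / 2 * N + (r%:R * (B / 2) + (qre (A t t) - B)) * n t.
      rewrite big_split /= (bigD1 t) //= [X in _ + X](bigD1 t) //= eqxx mulr1n.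
      rewrite [X in _ + (_ + X)]big1 => [|i /negPf ->]; last by rewrite mulr0n.
      rewrite -(bigD1 t (P := xpredT) (F := fun s => B * (n s + n t) / 2)) //=.
      rewrite (eq_bigr (fun s => B / 2 * n s + B / 2 * n t)) => [|i _]; last by field.
      rewrite big_split /= -mulr_sumr -/N sumr_const card_ord -[_ * n t *+ r]mulr_natl.
      by ring.
    rewrite (eq_bigr _ (fun t _ => E1 t)) big_split /= sumr_const card_ord -[_ * N *+
      r]mulr_natl.
    by rewrite /N !mulr_sumr -big_split /=; apply: eq_bigr => i _; field.
  rewrite mxE qre_sum; apply: ler_sum => t _.
  rewrite mxE mulr_suml qre_sum; apply: ler_sum => s _.
  by rewrite !mxE.
apply: (le_lt_trans total).
have [s0 s00] : exists s, xi s 0 != 0.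
  case: (pselect (exists s, xi s 0 != 0)) => // no; case/eqP: xi0; apply/colP => i.
  by rewrite mxE; apply/eqP/negPn/negP => nz; apply: no; exists i.
have neg s : r%:R * B - B + qre (A s s) < 0 by have := diag s; lra.
rewrite (bigD1 s0) //= -[ltRHS]addr0 ltr_leD //.
  by rewrite nmulr_rlt0 // lt_def n0 qnormsq_eq0 s00.
by apply: sumr_le0 => s _; rewrite nmulr_rle0.
Qed.

Lemma mulmx_scalarE n m (X : 'M[H]_(n, m)) (c : H) i j : (X *m c%:M) i j = X i j * c.
Proof.
rewrite mxE (bigD1 j) //= big1 => [|l /negPf lj]; last by rewrite mxE lj mulr0n mulr0.
by rewrite mxE eqxx mulr1n addr0.
Qed.

Lemma kernel_numerator p q h :
  p * (p * h + h * q) + (p * h + h * q) * qconj q =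
  (p ^+ 2 + qreal (2 * qre q) * p + qreal (qnormsq q)) * h.
Proof.
case: p q h => [a b c d] [a' b' c' d'] [x y z w].
by congr Quat; rewrite /qnormsq /=; ring.
Qed.

(** D is a polynomial in p with real coefficients, so it commutes with p and can be pulled out; what
    remains is [kernel_numerator]. *)
Lemma kernel_identity n (X : 'M[H]_n) p q :
  let D := p ^+ 2 + qreal (2 * qre q) * p + qreal (qnormsq q) in D != 0 ->
  let K := D^-1 *: (p *: X + X *m q%:M) in p *: K + K *m (qconj q)%:M = X.
Proof.
move=> D D0 K; apply/matrixP => i j; apply: (mulrI (x := D)); first exact: D0.
have DK a b : K a b = D^-1 * (p * X a b + X a b * q).
  by rewrite [LHS]mxE [X in _ * X]mxE [X in _ * (X + _)]mxE mulmx_scalarE.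
have Dp : p * D = D * p.
  rewrite -/(GRing.comm p D) /D; have cr x : GRing.comm p (qreal x) by rewrite
    /GRing.comm qrealC.
  apply: commrD (cr _); apply: commrD; first exact/commrX/commr_refl.
  exact: commrM (cr _) (commr_refl _).
rewrite mxE [X in _ * (X + _)]mxE mulmx_scalarE !DK mulrDr [D * (p * _)]mulrA -Dp -[p * D
  * _]mulrA.
rewrite mulVKr // [D * (_ * qconj q)]mulrA mulVKr //.
exact: kernel_numerator.
Qed.

End Kernel.

(** * Compression of the Gram matrix to complex vectors *)

Section Compression.
Variables (R : rcfType) (n : nat) (F : srat R n n).
Notation H := (quat R).
Notation C := R[i].
Implicit Types (p q h : H) (z w : C) (u : 'cV[C]_(n + n)) (b : bool).

(* A vector u of C^(2n) is split into a part commuting with z (placed at the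
   point z) and a part [d j] (placed at the point z^* ). *)
Definition cpt b z : H := qz (if b then z^* else z).
Definition cvec u b : 'cV[H]_n :=
  if b then \col_i qmk 0 (- (u (rshift n i) 0)^*)
  else \col_i qmk (u (lshift n i) 0) 0.

Arguments cpt : simpl never.
Arguments cvec : simpl never.

(** The pieces of u are chosen for this rule: the quaternionic point acting on the left becomes the
    complex scalar z on the right, the same for both pieces. *)
Lemma cpt_cvec u b z : cpt b z *: cvec u b = cvec u b *m (qz z)%:M.
Proof.
apply/matrixP => i j; rewrite mulmx_scalarE /cpt; case: b; rewrite !mxE qz_mul;
  apply: quat_eqP; rewrite ?qchi1M ?qchi2M /qz !(qchi1_mk, qchi2_mk) ?conjC0;
  by rewrite ?(mul0r, mulr0, subr0, add0r, addr0, oppr0) // mulrC.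
Qed.

Lemma qconj_qz z : qconj (qz z) = qz z^*.
Proof.
by apply: quat_eqP; rewrite ?qchi1_conj ?qchi2_conj /qz !(qchi1_mk, qchi2_mk) ?oppr0.
Qed.

Lemma qconj_cpt b z : qconj (cpt b z) = cpt b z^*.
Proof. by rewrite /cpt qconj_qz; case: b. Qed.

(** [skernel] computed on the fraction as given, where continuity is visible; the two agree where
    the denominators do not vanish ([skernel_kfrac]). *)
Definition kfrac p q : 'M[H]_n :=
  let X := frac_at F p + ctrmx (frac_at F q) in
  (p ^+ 2 + qreal (2 * qre q) * p + qreal (qnormsq q))^-1 *:
    (p *: X + X *m q%:M).

(** The entry between z and w of the Gram matrix once the rows and columns of the two pieces of u
    have been added up; see [compressed_gramE]. *)
Definition hform u z w : H :=
  \sum_(b : bool) \sum_(b' : bool)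
    (ctrmx (cvec u b) *m kfrac (cpt b z) (cpt b' w) *m cvec u b') 0 0.

Definition fform u z : H :=
  \sum_(b : bool) \sum_(b' : bool)
    (ctrmx (cvec u b) *m frac_at F (cpt b z) *m cvec u b') 0 0.

Lemma cpt_re b z : qre (cpt b z) = complex.Re z.
Proof. by case: b; case: z. Qed.

Lemma cpt_normsq b b' z : qnormsq (cpt b z) = qnormsq (cpt b' z).
Proof.
by case: z => x y; case: b; case: b'; rewrite /cpt /qnormsq /= ?sqrrN.
Qed.

Lemma cconjE (f : {poly C}) z : (cconj f).[z] = (f.[z^*])^*.
Proof. by rewrite -{1}[z]conjCK horner_map. Qed.

Lemma horner_qden_conj z : (qden F).[z^*] = ((qden F).[z])^*.
Proof. by rewrite -[qden F in LHS]/(cpoly (sden F)) -cconj_cpoly cconjE conjCK. Qed.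

Lemma sum_bool2 (f : bool -> bool -> H) :
  \sum_b \sum_b' f b b' = f true true + f true false + (f false true + f false false).
Proof. by rewrite !big_bool. Qed.

(** Sandwiched between the pieces of u, the identity p K + K conj q = X has p replaced by z and conj
    q by conj z, so each kernel term contributes 2 Re z times its real part. On the other side the
    terms pair up with their conjugates. *)
Lemma qre_hform u z : 0 < complex.Re z ->
  complex.Re z * qre (hform u z z) = qre (fform u z).
Proof.
move=> x0.
pose X b b' := frac_at F (cpt b z) + ctrmx (frac_at F (cpt b' z)).
pose T b b' := (ctrmx (cvec u b) *m kfrac (cpt b z) (cpt b' z) *m cvec u b') 0 0.
have key b b' : qz z * T b b' + T b b' * qz z^* =
    (ctrmx (cvec u b) *m X b b' *m cvec u b') 0 0.
  (* Both points have real part Re z and norm |z|, so the denominator reduces to 4 (Re z) p. *)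
  have D0 : (cpt b z) ^+ 2 + qreal (2 * qre (cpt b' z)) * cpt b z + qreal (qnormsq (cpt
    b' z)) != 0.
    rewrite (_ : _ + _ = qreal (4 * complex.Re z) * cpt b z); last first.
      rewrite (cpt_normsq b' b) cpt_re; case: (z) => x y.
      by case: (b); rewrite /cpt; congr Quat; rewrite /qnormsq /=; ring.
    rewrite -qnorm_eq0 qnormM mulf_neq0 // qnorm_eq0.
      apply/eqP => -[] /eqP; rewrite mulf_eq0 pnatr_eq0 /=.
      by rewrite (gt_eqF x0).
    by apply/eqP => /(congr1 (@qre R)); rewrite cpt_re => E; rewrite E ltxx in x0.
  rewrite -(kernel_identity (X b b') D0) -/(kfrac (cpt b z) (cpt b' z)).
  set K := kfrac _ _.
  rewrite mulmxDr mulmxDl [RHS]mxE; congr (_ + _).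
    have -> : ctrmx (cvec u b) *m (cpt b z *: K) = ctrmx (cpt b z^* *: cvec u b) *m K.
      apply/matrixP => i j; rewrite !mxE; apply: eq_bigr => l _; rewrite !mxE.
      by rewrite qconjM qconj_cpt conjCK mulrA.
    rewrite cpt_cvec ctrmxM -!mulmxA /T.
    have -> : ctrmx ((qz z^*)%:M : 'M_1) = (qz z)%:M.
      by apply/matrixP => i j; rewrite !ord1 !mxE qconj_qz conjCK.
    by rewrite mul_scalar_mx [RHS]mxE mulmxA.
  rewrite -mulmxA -[K *m _ *m _]mulmxA mul_scalar_mx qconj_cpt cpt_cvec.
  by rewrite !mulmxA mulmx_scalarE.
have re2 : qre (qz z * hform u z z + hform u z z * qz z^*) = 2 * complex.Re z * qre
  (hform u z z).
  by case: (z) (hform u z z) => [x y] [????] /=; ring.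
have qreJ h : qre (qconj h) = qre h by [].
have conjT b b' : (ctrmx (cvec u b) *m ctrmx (frac_at F (cpt b' z)) *m cvec u b') 0 0 =
    qconj ((ctrmx (cvec u b') *m frac_at F (cpt b' z) *m cvec u b) 0 0).
  rewrite -[in LHS](ctrmxK (cvec u b')) -!ctrmxM mulmxA.
  by rewrite [LHS]mxE [in LHS]mxE.
have XE b b' : qz z * T b b' + T b b' * qz z^* =
    (ctrmx (cvec u b) *m frac_at F (cpt b z) *m cvec u b') 0 0 +
    qconj ((ctrmx (cvec u b') *m frac_at F (cpt b' z) *m cvec u b) 0 0).
  by rewrite key /X mulmxDr mulmxDl [LHS]mxE conjT.
pose S b b' := (ctrmx (cvec u b) *m frac_at F (cpt b z) *m cvec u b') 0 0.
have hE : hform u z z = T true true + T true false + (T false true + T false false).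
  exact: (sum_bool2 T).
have fE : fform u z = S true true + S true false + (S false true + S false false).
  exact: (sum_bool2 S).
have E b b' : qre (qz z * T b b' + T b b' * qz z^*) = qre (S b b') + qre (S b' b).
  by rewrite XE -/(S b b') -/(S b' b).
have reD p q : qre (p + q) = qre p + qre q by [].
clearbody T S; apply: (@mulfI _ 2); first by rewrite pnatr_eq0.
rewrite mulrA -re2 hE fE !(mulrDr, mulrDl) !reD.
have := (E true true, E true false, E false true, E false false).
by rewrite !reD => -[[[e1 e2] e3] e4]; lra.
Qed.

(** Here R enters: the piece of u at z yields the upper half of u^* R(z) u, and the piece at conj z
    yields the lower half after conjugation. *)
Lemma qchi1_fform u z : (qden F).[z] != 0 ->
  qchi1 (fform u z) =
  (adjmx u *m (map_mx (horner_eval z) (qnum F) *m u)) 0 0 / (qden F).[z].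
Proof.
move=> Qz.
have Qzc := horner_qden_conj z.
have Qz' : (qden F).[z^*] != 0 by rewrite Qzc conjC_eq0.
have fE : fform u z = \sum_(b : bool)
    (ctrmx (cvec u b) *m (frac_at F (cpt b z) *m unvcol u)) 0 0.
  apply: eq_bigr => b _.
  rewrite (@big_bool _ _ _ (fun b' => (ctrmx (cvec u b) *m frac_at F (cpt b z) *m cvec u
    b') 0 0)) /=.
  rewrite -mulmxA -[in X in _ + X]mulmxA.
  have -> : unvcol u = cvec u true + cvec u false.
    apply/colP => i; rewrite !mxE; apply: quat_eqP; rewrite raddfD /=.
      by rewrite !qchi1_mk add0r.
    by rewrite !qchi2_mk addr0.
  by rewrite !mulmxDr [RHS]mxE.
pose Y b := frac_at F (cpt b z) *m unvcol u.
pose a i := u (lshift n i) 0; pose d i := - (u (rshift n i) 0)^*.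
pose f1 i j w := (cpart1 (snum F i j)).[w]; pose f2 i j w := (cpart2 (snum F i j)).[w].
have Yt i w : (qden F).[w] != 0 -> let y := (frac_at F (qz w) *m unvcol u) i 0 in
   qchi1 y = (\sum_j (f1 i j w * a j - f2 i j w * (d j)^*)) / (qden F).[w] /\
   qchi2 y = (\sum_j (f1 i j w * d j + f2 i j w * (a j)^*)) / (qden F).[w].
  move=> Qw y; rewrite /y mxE !raddf_sum /= !mulr_suml.
  split; apply: eq_bigr => j _; rewrite frac_at_qz // ?qchi1M ?qchi2M mxE !(qchi1_mk,
    qchi2_mk).
    by rewrite mulrBl ![_ / _ * _]mulrAC.
  by rewrite mulrDl ![_ / _ * _]mulrAC.
rewrite fE (@big_bool _ _ _ (fun b => (ctrmx (cvec u b) *m Y b) 0 0)) /= raddfD /=.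
have cE b i : ctrmx (cvec u b) 0 i = qconj (cvec u b i 0) by rewrite mxE mxE.
have E1 : qchi1 ((ctrmx (cvec u false) *m Y false) 0 0) =
    (\sum_i (a i)^* * \sum_j (f1 i j z * a j - f2 i j z * (d j)^*)) / (qden F).[z].
  rewrite mxE raddf_sum mulr_suml; apply: eq_bigr => i _ /=.
  rewrite cE [cvec _ _ _ _]mxE qchi1M qchi1_conj qchi2_conj qchi1_mk qchi2_mk oppr0 mul0r
    subr0.
  by have [-> _] := Yt i z Qz; rewrite mulrA.
have E2 : qchi1 ((ctrmx (cvec u true) *m Y true) 0 0) =
    (\sum_i d i * (\sum_j (f1 i j z^* * d j + f2 i j z^* * (a j)^*))^*) / (qden F).[z].
  rewrite mxE raddf_sum mulr_suml; apply: eq_bigr => i _ /=.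
  rewrite cE [cvec _ _ _ _]mxE qchi1M qchi1_conj qchi2_conj qchi1_mk qchi2_mk conjC0
    mul0r sub0r mulNr opprK.
  have [_ ->] := Yt i z^* Qz'.
  by rewrite rmorphM fmorphV /= Qzc conjCK mulrA.
rewrite E1 E2 -mulrDl; congr (_ / _).
rewrite [RHS]mxE big_split_ord addrC; congr (_ + _); apply: eq_bigr => i _.
  rewrite [in RHS]mxE [in RHS]mxE; congr (_ * _);
    rewrite [RHS]mxE big_split_ord /= -big_split /=.
  apply: eq_bigr => j _; rewrite ![map_mx _ (qnum F) _ _]mxE block_mxEul block_mxEur !mxE.
  by rewrite /d rmorphN /= conjCK mulrN opprK.
rewrite [in RHS]mxE [in RHS]mxE /d mulNr -mulrN; congr (_ * _).
rewrite [RHS]mxE big_split_ord /= -big_split /= rmorph_sum -sumrN.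
apply: eq_bigr => j _; rewrite ![map_mx _ (qnum F) _ _]mxE block_mxEdl block_mxEdr !mxE.
rewrite /horner_eval /= hornerN !cconjE -/(f1 i j z^*) -/(f2 i j z^*) -/(a j).
by rewrite rmorphD !rmorphM rmorphN /= !conjCK; ring.
Qed.

End Compression.

(** * From finitely many negative squares to positivity on the axis *)

Section AxisPositivity.
Variables (R : rcfType) (n : nat) (F : srat R n n).
Notation H := (quat R).
Notation C := R[i].
Implicit Types (p q h : H) (z : C) (u : 'cV[C]_(n + n)) (b : bool) (f g : R -> H).

Lemma eq_cont0 f g : f =1 g -> cont0 f -> cont0 g.
Proof. by move=> /funext ->. Qed.

Lemma qzV z : qz z^-1 = (qz z)^-1.
Proof.
have [->|z0] := eqVneq z 0; first by rewrite invr0 -[qz 0]/(0 : H) invr0.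
have qz0 : qz z != 0 by rewrite qz_eq0.
by apply: (mulrI (x := qz z)); [exact: qz0 | rewrite -qzM !mulrV ?unitfE].
Qed.

Lemma cont0_horner (h : {poly C}) (w : R -> C) :
  cont0 (fun t => qz (w t)) -> cont0 (fun t => qz h.[w t]).
Proof.
move=> cw; apply: eq_cont0 (cont0_leval (cmk h 0) cw) => t /=.
by rewrite leval_qz cpart1_mk cpart2_mk horner0.
Qed.

Lemma cont0_ratio (h k : {poly C}) (w : R -> C) :
  cont0 (fun t => qz (w t)) -> k.[w 0] != 0 ->
  cont0 (fun t => qz (h.[w t] / k.[w t])).
Proof.
move=> cw kw.
apply: (@eq_cont0 (fun t => qz h.[w t] * (qz k.[w t])^-1)) => [t|].
  by rewrite qzM qzV.
by apply: cont0M; [exact: cont0_horner|apply: cont0V; [exact: cont0_horner|rewrite qz_eq0]].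
Qed.

Lemma cont0_frac_at f i j : cont0 f -> sden_at F (f 0) != 0 ->
  cont0 (fun t => frac_at F (f t) i j).
Proof.
move=> cf F0; apply: (@eq_cont0 (fun t => (sden_at F (f t))^-1 * leval (snum F i j) (f t))).
  by move=> t; rewrite /frac_at !mxE.
by apply: cont0M; [apply: cont0V => //; exact: cont0_leval|exact: cont0_leval].
Qed.

Lemma cont0_kfrac f g i j : cont0 f -> cont0 g ->
  sden_at F (f 0) != 0 -> sden_at F (g 0) != 0 ->
  (f 0) ^+ 2 + qreal (2 * qre (g 0)) * f 0 + qreal (qnormsq (g 0)) != 0 ->
  cont0 (fun t => kfrac F (f t) (g t) i j).
Proof.
move=> cf cg Ff Fg D0.
(* 2 Re q and |q|^2 are rewritten with the conjugate of q, so continuity follows from that of sums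
   and products. *)
pose D t := (f t) ^+ 2 + (g t + qconj (g t)) * f t + g t * qconj (g t).
have DE t : D t = (f t) ^+ 2 + qreal (2 * qre (g t)) * f t + qreal (qnormsq (g t)).
  rewrite /D; congr (_ + _ * _ + _); case: (g t) => a b c d; congr Quat;
  by rewrite /qnormsq /=; ring.
pose X t := frac_at F (f t) i j + qconj (frac_at F (g t) j i).
have cX : cont0 X by apply: cont0D; [|apply: cont0_conj]; exact: cont0_frac_at.
have cD : cont0 D.
  apply: cont0D; last by apply: cont0M => //; exact: cont0_conj.
  apply: cont0D; first exact: cont0X.
  by apply: cont0M => //; apply: cont0D => //; exact: cont0_conj.
apply: (@eq_cont0 (fun t => (D t)^-1 * (f t * X t + X t * g t))) => [t|].
  by rewrite DE /kfrac [RHS]mxE [in RHS]mxE mulmx_scalarE [in X in _ = _ * (X + _)]mxE /X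
    /frac_at !mxE.
apply: cont0M; first by apply: cont0V; rewrite ?DE.
by apply: cont0D; exact: cont0M.
Qed.

Lemma cont0_hform u (w w' : R -> C) :
  cont0 (fun t => qz (w t)) -> cont0 (fun t => qz (w' t)) ->
  (qden F).[w 0] != 0 -> (qden F).[w' 0] != 0 ->
  (forall b b', let p := cpt b (w 0) in let q := cpt b' (w' 0) in
    p ^+ 2 + qreal (2 * qre q) * p + qreal (qnormsq q) != 0) ->
  cont0 (fun t => hform F u (w t) (w' t)).
Proof.
move=> cw cw' Fw Fw' D0.
have cc b (v : R -> C) : cont0 (fun t => qz (v t)) -> cont0 (fun t => cpt b (v t)).
  case: b => // cv; apply: eq_cont0 (cont0_conj cv) => t.
  by rewrite qconj_qz.
have nz b z : (qden F).[z] != 0 -> sden_at F (cpt b z) != 0.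
  by move=> Fz; rewrite sden_at_qz qz_eq0; case: b => //;
    rewrite horner_qden_conj conjC_eq0.
apply: cont0_sum => b; apply: cont0_sum => b'.
apply: (@eq_cont0 (fun t => \sum_j (\sum_i qconj (cvec u b i 0) *
   kfrac F (cpt b (w t)) (cpt b' (w' t)) i j) * cvec u b' j 0)) => [t|].
  rewrite [RHS]mxE; apply: eq_bigr => j _; congr (_ * _); rewrite [RHS]mxE.
  by apply: eq_bigr => i _; congr (_ * _); rewrite mxE mxE.
apply: cont0_sum => j; apply: cont0M (cont0_cst _); apply: cont0_sum => i.
apply: cont0M (cont0_cst _) _; apply: cont0_kfrac; rewrite ?nz //; exact: cc.
Qed.

Definition aform u : {poly C} :=
  (map_mx polyC (adjmx u) *m (qnum F *m map_mx polyC u)) 0 0.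

Lemma aformE u z :
  (aform u).[z] = (adjmx u *m (map_mx (horner_eval z) (qnum F) *m u)) 0 0.
Proof.
have E m l (A : 'M[C]_(m, l)) : map_mx (horner_eval z) (map_mx polyC A) = A.
  by apply/matrixP => i j; rewrite !mxE /horner_eval hornerC.
have -> : adjmx u *m (map_mx (horner_eval z) (qnum F) *m u) =
    map_mx (horner_eval z) (map_mx polyC (adjmx u) *m (qnum F *m map_mx polyC u)).
  by rewrite !map_mxM !E.
by rewrite [RHS]mxE.
Qed.

(* On finitely many lines Im z = y_s the compressed Gram matrix has diagonal
   Re(u^* R(z) u) / Re z, tending to -oo at the axis, and bounded off-diagonal entries. *)
Lemma compressed_gram_negative r u (y : 'I_r -> R) :
  (forall s t, s != t -> y s ^+ 2 != y t ^+ 2) ->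
  (forall s, (qden F).[Complex 0 (y s)] != 0 /\
     complex.Re ((aform u).[Complex 0 (y s)] / (qden F).[Complex 0 (y s)]) < 0) ->
  exists2 e, 0 < e & (forall s, (qden F).[Complex e (y s)] != 0) /\
    forall xi : 'cV[H]_r, xi != 0 ->
      qre ((ctrmx xi *m
        (\matrix_(s, t) hform F u (Complex e (y s)) (Complex e (y t))) *m xi) 0 0) < 0.
Proof.
move=> ysep yneg; pose w s e : C := Complex e (y s).
have cw s : cont0 (fun e => qz (w s e)).
  apply: (@eq_cont0 (fun e => qreal e + qz (w s 0))) => [e|].
    by congr Quat; rewrite /= ?addr0 ?add0r.
  by apply: cont0D (cont0_cst _); exact: cont0_id.
pose ps s e := qz ((aform u).[w s e] / (qden F).[w s e]).
have cps s : cont0 (ps s) by apply: cont0_ratio; [exact: cw|case: (yneg s)].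
have n1 : near0 (fun e => forall s, qre (ps s e) <= qre (ps s 0) / 2).
  by apply: near0_all => s; apply: cont0_neg => //; case: (yneg s).
have n2 : near0 (fun e => forall s, (qden F).[w s e] != 0).
  apply: near0_all => s; have Q0 : qz (qden F).[w s 0] != 0.
    by rewrite qz_eq0; case: (yneg s).
  have := cont0_neq0 (cont0_horner (qden F) (cw s)) Q0; apply: near0_imp => e _ h.
  rewrite -qz_eq0 -qnorm_eq0 gt_eqF // (lt_le_trans _ h) // divr_gt0 //.
  by rewrite qnorm_gt0.
pose hst st e := hform F u (w st.1 e) (w st.2 e).
pose B st := if st.1 == st.2 then 0 else qnorm (hst st 0) + 1.
have n3 : near0 (fun e => forall st : 'I_r * 'I_r, st.1 != st.2 -> qnorm (hst st e) <= B
  st).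
  apply: near0_all => -[s t] /=; rewrite /B /=; have [st|st] := eqVneq s t.
    by exists 1.
  suff ch : cont0 (hst (s, t)) by apply: near0_imp (cont0_bounded ch).
  apply: cont0_hform; [exact: cw|exact: cw|by case: (yneg s)|by case: (yneg t)|].
  move=> b b' /=.
  (* On the axis the kernel denominator degenerates to y_t^2 - y_s^2. Since i y and - i y lie on one
     sphere, the squares have to differ, not only the heights. *)
  rewrite (_ : _ + _ = qreal (y t ^+ 2 - y s ^+ 2)); last first.
    by case: b; case: b'; rewrite /cpt; congr Quat; rewrite /qnormsq /=; ring.
  apply/eqP => -[/eqP]; rewrite subr_eq0; apply/negP.
  by rewrite eq_sym ysep.
pose BB := \sum_st B st.
have B0 st : 0 <= B st by rewrite /B; case: ifP => // _; rewrite addr_ge0 ?qnorm_ge0.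
have BB0 : 0 <= BB by apply: sumr_ge0.
(* For such e the diagonal entry, at most Re(ps s 0) / (2 e), lies below - r BB, as diagonal
   dominance requires. *)
have n4 : near0 (fun e => forall s, qre (ps s 0) / 2 < - (r%:R * BB) * e).
  apply: near0_all => s; set m := - (qre (ps s 0) / 2).
  have m0 : 0 < m by have [_] := yneg s; rewrite /m -[complex.Re _]/(qre (ps s 0)); lra.
  have rB : 0 < r%:R * BB + 1 by rewrite ltr_wpDl // mulr_ge0.
  exists (m / (r%:R * BB + 1)); first by rewrite divr_gt0.
  move=> e e0; rewrite ltr_pdivlMr // => em.
  by rewrite -[_ / 2]opprK -/m mulNr ltrN2 (le_lt_trans _ em) // mulrC ler_wpM2l ?ltW //
    ltrDl.
have [e e0 [[E1 E2] [E3 E4]]] := near0_ex (near0_and (near0_and n1 n2) (near0_and n3 n4)).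
exists e => //; split; first exact: E2.
apply: (@diag_dominant_neg _ _ _ BB) => // [s t st|s].
  rewrite mxE (le_trans (E3 (s, t) st)) // /BB (bigD1 (s, t)) //= lerDl.
  exact: sumr_ge0.
rewrite mxE -(ltr_pM2l e0) -/(w s e).
have := qre_hform F u (z := w s e) e0; rewrite /= => ->.
have -> : qre (fform F u (w s e)) = qre (ps s e).
  rewrite -[LHS]/(complex.Re (qchi1 _)) -[RHS]/(complex.Re (qchi1 (ps s e))).
  by rewrite qchi1_fform ?E2 // /ps qchi1_mk aformE.
by rewrite (le_lt_trans (E1 s)) // [ltRHS]mulrC E4.
Qed.

Lemma sden_at_cpt b z : (qden F).[z] != 0 -> sden_at F (cpt b z) != 0.
Proof.
by move=> Fz; rewrite sden_at_qz qz_eq0; case: b => //; rewrite horner_qden_conj conjC_eq0.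
Qed.

Lemma not_spole_cpt b z : (qden F).[z] != 0 -> ~~ spole F (cpt b z).
Proof.
move=> Fz; apply: nonroot_not_Rpole; rewrite /root.
have -> : qimnorm (cpt b z) = `|complex.Im z|.
  rewrite -sqrtr_sqr; congr Num.sqrt.
  by case: z {Fz} => x y; case: b => /=; ring.
rewrite cpt_re; case: z Fz => x y Fz /=.
have [y0|y0] := ler0P y; last by [].
by rewrite -[Complex x (- y)]/((Complex x y)^*)%R horner_qden_conj conjC_eq0.
Qed.

Lemma skernel_kfrac p q : sden_at F p != 0 -> sden_at F q != 0 ->
  skernel F p q = kfrac F p q.
Proof. by move=> Fp Fq; rewrite /skernel !sval_atE. Qed.

(** Each z_s gives two of the 2r points, one for each piece of u; compression by the stacked
    identities W adds the four corresponding blocks. *)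
Lemma compressed_gramE u r (z : 'I_r -> C) : (forall s, (qden F).[z s] != 0) ->
  let p k := match split k with inl s => cpt false (z s) | inr s => cpt true (z s) end in
  let c k := match @split r r k with inl _ => cvec u false | inr _ => cvec u true end in
  let W : 'M[H]_(r + r, r) := col_mx 1%:M 1%:M in
  ctrmx W *m gram (skernel F) p c *m W = \matrix_(s, t) hform F u (z s) (z t).
Proof.
move=> Fz p c W; set G := gram _ _ _.
have -> : ctrmx W = row_mx 1%:M 1%:M.
  rewrite /ctrmx tr_col_mx map_row_mx trmx1.
  have -> : map_mx (@qconj R) 1%:M = 1%:M :> 'M_r; last by [].
  by apply/matrixP => i j; rewrite !mxE; case: eqP => _; congr Quat; rewrite /= oppr0.
rewrite -(submxK G) mul_row_block mul_row_col !mul1mx !mulmx1.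
have pl s : p (lshift r s) = cpt false (z s) by rewrite /p (unsplitK (inl s)).
have pr s : p (rshift r s) = cpt true (z s) by rewrite /p (unsplitK (inr s)).
have cl s : c (lshift r s) = cvec u false by rewrite /c (unsplitK (inl s)).
have cr s : c (rshift r s) = cvec u true by rewrite /c (unsplitK (inr s)).
have nz b s : sden_at F (cpt b (z s)) != 0 by apply: sden_at_cpt.
apply/matrixP => s t; rewrite [RHS]mxE /hform sum_bool2.
have addE (X Y : 'M[H]_r) : (X + Y) s t = X s t + Y s t by rewrite mxE.
have ulE (X : 'M[H]_(r + r)) : ulsubmx X s t = X (lshift r s) (lshift r t) by rewrite !mxE.
have urE (X : 'M[H]_(r + r)) : ursubmx X s t = X (lshift r s) (rshift r t) by rewrite !mxE.
have dlE (X : 'M[H]_(r + r)) : dlsubmx X s t = X (rshift r s) (lshift r t) by rewrite !mxE.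
have drE (X : 'M[H]_(r + r)) : drsubmx X s t = X (rshift r s) (rshift r t) by rewrite !mxE.
have GE k l : G k l = (ctrmx (c k) *m skernel F (p k) (p l) *m c l) 0 0 by rewrite mxE.
clearbody G; rewrite !addE ulE urE dlE drE !GE !pl !pr !cl !cr !skernel_kfrac //.
have swap (x1 x2 x3 x4 : H) : x1 + x2 + (x3 + x4) = x4 + x2 + (x3 + x1).
  by rewrite [RHS]addrACA [LHS]addrC [x3 + x4]addrC [x1 + x2]addrC.
exact: swap.
Qed.

(** A negative value of u^* R u at an axis point persists on a segment of the axis. Choosing kappa +
    1 heights there gives a negative definite compression of that size, hence more negative
    eigenvalues than kappa. *)
Lemma GPE_axis_psd : GPE F -> axis_psd (csharp (qden F) *: qnum F).
Proof.
move=> [ev [kappa [herm le _]]] z0 z0E u.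
set N := csharp (qden F) *: qnum F.
have Nh : csharpmx N = N.
  move/sreqP: ev; rewrite qden_ssharp qnum_ssharp => ev.
  by rewrite /N csharpmxZ csharpK ev.
set v := (_ *m _ *m _) 0 0.
have vE : v = ((qden F).[z0])^* * (aform u).[z0].
  rewrite /v /N map_mxZ -mulmxA -scalemxAl -scalemxAr [LHS]mxE -aformE.
  by rewrite /= /horner_eval csharp_axis.
(* Realness is needed before the failure of 0 <= v can be turned into v < 0. *)
have vr : v \is Num.real.
  have h : adjmx (adjmx u *m map_mx (horner_eval z0) N *m u) = adjmx u *m map_mx
    (horner_eval z0) N *m u.
    rewrite !adjmxM -csharpmx_axis // Nh mulmxA; congr (_ *m _ *m _).
    by apply/matrixP => i j; rewrite !mxE conjCK.
  apply/CrealP; move/matrixP/(_ 0 0): h; rewrite [LHS]mxE [in LHS]mxE.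
  by [].
rewrite real_leNgt ?real0 //; apply/negP => v0.
have Q0 : (qden F).[z0] != 0.
  by apply: contraTneq v0 => Q0; rewrite vE Q0 conjC0 mul0r ltxx.
have [y0 zE] : exists y0, z0 = Complex 0 y0.
  exists (complex.Im z0); case: (z0) z0E => x y [/eqP].
  by rewrite -addr_eq0 -mulr2n mulrn_eq0 /= => /eqP -> _.
have neg0 : complex.Re ((aform u).[z0] / (qden F).[z0]) < 0.
  have : (aform u).[z0] / (qden F).[z0] < 0.
    rewrite -(pmulr_rlt0 _ (x := (qden F).[z0] * ((qden F).[z0])^*)) ?mul_conjC_gt0 //.
    by rewrite mulrC mulrA mulfVK // mulrC -vE.
  by rewrite ltcE => /andP[].
(* Moving away from 0 gives |y0 + sg t| = |y0| + t, so distinct t > 0 lead to distinct squares. *)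
pose sg : R := if 0 <= y0 then 1 else -1.
pose w t : C := Complex 0 (y0 + sg * t).
have cw : cont0 (fun t => qz (w t)).
  apply: (@eq_cont0 (fun t => qz (Complex 0 y0) + qreal t * qz (Complex 0 sg))) => [t|].
    by congr Quat => /=; ring.
  by apply: cont0D (cont0_cst _) _; apply: cont0M (@cont0_id R) (cont0_cst _).
have w0 : w 0 = z0 by rewrite /w zE mulr0 addr0.
have n1 := cont0_neg (cont0_ratio (aform u) cw (k := qden F) _) _.
rewrite w0 in n1; have {}n1 := n1 Q0 neg0.
have n2 := cont0_neq0 (cont0_horner (qden F) cw) _.
rewrite w0 qz_eq0 in n2; have {n1 n2} [d d0 nd] := near0_and n1 (n2 Q0).
(* One displacement more than kappa allows, evenly spaced strictly between 0 and d. *)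
pose r := kappa.+1; pose tt (s : 'I_r) : R := d * (s.+1%:R / r.+1%:R).
pose y s := y0 + sg * tt s.
have tt0 s : 0 < tt s by rewrite mulr_gt0 ?divr_gt0 ?ltr0n.
have ttd s : tt s < d.
  by rewrite /tt gtr_pMr // ltr_pdivrMr ?ltr0n // mul1r ltr_nat ltnS.
have ttI s t : tt s = tt t -> s = t.
  have dn0 : d != 0 by rewrite gt_eqF.
  have rn0 : (r.+1%:R : R)^-1 != 0 by rewrite invr_eq0 pnatr_eq0.
  by move/(mulfI dn0)/(mulIf rn0)/eqP; rewrite eqr_nat eqSS => /eqP/val_inj.
have ysq s : y s ^+ 2 = (`|y0| + tt s) ^+ 2.
  rewrite /y /sg; case: ifP => [y0p|/negbT]; first by rewrite ger0_norm // mul1r.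
  by rewrite -ltNge => y0n; rewrite ltr0_norm // mulN1r -sqrrN opprB addrC.
have ysep s t : s != t -> y s ^+ 2 != y t ^+ 2.
  apply: contraNneq => /eqP; rewrite !ysq eqrXn2 ?addr_ge0 ?(ltW (tt0 _)) //.
  by move/eqP/addrI/ttI ->.
have yneg s : (qden F).[Complex 0 (y s)] != 0 /\
     complex.Re ((aform u).[Complex 0 (y s)] / (qden F).[Complex 0 (y s)]) < 0.
  have [h1 h2] := nd (tt s) (tt0 s) (ttd s); rewrite -/(w (tt s)); split.
    rewrite -qz_eq0 -qnorm_gt0 (lt_le_trans _ h2) // divr_gt0 // qnorm_gt0.
    by rewrite qz_eq0.
  by apply: le_lt_trans h1 _; rewrite -[qre _]/(complex.Re _); lra.
have [e e0 [Qe neg]] := compressed_gram_negative ysep yneg.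
have gramE := compressed_gramE u Qe.
set p := fun k => _ in gramE; set c := fun k => _ in gramE.
set W := col_mx _ _ in gramE.
have Om k : [set p | right_half p /\ ~~ spole F p]%classic (p k).
  by split; rewrite /p; case: split => s; rewrite ?not_spole_cpt ///right_half /= ?cpt_re.
pose G := gram (skernel F) p c.
have Gh : ctrmx G = G.
  apply/matrixP => k l; rewrite [LHS]mxE [in LHS]mxE /G [in LHS]mxE [RHS]mxE.
  rewrite (herm _ _ (Om k) (Om l)).
  have E (X : 'M[H]_1) : qconj (X 0 0) = ctrmx X 0 0 by rewrite mxE mxE.
  by rewrite E !ctrmxM ctrmxK mulmxA.
have step k : (k <= r)%N -> neg_eig_ge G k.
  elim: k => [_|k IHk kr].
    exists 0, 0; split=> [[]//||c0 _]; first by rewrite mulmx0 mul0mx.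
    by rewrite [c0]flatmx0.
  apply: (neg_eig_step Gh (W := W)) kr (IHk (ltnW kr)) => xi xi0.
  by rewrite gramE; exact: neg.
by have := le _ p c Om _ (step r (leqnn r)); rewrite ltnn.
Qed.

End AxisPositivity.

(** * Descent to the quaternions *)

Section Descent.
Variables (R : rcfType) (n : nat).
Notation H := (quat R).
Notation C := R[i].
Notation J := (symplectic {poly C} n).
Implicit Types (f g : {poly C}) (z : C) (A B M : 'M[{poly C}]_(n + n)).

(* [- J] is the inverse of [J]; the range of chi is the set of fixed points. *)
Definition jconj M : 'M[{poly C}]_(n + n) := - (J *m map_mx (@cconj R) M *m J).

Lemma jconjM A B : jconj (A *m B) = jconj A *m jconj B.
Proof.
rewrite /jconj mulNmx mulmxN opprK map_mxM.
rewrite -!mulmxA [J *m (J *m _)]mulmxA symplecticK mulNmx mul1mx.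
by rewrite !mulmxN.
Qed.

Lemma jconjZ f A : jconj (f *: A) = cconj f *: jconj A.
Proof. by rewrite /jconj map_mxZ -scalemxAr -scalemxAl scalerN. Qed.

Lemma jconjB A B : jconj (A - B) = jconj A - jconj B.
Proof. by rewrite /jconj map_mxB mulmxBr mulmxBl opprB opprK addrC. Qed.

Lemma jconj_scalar f : jconj f%:M = (cconj f)%:M.
Proof.
by rewrite /jconj map_scalar_mx /= mul_mx_scalar -scalemxAl symplecticK scalerN opprK
  scalemx1.
Qed.

Lemma jconj_chip (P : 'M[{poly H}]_n) : jconj (chip P) = chip P.
Proof. by rewrite /jconj chip_symplectic -mulmxA symplecticK mulmxN mulmx1 opprK. Qed.

Lemma jconjP B : jconj B = B -> exists P : 'M[{poly H}]_n, B = chip P.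
Proof.
move=> BE; apply: chipP; rewrite -[in RHS]BE /jconj mulNmx -[J *m _ *m J *m J]mulmxA
  symplecticK.
by rewrite mulmxN mulmx1 opprK.
Qed.

Lemma cconj_csharp f : cconj (csharp f) = csharp (cconj f).
Proof.
apply/polyP => k; rewrite coef_cconj !coef_csharp coef_cconj rmorphM rmorphXn rmorphN.
by rewrite rmorph1.
Qed.

Lemma csharpmx_jconj M : csharpmx (jconj M) = jconj (csharpmx M).
Proof.
have Js : csharpmx J = - J.
  rewrite /symplectic csharpmx_block /csharpmx !trmx0 !map_mx0 linearN /= trmx1 map_mxN
    map_mx1.
  by rewrite opp_block_mx !oppr0 opprK.
have cs : csharpmx (map_mx (@cconj R) M) = map_mx (@cconj R) (csharpmx M).
  by apply/matrixP => i j; rewrite !mxE cconj_csharp.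
have NE (X : 'M[{poly C}]_(n + n)) : csharpmx (- X) = - csharpmx X.
  by rewrite /csharpmx linearN map_mxN.
by rewrite /jconj NE !csharpmxM Js cs !(mulNmx, mulmxN) opprK mulmxA.
Qed.

Lemma det_jconj M : \det (jconj M) = cconj (\det M).
Proof.
have JJ : - J *m J = 1%:M by rewrite mulNmx symplecticK opprK.
have d1 : \det (- J) * \det J = 1 by rewrite -det_mulmx JJ det1.
by rewrite /jconj -!mulNmx !det_mulmx det_map_mx mulrAC d1 mul1r.
Qed.

Lemma size_jconj M k : (forall i j, (size (M i j) <= k)%N) ->
  forall i j, (size (jconj M i j) <= k)%N.
Proof.
move=> sM i j; have E : jconj M = block_mx
    (map_mx (@cconj R) (drsubmx M)) (- map_mx (@cconj R) (dlsubmx M))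
    (- map_mx (@cconj R) (ursubmx M)) (map_mx (@cconj R) (ulsubmx M)).
  rewrite /jconj -{1}(submxK M) /symplectic map_block_mx !mulmx_block.
  rewrite !(mul0mx, mulmx0, mul1mx, mulmx1, mulNmx, mulmxN, add0r, addr0).
  by rewrite opp_block_mx !opprK.
rewrite E !mxE; case: splitP => i' _; rewrite !mxE; case: splitP => j' _;
  by rewrite !mxE ?size_polyN size_map_poly sM.
Qed.

Lemma cconj_realP f : cconj f = f -> exists Q : {poly R}, f = cpoly Q.
Proof.
move=> fE; exists (map_poly (@complex.Re R) f); apply/polyP => k.
rewrite coef_map coef_map_id0 //=; move/polyP/(_ k): fE; rewrite coef_cconj.
by rewrite -[_^*]/(conjc _); case: f`_k => x y [/eqP];
  rewrite eq_sym -addr_eq0 -mulr2n mulrn_eq0 /= => /eqP ->.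
Qed.

(** Both sides multiplied by B on the left give det B, which [cconj] fixes; B is then cancelled
    through its determinant. *)
Lemma jconj_adj B : \det B != 0 -> jconj B = B -> jconj (\adj B) = \adj B.
Proof.
move=> dB BE; apply: (scalemxI dB); rewrite -!mul_scalar_mx -mul_adj_mx -!mulmxA.
congr (_ *m _); rewrite mul_mx_adj -{1}BE -jconjM mul_mx_adj jconj_scalar.
by rewrite -det_jconj BE.
Qed.

End Descent.

(** * Quaternionic normalized factors for a half-plane *)

Section HalfPlaneFactors.
Variables (R : rcfType) (om : pred R).
Hypothesis om_anti : forall x, om x -> ~~ om (- x).
Hypothesis om_total : forall x, x != 0 -> om x \/ om (- x).
Notation H := (quat R).
Notation C := R[i].
(** A predicate on the real part treats both half-planes at once and is invariant under conjugation,
    which the descent to quaternions relies on. *)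
Let Om : pred C := fun z => om (complex.Re z).
Let Omega : set H := [set p | om (qre p)]%classic.

Let Om_anti z : Om z -> ~~ Om (- z^*).
Proof. by case: z => x y; exact: om_anti. Qed.

Let Om_total z : z != - z^* -> Om z \/ Om (- z^*).
Proof.
case: z => x y zN; apply: om_total; apply: contra zN => /eqP /= ->.
by apply/eqP; congr Complex; rewrite ?oppr0 ?opprK.
Qed.

(** [spole] certifies x + i |y| only; a point of the lower half-plane is reached through
    [regular_at_conj]. *)
Lemma no_poles_regular n (F : srat R n n) z :
  no_poles_in Omega F -> Om z -> regular_at (qnum F) (qden F) z.
Proof.
move=> Fp Omz.
have := Fp (qz z) Omz; rewrite /spole.
have -> : qimnorm (qz z) = `|complex.Im z|.
  by rewrite -sqrtr_sqr; congr Num.sqrt; case: (z) => x y /=; ring.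
move/not_Rpole_regular; case: z Omz => x y _ /=.
have [y0|//] := ler0P y.
by move/regular_at_conj; rewrite -[(_)^*]/(Complex x (- - y)) opprK.
Qed.

Lemma nonroot_no_poles n (F : srat R n n) :
  (forall z, Om z -> ~~ root (qden F) z) -> no_poles_in Omega F.
Proof. by move=> h p Op; apply: nonroot_not_Rpole; exact: h. Qed.

Lemma is_sinvP n (F G : srat R n n) : is_sinv F G <->
  qnum F *m qnum G = (qden F * qden G)%:M /\ qnum G *m qnum F = (qden G * qden F)%:M.
Proof.
rewrite /is_sinv !sreqP !qden_smul !qnum_smul !qden_sconst !qnum_sconst1.
by rewrite !scale1r !scalemx1.
Qed.

Lemma normalized_factor_unique n (F L L' : srat R n n) :
  normalized_factor Omega F L -> normalized_factor Omega F L' -> sreq L' L.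
Proof.
move=> [p [G [/is_sinvP[LG _] pG]] i /sreqP E] [p' [G' [/is_sinvP[LG' _] pG']] i' /sreqP
  E'].
apply/sreqP; rewrite !(qden_smul, qnum_smul, qden_ssharp, qnum_ssharp) in E E'.
apply: (spectral_factor_unique (Om := Om) (q := qden F) (A := qnum F)
  (h := qden G) (W := qnum G) (h' := qden G') (W' := qnum G')) => //;
  try exact: qden_neq0.
- by move=> z Omz; split; exact: no_poles_regular.
- by move=> z Omz; split; exact: no_poles_regular.
- exact: svalue_infty_near_scalar.
exact: svalue_infty_near_scalar.
Qed.

Lemma normalized_factor_exists n (F : srat R n n) :
  GPE F -> svalue_infty F 1%:M -> exists L, normalized_factor Omega F L.
Proof.
move=> gF F1; pose q := qden F; pose A := qnum F; have q0 : q != 0 by exact: qden_neq0.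
have sA := svalue_infty_near_scalar F1.
have AS : q *: csharpmx A = csharp q *: A.
  by case: gF => /sreqP ev _; rewrite qden_ssharp qnum_ssharp in ev.
have [g [M [g0 dM0 rgM ME sM]]] :=
  spectral_factor_exists Om_anti q0 AS (GPE_axis_psd gF) sA.
have rconj f z : root (cconj f) z = root f (z^*).
  by rewrite /root cconjE conjC_eq0.
have Omc z : Om z -> Om z^* by case: z.
have cg0 : cconj g != 0 by rewrite map_poly_eq0.
(* jconj M / conj g is another normalized factor: R is fixed by [jconj] and [Om] by conjugation. The
   adjugates provide the inverses that the uniqueness lemma asks for. *)
have key : g *: jconj M = cconj g *: M.
  apply: (spectral_factor_unique (Om := Om) (q := q) (A := A)
    (h := \det M) (W := g *: \adj M)
    (h' := \det (jconj M)) (W' := cconj g *: \adj (jconj M))) => //.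
  - by rewrite det_jconj map_poly_eq0.
  - have qc : cconj q = q := cconj_cpoly _.
    rewrite csharpmx_jconj -jconjM -{1}qc -jconjZ ME jconjZ jconj_chip.
    by rewrite rmorphM /= cconj_csharp.
  - by rewrite -scalemxAr mul_mx_adj scale_scalar_mx.
  - by rewrite -scalemxAr mul_mx_adj scale_scalar_mx.
  - by move=> z /rgM[rg rM]; split; exact: regular_at_nonroot.
  - move=> z /Omc/rgM[rg rM]; split; apply: regular_at_nonroot; rewrite ?det_jconj rconj //.
  move=> i j; pose E := M - g%:M.
  have -> : jconj M i j - cconj g *+ (i == j) = jconj E i j.
    by rewrite /E jconjB jconj_scalar [RHS]mxE [in X in _ = _ + X]mxE [in X in _ = _ +
      X]mxE.
  have sg : size (cconj g) = (size g).-1.+1.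
    by rewrite size_map_poly prednK // lt0n size_poly_eq0.
  rewrite sg ltnS; apply: size_jconj => {}i {}j.
  rewrite -ltnS prednK ?lt0n ?size_poly_eq0 //.
  suff -> : E i j = M i j - g *+ (i == j) by exact: sM.
  by rewrite /E [LHS]mxE [in X in _ + X = _]mxE [in X in _ + X = _]mxE.
(* M / g is rewritten as B / D. It is B, and not M, that [jconj] fixes, and D has real coefficients,
   so the pair comes from a quaternionic fraction. *)
pose B := cconj g *: M; pose D := g * cconj g.
have D0 : D != 0 by rewrite mulf_neq0.
have Dc : cconj D = D by rewrite rmorphM /= cconjK mulrC.
have BE : jconj B = B by rewrite /B jconjZ cconjK.
have dB : \det B = cconj g ^+ (n + n) * \det M by rewrite detZ.
have dB0 : \det B != 0 by rewrite dB mulf_neq0 ?expf_neq0.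
have [P PE] := jconjP BE.
have [Dr DE] := cconj_realP Dc.
have [dr drE] : exists Q : {poly R}, \det B = cpoly Q.
  by apply: cconj_realP; rewrite -det_jconj BE.
have [Y YE] : exists Y : 'M[{poly H}]_n, D *: \adj B = chip Y.
  by apply: jconjP; rewrite jconjZ Dc jconj_adj.
have Dr0 : Dr != 0 by apply: contraNneq D0 => E; rewrite DE E /cpoly map_poly0.
have dr0 : dr != 0 by apply: contraNneq dB0 => E; rewrite drE E /cpoly map_poly0.
(* The inverse of B / D is D adj B / det B, with det B real. Its possible poles are roots of conj g
   and of det M, all outside [Om]. *)
pose L : srat R n n := SRat Dr0 P; pose G : srat R n n := SRat dr0 Y.
have LD : qden L = D by rewrite DE.
have LN : qnum L = B by rewrite PE.
have GD : qden G = \det B by rewrite drE.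
have GN : qnum G = D *: \adj B by rewrite YE.
have rD z : Om z -> ~~ root D z.
  move=> Omz; rewrite rootM negb_or rconj; have [-> _] := rgM z Omz.
  by have [-> _] := rgM _ (Omc _ Omz).
exists L; split.
- by apply: nonroot_no_poles; rewrite LD.
- exists G; split.
    apply/is_sinvP; rewrite LD LN GD GN -[B *m (D *: _)]scalemxAr -[D *: _ *m B]scalemxAl.
    rewrite mul_mx_adj mul_adj_mx.
    by rewrite scale_scalar_mx [\det B * D]mulrC.
  apply: nonroot_no_poles => z Omz; rewrite GD dB rootM negb_or.
  have [_ ->] := rgM z Omz; rewrite andbT; apply: contra (rD z Omz) => rg.
  rewrite /D rootM; apply/orP; right; move: rg; rewrite /root horner_exp expf_eq0.
  by case/andP.
- apply: near_scalar_svalue_infty => i j; rewrite LD LN.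
  have -> : B i j - D *+ (i == j) = cconj g * (M i j - g *+ (i == j)).
    by rewrite [X in X - _]mxE mulrBr mulrnAr /D [g * _]mulrC.
  have [->|E0] := eqVneq (M i j - g *+ (i == j)) 0.
    by rewrite mulr0 size_poly0 lt0n size_poly_eq0.
  rewrite /D mulrC !size_mul // -!subn1 ltn_sub2r //.
    have sg0 : (0 < size g)%N by rewrite lt0n size_poly_eq0.
    by rewrite size_map_poly; exact: (leq_add sg0 sg0).
  by rewrite ltn_add2r sM.
apply/sreqP; rewrite !(qden_smul, qnum_smul, qden_ssharp, qnum_ssharp) LD LN.
transitivity ((csharp (cconj g) * cconj g) *: (q *: (csharpmx M *m M))).
  by rewrite ME scalerA /D; congr (_ *: _); rewrite [csharp (_ * _)]rmorphM /=; ring.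
by rewrite /B csharpmxZ -scalemxAr -scalemxAl !scalerA; congr (_ *: _); rewrite /q; ring.
Qed.

Lemma spectral_factorization n (F : srat R n n) : GPE F -> svalue_infty F 1%:M ->
  exists L, normalized_factor Omega F L /\
    forall L', normalized_factor Omega F L' -> sreq L' L.
Proof.
move=> gF F1; have [L LF] := normalized_factor_exists gF F1.
by exists L; split=> // L'; exact: normalized_factor_unique.
Qed.

End HalfPlaneFactors.

Local Close Scope ring_scope.


Theorem theorem1p3 (R : realType) (n N : nat) (Phi : srat R n n)
    (A : 'M[quat R]_N) (B : 'M[quat R]_(N, n)) (C : 'M[quat R]_(n, N)) :
  GPE Phi ->
  svalue_infty Phi (1%:M)%R ->
  minimal_realization Phi A B C (1%:M)%R ->
  (exists Lp : srat R n n,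
     normalized_factor (@right_half R) Phi Lp /\
     forall L : srat R n n, normalized_factor (@right_half R) Phi L -> sreq L Lp) /\
  (exists Lm : srat R n n,
     normalized_factor (@left_half R) Phi Lm /\
     forall L : srat R n n, normalized_factor (@left_half R) Phi L -> sreq L Lm).
Proof.
move=> gpe infty _; split.
  apply: (@spectral_factorization R (fun x => 0 < x)%R) => // x.
    by rewrite oppr_gt0 -leNgt => /ltW.
  by rewrite oppr_gt0 neq_lt => /orP[]; [right|left].
apply: (@spectral_factorization R (fun x => x < 0)%R) => // x.
  by rewrite oppr_lt0 -leNgt => /ltW.
by rewrite oppr_lt0 neq_lt => /orP[]; [left|right].
Qed.
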